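(* Let $\Sigma$ be the free semigroup (with identity $e$) on a finite or countable non-empty set $W$, let $\mu$ be a generating probability measure on $\Sigma$, and let $(\partial\Sigma,\lambda)$ be the space of infinite words in the generators equipped with the hitting measure $\lambda$ of the random walk $(\Sigma,\mu)$. Suppose that there exists a word $w\neq e$ in $\Sigma$ such that $\mu$ has finite logarithmic $w$-moment, i.e. $\sum_{g\in\Sigma}\mu(g)\log|g|_w<\infty$. Then $(\partial\Sigma,\lambda)$ is the Poisson boundary of the random walk $(\Sigma,\mu)$.
   Context: Free semigroup: $\Sigma$ is the set of finite words in the alphabet $W$ with concatenation; the empty word is the identity $e$; $|g|$ is the length of the word $g$. The $w$-norm: for $w,g\in\Sigma$, $|g|_w:=\mathrm{card}\{g'\in\Sigma : g=g'wg''\text{ for some }g''\in\Sigma\}+|w|$, i.e. the number of occurrences of $w$ as a subword (block of consecutive letters) of $g$, plus the length of $w$. Generating: a probability measure $\mu$ on $\Sigma$ is generating if the semigroup with identity generated by its support is all of $\Sigma$. Random walk: for $g\in\Sigma$, $\mathbf{P}_g$ denotes the law, on the space $\Omega$ of sample paths $(x_n)_{n\ge 0}$ in $\Sigma$, of the process $x_0=g$, $x_n=g\,g_1\cdots g_n$, where $g_1,g_2,\dots$ are i.i.d. with law $\mu$. Put $\mathbf{P}=\mathbf{P}_e$. Infinite words and hitting measure: $\partial\Sigma=W^{\{1,2,\dots\}}$ with the product $\sigma$-algebra. A sequence of finite words $x_n$ converges to an infinite word $\boldsymbol{g}\in\partial\Sigma$ if every finite prefix of $\boldsymbol{g}$ is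 a prefix of $x_n$ for all sufficiently large $n$. $\mathbf{P}$-almost every sample path converges to a point of $\partial\Sigma$; the hitting measure $\lambda$ is the law of $\lim_n x_n$ under $\mathbf{P}$. Poisson boundary: fix a probability measure $m$ on $\Sigma$ with $m(g)>0$ for all $g$ and let $\mathbf{P}_m=\sum_g m(g)\mathbf{P}_g$. Two sample paths $(x_n),(y_n)$ are equivalent if there are $i,j\ge 0$ with $x_{n+i}=y_{n+j}$ for all $n\ge0$. Let $\mathcal{A}$ be the $\sigma$-algebra (mod $0$ with respect to $\mathbf{P}_m$) of all measurable unions of equivalence classes. There are a (unique up to isomorphism) measurable space $\Gamma$ and a measurable map $\mathrm{bnd}:\Omega\to\Gamma$ such that $\mathcal{A}$ coincides mod $0$ with the $\sigma$-algebra of $\mathrm{bnd}$-preimages of measurable sets. The Poisson boundary is $(\Gamma,\nu)$ with $\nu=\mathrm{bnd}_\star\mathbf{P}$. The limit map $(x_n)\mapsto\lim_n x_n\in\partial\Sigma$ factors (mod $0$) through $\mathrm{bnd}$, giving a map $\Lambda:\Gamma\to\partial\Sigma$ with $\Lambda_\star\nu=\lambda$. Saying that $(\partial\Sigma,\lambda)$ is the Poisson boundary means that $\Lambda:(\Gamma,\nu)\to(\partial\Sigma,\lambda)$ is an isomorphism mod $0$; equivalently, every set in $\mathcal{A}$ coincides, up to a $\mathbf{P}$-null set, with the preimage under the limit map of a measurable subset of $\partial\Sigma$. *)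

(* Defs.v *)
From HB Require Import structures.
From mathcomp Require Import all_boot all_order all_algebra finmap.
From mathcomp Require Import all_classical all_reals all_analysis.

Set Implicit Arguments.
Unset Strict Implicit.
Unset Printing Implicit Defensive.
Import Order.TTheory GRing.Theory Num.Theory.

Local Open Scope classical_set_scope.
Local Open Scope ring_scope.

(* A finite or countable non-empty alphabet; the distinguished point is only
   used as a junk value. *)
#[short(type="alphabet")]
HB.structure Definition Alphabet := {W of Countable W & isPointed W}.

(* The free semigroup with identity: concatenation is [++], [e] is [[::]],
   the length is [size].  It carries the discrete sigma-algebra. *)
Definition word (W : Type) : Type := seq W.

HB.instance Definition _ (W : countType) := Countable.copy (word W) (seq W).
HB.instance Definition _ (W : countType) := isPointed.Build (word W) [::].
HB.instance Definition _ (W : countType) :=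
  @isMeasurable.Build default_measure_display (word W) discrete_measurable
    discrete_measurable0 discrete_measurableC discrete_measurableU.

(* The space of sequences in [A] with the product of the discrete
   sigma-algebras. *)
Definition seq_space (A : Type) : Type := nat -> A.

Definition coordinate_sets (A : Type) : set (set (seq_space A)) :=
  \bigcup_n preimage_set_system setT (fun x : seq_space A => x n)
              discrete_measurable.

HB.instance Definition _ (A : pointedType) :=
  Pointed.copy (seq_space A) (nat -> A).
HB.instance Definition _ (A : pointedType) :=
  Measurable.copy (seq_space A) (g_sigma_algebraType (@coordinate_sets A)).

Notation path_space W := (seq_space (word W)).

(* Infinite words; the letter with index [n : nat] is the (n+1)-st one. *)
Notation infinite_word W := (seq_space W).

Section free_semigroup.
Context {R : realType} {W : alphabet}.
Implicit Types (w g : word W) (mu m : probability (word W) R).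

Definition occurrences w g : set (word W) :=
  [set g' | exists g'' : word W, g = g' ++ w ++ g''].

(* [fset_set] is only meaningful on finite sets. *)
Lemma finite_occurrences w g : finite_set (occurrences w g).
Proof.
apply: (@sub_finite_set _ _ ((fun i => take i g) @` `I_(size g).+1)).
  move=> g' [g'' gE]; exists (size g'); last by rewrite gE take_size_cat.
  by rewrite /= ltnS gE size_cat leq_addr.
exact/finite_image/finite_II.
Qed.

Definition wnorm w g : nat := (#|` fset_set (occurrences w g)| + size w)%N.

Definition log_moment mu w : \bar R :=
  \esum_(g in [set: word W]) (mu [set g] * (ln (wnorm w g)%:R)%:E)%E.

Definition subsemigroup_with_identity (S : set (word W)) : Prop :=
  S [::] /\ forall g h, S g -> S h -> S (g ++ h).

Definition generating mu : Prop :=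
  smallest subsemigroup_with_identity [set g | (0 < mu [set g])%E] = setT.

Definition converges (x : path_space W) (g : infinite_word W) : Prop :=
  forall k, \forall n \near \oo, prefix (mkseq g k) (x n).

(* A junk value off the set of convergent paths. *)
Definition limit_word (x : path_space W) : infinite_word W :=
  xget point [set g | converges x g].

Definition tail_equiv (x y : path_space W) : Prop :=
  exists i j, forall n, x (n + i)%N = y (n + j)%N.

Definition tail_measurable (A : set (path_space W)) : Prop :=
  measurable A /\ forall x y, tail_equiv x y -> A x -> A y.

Definition tail_measurable_mod0 (Q : set (path_space W) -> \bar R)
    (A : set (path_space W)) : Prop :=
  measurable A /\ exists2 B, tail_measurable B & Q (A `+` B) = 0%E.

End free_semigroup.

Section random_walk.
Context {R : realType} {W : alphabet}.
Context {d : measure_display} {T : measurableType d} (Pr : probability T R).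
Implicit Types (mu m : probability (word W) R).

Definition mutually_independent (xi : nat -> {mfun T >-> word W}) : Prop :=
  forall (J : {fset nat}) (B : nat -> set (word W)),
    Pr (\bigcap_(n in [set` J]) (xi n @^-1` B n)) =
    (\prod_(n <- J) Pr (xi n @^-1` B n))%E.

Definition iid mu (xi : nat -> {mfun T >-> word W}) : Prop :=
  (forall n A, distribution Pr (xi n) A = mu A) /\ mutually_independent xi.

(* [xi i] is the (i+1)-st increment. *)
Definition walk (xi : nat -> {mfun T >-> word W}) (g : word W) (t : T) :
    path_space W :=
  fun n => g ++ flatten (mkseq (fun i => xi i t) n).

Definition walk_law (xi : nat -> {mfun T >-> word W}) (g : word W) :
    set (path_space W) -> \bar R :=
  pushforward Pr (walk xi g).

Definition walk_law_init m (xi : nat -> {mfun T >-> word W})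
    (A : set (path_space W)) : \bar R :=
  \esum_(g in [set: word W]) (m [set g] * walk_law xi g A)%E.

End random_walk.

Section isomorphism.
Context (R : realType).

Definition standard_borel d (G : measurableType d) : Prop :=
  exists phi : G -> R, [/\ injective phi, measurable_fun setT phi &
    forall C, measurable C -> measurable (phi @` C)].

Definition isomorphism_mod0 d1 d2 (G1 : measurableType d1)
    (G2 : measurableType d2) (nu1 : set G1 -> \bar R) (nu2 : set G2 -> \bar R)
    (f : G1 -> G2) : Prop :=
  (forall C, measurable C -> nu1 (f @^-1` C) = nu2 C) /\
  exists A B, [/\ measurable A /\ nu1 (~` A) = 0%E,
    measurable B /\ nu2 (~` B) = 0%E, set_bij A B f,
    measurable_fun A f &
    forall C, measurable C -> C `<=` A -> measurable (f @` C)].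

End isomorphism.

Section poisson_boundary.
Context {R : realType} {W : alphabet}.
Implicit Types (P Pm : set (path_space W) -> \bar R).

(* [bnd] generates the sigma-algebra of tail-measurable sets mod 0. *)
Definition is_bnd Pm d (G : measurableType d) (bnd : path_space W -> G) :
    Prop :=
  [/\ measurable_fun setT bnd,
    forall A, tail_measurable_mod0 Pm A ->
      exists2 C, measurable C & Pm (A `+` bnd @^-1` C) = 0%E &
    forall C, measurable C -> tail_measurable_mod0 Pm (bnd @^-1` C)].

(* The first conjunct says that, for every realization [(G, bnd_* P)] of the
   Poisson boundary, the map [L] through which the limit map factors is an
   isomorphism mod 0.  The target of [bnd] has to be standard for the boundary
   to be unique up to isomorphism.  The second conjunct is the same assertion
   in terms of sigma-algebras; it does not refer to any [G]. *)
Definition infinite_words_are_poisson_boundary P Pm : Prop :=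
  (forall d (G : measurableType d) (bnd : path_space W -> G),
    standard_borel R G -> is_bnd Pm bnd ->
    exists L : G -> infinite_word W,
      [/\ measurable_fun setT L,
        Pm [set x | L (bnd x) <> limit_word x] = 0%E &
        isomorphism_mod0 (pushforward P bnd) (pushforward P limit_word) L]) /\
  (forall A, tail_measurable_mod0 Pm A ->
    exists2 B : set (infinite_word W), measurable B &
      P (A `+` limit_word @^-1` B) = 0%E).

End poisson_boundary.

(* Main.v *)
Require Import Defs.
From HB Require Import structures.
From mathcomp Require Import all_boot all_order all_algebra finmap.
From mathcomp Require Import all_classical all_reals all_analysis.
From mathcomp Require Import measurable_realfun lra ring.

(** Resample the walk at the times when its increment equals [w]: the resulting
    step law [nu] has the same bounded harmonic functions as [mu], is carried by
    words ending with [w], and still has a finite logarithmic moment.  Positions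
    of the resampled walk that are prefixes of the same infinite word are
    distinguished by their numbers of occurrences of [w].  Hence, given the limit
    word, the entropy of the position at time [n] is at most the expected
    logarithm of its norm (up to a factor), which is o(n).

    If the conditional law of the first increment given the limit word differed,
    when tested against a bounded harmonic function, from its conditional law
    given also the position at time [n], then the conditional entropy would grow
    linearly.  So for a tail event [B] and a possible first increment [g] the
    probability of [B] after [g] is the integral of [F (g x)], where [F] is the
    conditional probability of [B] given the limit word.  The mean of [F (1 - F)]
    at the limit word is then a harmonic function lying below the probabilities
    of [B] and of its complement, so it vanishes by the 0-1 law: [F] is an
    indicator, and [B] is determined by the limit word. *)

Set Implicit Arguments.
Unset Strict Implicit.
Unset Printing Implicit Defensive.
Import Order.TTheory GRing.Theory Num.Theory.

Local Open Scope classical_set_scope.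
Local Open Scope ring_scope.

(** * Convolution of measures on words *)

(** Two obstacles shape the proof. First, [mu] need not charge [w]. The walk is therefore observed
    at geometric times, which keeps its bounded harmonic functions and makes every word a possible
    increment; only then is it resampled at increments equal to [w]. Beforehand [w] is replaced by
    [w ++ w]: no letter then equals the distinguished word, so the resampled law charges every word
    that ends with it. Second, a logarithmic moment bounds neither the entropy of [mu] nor that of
    the resampled law. Only entropies conditional on the limit word occur, and as they may be
    infinite too, the inequalities between them are stated without subtraction.

    The linear growth comes from a relative entropy tested against a small multiple [dl] of a
    harmonic function: a discrepancy yields a gain of order [dl] at a cost of order [dl ^+ 2]. The
    sublinear bound comes from cutting increments at norm [c]: small ones contribute the logarithm
    of a multiple of [n], large ones [n] times a small tail of the moment. *)

Section probability_integrals.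
Context d (T : measurableType d) (R : realType) (P : probability T R).
Local Open Scope ereal_scope.

Lemma probability_integralDl (c : \bar R) (f : T -> \bar R) :
  0 <= c -> measurable_fun setT f -> (forall x, 0 <= f x) ->
  \int[P]_x (c + f x) = c + \int[P]_x f x.
Proof.
move=> c0 mf f0; rewrite ge0_integralD//.
by rewrite (integral_cst P measurableT c) (_ : _ setT = 1) ?mule1//; exact: probability_setT.
Qed.

Lemma probability_integral_cst (c : \bar R) : \int[P]_x c = c.
Proof.
by rewrite (integral_cst P measurableT c) (_ : _ setT = 1) ?mule1//; exact: probability_setT.
Qed.

Lemma ae_not_indic (B : set T) : measurable B -> P B = 0 ->
  {ae P, forall x, ~ B x}.
Proof. by move=> mB PB; exists B; split => // x /= /contrapT. Qed.

End probability_integrals.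

Section countable_discrete.
Context {R : realType} {W : alphabet}.
Local Open Scope ereal_scope.

Lemma measurable_fun_word d (Y : measurableType d) (D : set (word W))
  (f : word W -> Y) : measurable_fun D f.
Proof. by []. Qed.

Lemma measurable_fun_word_prod d d' (X : measurableType d)
    (Y : measurableType d') (f : word W * X -> Y) :
  (forall g, measurable_fun setT (fun x => f (g, x))) -> measurable_fun setT f.
Proof.
move=> mf _ B mB; rewrite setTI.
have -> : f @^-1` B =
    \bigcup_g ([set g] `*` ((fun x => f (g, x)) @^-1` B)).
  apply/seteqP; split => [[g x] /= fB|[g x] [g' _ [/= -> ]]//].
  by exists g.
apply: countable_bigcupT_measurable => [|g]; first exact: countableP.
by apply: measurableX => //; rewrite -[X in measurable X]setTI; exact: mf.
Qed.

Lemma integral_word (nu : {measure set (word W) -> \bar R}) (f : word W -> \bar R) :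
  (forall x, 0 <= f x) ->
  \int[nu]_x f x = \esum_(x in setT) (nu [set x] * f x).
Proof.
move=> f0.
(* The fibres of [pickle] are empty or singletons, so the integral splits into a countable sum over
   disjoint pieces. *)
pose F i := [set x : word W | choice.pickle x = i].
have FT : \bigcup_i F i = setT by apply/seteqP; split => // x _; exists (choice.pickle x).
have tF : trivIset setT F by move=> i j _ _ [x [<- <-]].
rewrite -FT ge0_integral_bigcup//.
rewrite esum_bigcupT//; last by move=> x; rewrite mule_ge0.
rewrite nneseries_esumT; last by move=> i; exact: integral_ge0.
apply: eq_esum => i _.
have [[x Fx]|F0] := pselect (exists x, F i x).
  have -> : F i = [set x].
    by apply/seteqP; split => [y Fy|y ->//]; apply: (pcan_inj choice.pickleK); rewrite Fy Fx.
  rewrite esum_set1 ?mule_ge0// (eq_integral (cst (f x))).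
    by rewrite integral_cst// muleC.
  by move=> y; rewrite inE => ->.
have -> : F i = set0 by apply/seteqP; split => // x Fx; case: F0; exists x.
by rewrite integral_set0 esum_set0.
Qed.

Lemma eq_integral_word (nu : {measure set (word W) -> \bar R})
    (f g : word W -> \bar R) : (forall x, 0 <= f x) -> (forall x, 0 <= g x) ->
  (forall x, nu [set x] != 0 -> f x = g x) -> \int[nu]_x f x = \int[nu]_x g x.
Proof.
move=> f0 g0 fg; rewrite !integral_word//; apply: eq_esum => x _.
by have [->|/fg->//] := eqVneq (nu [set x]) 0; rewrite !mul0e.
Qed.

Lemma le_integral_word (nu : {measure set (word W) -> \bar R})
    (f g : word W -> \bar R) : (forall x, 0 <= f x) -> (forall x, 0 <= g x) ->
  (forall x, nu [set x] != 0 -> f x <= g x) -> \int[nu]_x f x <= \int[nu]_x g x.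
Proof.
move=> f0 g0 fg; rewrite !integral_word//; apply: le_esum => x _.
have [->|/fg ?] := eqVneq (nu [set x]) 0; first by rewrite !mul0e.
by rewrite lee_wpmul2l.
Qed.

Lemma integral_word_ge (nu : {measure set (word W) -> \bar R})
    (f : word W -> \bar R) x : (forall x, 0 <= f x) ->
  nu [set x] * f x <= \int[nu]_x f x.
Proof.
move=> f0; rewrite integral_word// -(@esum_set1 _ _ x (fun x => nu [set x] * f x));
  last by rewrite mule_ge0.
rewrite [leLHS]esum_mkcond; apply: le_esum => y _.
by case: ifPn => // _; rewrite mule_ge0.
Qed.

Lemma integral_word_set (nu : {measure set (word W) -> \bar R}) (A : set (word W)) :
  nu A = \int[nu]_x (\1_A x)%:E.
Proof. by rewrite integral_indic// setIT. Qed.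

End countable_discrete.

Section convolution.
Context {R : realType} {W : alphabet}.
Implicit Types p q nu : probability (word W) R.
Local Open Scope ereal_scope.

Definition cat_pair (x : word W * word W) : word W := x.1 ++ x.2.

Lemma measurable_cat_pair : measurable_fun setT cat_pair.
Proof. by apply: measurable_fun_word_prod => g; exact: measurable_fun_word. Qed.

HB.instance Definition _ :=
  isMeasurableFun.Build _ _ _ _ cat_pair measurable_cat_pair.

Definition convol p q : probability (word W) R :=
  distribution (p \x q) cat_pair.

Lemma integral_convol p q (f : word W -> \bar R) : (forall x, 0 <= f x) ->
  \int[convol p q]_x f x = \int[p]_s \int[q]_t f (s ++ t).
Proof.
move=> f0; rewrite ge0_integral_distribution//.
have mf : measurable_fun setT (fun z : word W * word W => f (z.1 ++ z.2)).
  by apply: measurable_fun_word_prod => g; exact: measurable_fun_word.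
by rewrite -(fubini_tonelli1 (fun z : word W * word W => f (z.1 ++ z.2))).
Qed.

Fixpoint convol_iter nu n : probability (word W) R :=
  if n is n'.+1 then convol nu (convol_iter nu n') else dirac ([::] : word W).

Lemma integral_convol_iter0 nu (f : word W -> \bar R) :
  \int[convol_iter nu 0]_x f x = f [::].
Proof. by rewrite integral_dirac// diracT mul1e. Qed.

Lemma integral_convol_iterS nu n (f : word W -> \bar R) : (forall x, 0 <= f x) ->
  \int[convol_iter nu n.+1]_x f x = \int[nu]_s \int[convol_iter nu n]_t f (s ++ t).
Proof. by move=> f0; rewrite integral_convol. Qed.

(** [convol_iter] splits off the first step. The last step is needed to see how a word ends, and to
    see that averages of superharmonic functions decrease. *)
Lemma integral_convol_iterSr nu n (f : word W -> \bar R) : (forall x, 0 <= f x) ->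
  \int[convol_iter nu n.+1]_x f x = \int[convol_iter nu n]_s \int[nu]_t f (s ++ t).
Proof.
elim: n f => [|n IHn] f f0.
  rewrite integral_convol_iter0 integral_convol_iterS//; apply: eq_integral => s _.
  by rewrite integral_convol_iter0 cats0.
rewrite integral_convol_iterS//.
under eq_integral do rewrite IHn//.
rewrite [RHS]integral_convol_iterS; last by move=> x; exact: integral_ge0.
apply: eq_integral => s _; apply: eq_integral => t _; apply: eq_integral => u _.
by rewrite catA.
Qed.

Lemma convol_ge p q s t : p [set s] * q [set t] <= convol p q [set s ++ t].
Proof.
rewrite (integral_word_set (convol p q)) integral_convol//.
apply: le_trans (integral_word_ge _ s _); last by move=> x; exact: integral_ge0.
apply: lee_wpmul2l => //; apply: le_trans (integral_word_ge _ t _) => //.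
by rewrite indicE mem_set// mule1.
Qed.

Lemma convol_iter_gt0 nu n s t : 0 < nu [set s] -> 0 < convol_iter nu n [set t] ->
  0 < convol_iter nu n.+1 [set s ++ t].
Proof. by move=> s0 t0; apply: lt_le_trans (convol_ge _ _ _ _); exact: mule_gt0. Qed.

End convolution.

(** * Harmonic functions and sampled walks *)

Section resolvent.
Context {R : realType} {W : alphabet}.
Implicit Types p beta nu kappa : probability (word W) R.
Local Open Scope ereal_scope.

(* The law of [g_1 ... g_J b] with [g_i] of law [p], [b] of law [beta] and [J]
   geometric of parameter [eps]. *)
Section resolvent_measure.
Variables (eps : R) (eps01 : (0 < eps < 1)%R) (p beta : probability (word W) R).

Let c j : {nonneg R} :=
  NngNum (mulr_ge0 (ltW (proj1 (andP eps01)))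
    (exprn_ge0 j (ltW (eq_ind_r is_true (proj2 (andP eps01)) (subr_gt0 eps 1))))).

Let term j := mscale (c j) (convol (convol_iter p j) beta).

Definition resolvent_measure : set (word W) -> \bar R := mseries term 0.

HB.instance Definition _ := Measure.on resolvent_measure.

Let integral_resolvent_series f : (forall x, 0 <= f x) ->
  \int[resolvent_measure]_x f x =
  \sum_(j <oo) (eps * (1 - eps) ^+ j)%:E * \int[convol (convol_iter p j) beta]_x f x.
Proof.
move=> f0; rewrite ge0_integral_measure_series//; apply: eq_eseriesr => j _.
by rewrite ge0_integral_mscale.
Qed.

Lemma resolvent_measure1 : resolvent_measure setT = 1.
Proof.
have := @cvg_geometric_series R eps (1 - eps)%R.
rewrite subKr divff ?gt_eqF//; last by case/andP: eps01.
have e01 : (`|1 - eps| < 1)%R.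
  by case/andP: eps01 => e0 e1; rewrite ger0_norm ?subr_ge0 ?ltW// ltrBlDl ltrDr.
move=> /(_ e01) cvg1; rewrite /resolvent_measure /mseries.
have -> : \sum_(0 <= k <oo) term k setT =
    limn (EFin \o series (geometric eps (1 - eps)%R)).
  apply/congr_lim/funext => n /=; rewrite -sumEFin; apply: eq_bigr => j _.
  by rewrite /term /mscale/= probability_setT mule1.
by apply/cvg_lim => //; apply: cvg_EFin => //; exact: nearW.
Qed.

HB.instance Definition _ :=
  Measure_isProbability.Build _ _ _ resolvent_measure resolvent_measure1.

Definition resolvent : probability (word W) R := resolvent_measure.

(** First-step analysis: with probability [eps] no factor of law [p] occurs, and otherwise the
    geometric count starts afresh after the first one. Later arguments use this equation rather than
    the series. *)
Lemma integral_resolvent f : (forall x, 0 <= f x) ->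
  \int[resolvent]_x f x = eps%:E * \int[beta]_x f x +
    (1 - eps)%:E * \int[p]_s \int[resolvent]_t f (s ++ t).
Proof.
move=> f0; have [e0 e1] := andP eps01.
have c0 j : 0 <= (eps * (1 - eps) ^+ j)%:E.
  by rewrite lee_fin mulr_ge0 ?exprn_ge0// ?subr_ge0 ltW.
rewrite [LHS]integral_resolvent_series// nneseries_recl//; last first.
  by move=> j _; rewrite mule_ge0// integral_ge0.
rewrite expr0 mulr1 integral_convol// integral_convol_iter0; congr (_ + _).
under [X in _ = _ * X]eq_integral do rewrite integral_resolvent_series//.
rewrite integral_nneseries//; last first.
  by move=> j x _; rewrite mule_ge0// integral_ge0.
rewrite -nneseriesZl; last first.
  by move=> j _; apply: integral_ge0 => x _; rewrite mule_ge0// integral_ge0.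
rewrite -(@nneseries_addn _ _ 1); last first.
  by move=> j; rewrite mule_ge0// integral_ge0.
apply: eq_eseriesr => j _; rewrite addn1 ge0_integralZl_EFin//; last 2 first.
- by move=> x _; exact: integral_ge0.
- by rewrite -lee_fin.
rewrite muleA -EFinM mulrCA -exprS; congr (_ * _).
rewrite integral_convol// integral_convol_iterS; last by move=> x; exact: integral_ge0.
apply: eq_integral => s _; rewrite integral_convol//.
by apply: eq_integral => t _; apply: eq_integral => u _; rewrite catA.
Qed.

End resolvent_measure.

Section conditioning.
Variables (kappa : probability (word W) R) (w : word W).

Let mD : measurable (~` [set w]). Proof. by []. Qed.

(** The law [kappa] conditioned on differing from [w]. The last argument is the fallback of
    [mnormalize] when there is no mass to normalize. *)
Definition avoiding : probability (word W) R :=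
  mnormalize (mrestr kappa mD) kappa.

Lemma integral_avoiding f : kappa [set w] < 1 -> (forall x, 0 <= f x) ->
  \int[kappa]_x f x = kappa [set w] * f w +
    (1 - kappa [set w]) * \int[avoiding]_x f x.
Proof.
move=> kw1 f0.
have kwf : kappa [set w] \is a fin_num by exact: fin_num_measure.
pose e : {nonneg R} := NngNum (fine_ge0 (measure_ge0 kappa [set w])).
have eE : (e%:num)%:E = kappa [set w] by rewrite /= fineK.
have e1 : (e%:num < 1)%R by rewrite -lte_fin eE.
have e'0 : (0 <= 1 - e%:num)%R by rewrite subr_ge0 ltW.
rewrite -eE -EFinB.
rewrite (eq_measure_integral (measure_add (mscale e (dirac w))
  (mscale (NngNum e'0) avoiding))); last first.
  move=> A _ _; apply: etrans (esym (measure_addE _ _ A)).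
  have kC : kappa [set~ w] = (1 - e%:num)%:E by rewrite probability_setC// EFinB eE.
  have AE : avoiding A = kappa (A `&` [set~ w]) * ((1 - e%:num)^-1)%:E.
    rewrite /avoiding /= /mnormalize /= /mrestr setTI kC.
    by rewrite eqe gt_eqF ?subr_gt0.
  change (kappa A = (e%:num)%:E * \d_w A + (1 - e%:num)%:E * avoiding A).
  rewrite AE [X in _ + X]muleCA -[X in _ + _ * X]EFinM divff ?gt_eqF ?subr_gt0// mule1.
  rewrite (measureDI kappa (A:=A) (B:=[set w]))// setDE addeC.
  congr (_ + _); rewrite diracE fineK//; have [Aw|Aw] := boolP (w \in A).
    rewrite mule1; congr (kappa _); apply/seteqP.
    by split => [x []//|x ->]; split=> //; exact: set_mem.
  rewrite mule0; have -> : A `&` [set w] = set0; last by rewrite measure0.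
  by apply/seteqP; split => // x [+ xw]; rewrite xw => /mem_set; exact/negP.
rewrite ge0_integral_measure_add// !ge0_integral_mscale//.
by rewrite integral_dirac// diracT mul1e.
Qed.

End conditioning.
End resolvent.

Section harmonic.
Context {R : realType} {W : alphabet}.
Implicit Types p beta nu kappa : probability (word W) R.
Implicit Types h u v : word W -> \bar R.
Local Open Scope ereal_scope.

Definition harmonic p h := forall g, \int[p]_s h (g ++ s) = h g.

Lemma le_integral_prob p h (C : \bar R) :
  (forall g, 0 <= h g <= C) -> \int[p]_s h s <= C.
Proof.
move=> hC; have C0 : 0 <= C by case/andP: (hC [::]) => h0; exact: le_trans.
rewrite -[leRHS]mule1 -(probability_setT p) -integral_cst//.
by apply: ge0_le_integral => // x _; case/andP: (hC x).
Qed.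

(** Each use of the two inequalities shrinks the possible excess of [u] over [v] by the factor
    [1 - eps], starting from [C]. *)
Lemma resolvent_comparison p (eps : R) (C : R) b u v :
  (0 < eps < 1)%R -> (forall g, 0 <= b g) ->
  (forall g, 0 <= u g <= C%:E) -> (forall g, 0 <= v g) ->
  (forall g, u g <= b g + (1 - eps)%:E * \int[p]_s u (g ++ s)) ->
  (forall g, b g + (1 - eps)%:E * \int[p]_s v (g ++ s) <= v g) ->
  forall g, u g <= v g.
Proof.
move=> /andP[e0 e1] b0 uC v0 ub bv.
have C0 : (0 <= C)%R by rewrite -lee_fin; case/andP: (uC [::]) => h0; exact: le_trans.
have e'0 : (0 <= 1 - eps)%R by rewrite subr_ge0 ltW.
have bound n g : u g <= v g + ((1 - eps) ^+ n * C)%:E.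
  elim: n g => [|n IHn] g.
    by rewrite expr0 mul1r (le_trans _ (leeDr _ (v0 g)))//; case/andP: (uC g).
  apply: (le_trans (ub g)); rewrite exprS -mulrA EFinM.
  have c0 : (0 <= (1 - eps) ^+ n * C)%R by rewrite mulr_ge0// exprn_ge0.
  apply: (@le_trans _ _ (b g + (1 - eps)%:E *
      \int[p]_s (((1 - eps) ^+ n * C)%:E + v (g ++ s)))).
    rewrite leeD2l// lee_wpmul2l ?lee_fin//; apply: ge0_le_integral => //.
      by move=> x _; case/andP: (uC (g ++ x)).
    by move=> x _; rewrite addeC.
  rewrite (probability_integralDl p)// ge0_muleDr ?integral_ge0// addeCA addeC.
  by rewrite leeD// -EFinM.
move=> g; apply/lee_addgt0Pr => d d0.
have e'1 : (`|1 - eps| < 1)%R by rewrite ger0_norm// ltrBlDl ltrDr.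
have /cvgr0Pnorm_lt/(_ d d0)[n _ /(_ n (leqnn n))] := cvg_geometric C e'1.
rewrite /geometric/= ger0_norm ?mulr_ge0 ?exprn_ge0// mulrC => nd.
by apply: (le_trans (bound n g)); rewrite leeD2l// lee_fin ltW.
Qed.

(** If [h] satisfies the equation on the right, then [h] and its average [u] against the resolvent
    solve the same fixed-point equation, and comparison in both directions identifies them. *)
Lemma harmonic_resolvent p beta (eps : R) (e01 : (0 < eps < 1)%R) (C : R) h :
  (forall g, 0 <= h g <= C%:E) ->
  harmonic (resolvent e01 p beta) h <->
  forall g, h g = eps%:E * \int[beta]_x h (g ++ x) +
                  (1 - eps)%:E * \int[p]_s h (g ++ s).
Proof.
move=> hC; have h0 g : 0 <= h g by case/andP: (hC g).
have e0 : (0 <= eps)%R by case/andP: e01 => /ltW.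
pose u g := \int[resolvent e01 p beta]_x h (g ++ x).
have u0 g : 0 <= u g by exact: integral_ge0.
have uE g : u g = eps%:E * \int[beta]_x h (g ++ x) +
                  (1 - eps)%:E * \int[p]_s u (g ++ s).
  rewrite /u integral_resolvent//; congr (_ + _ * _).
  by apply: eq_integral => s _; apply: eq_integral => t _; rewrite catA.
have uC g : 0 <= u g <= C%:E by rewrite u0/= le_integral_prob.
split=> [hh g|hE g].
  rewrite -{1}hh [LHS]uE; congr (_ + _ * _).
  by apply: eq_integral => s _; exact: hh.
have b0 g' : 0 <= eps%:E * \int[beta]_x h (g' ++ x).
  by rewrite mule_ge0 ?integral_ge0 ?lee_fin.
apply/eqP; rewrite eq_le; apply/andP; split.
- apply: (@resolvent_comparison p eps C _ u h e01 b0 uC h0) => g'.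
    by rewrite -uE.
  by rewrite -hE.
- apply: (@resolvent_comparison p eps C _ h u e01 b0 hC u0) => g'.
    by rewrite -hE.
  by rewrite -uE.
Qed.

Lemma harmonic_convol_iter p h n : (forall g, 0 <= h g) -> harmonic p h ->
  harmonic (convol_iter p n) h.
Proof.
move=> h0 hh; elim: n => [|n IHn] g; first by rewrite integral_convol_iter0 cats0.
rewrite integral_convol_iterS// -[RHS]hh; apply: eq_integral => s _.
by under eq_integral do rewrite catA; exact: IHn.
Qed.

Lemma resolvent_ge_end p beta (eps : R) (e01 : (0 < eps < 1)%R) x :
  eps%:E * beta [set x] <= resolvent e01 p beta [set x].
Proof.
rewrite (integral_word_set (resolvent e01 p beta)) integral_resolvent//.
rewrite -integral_word_set leeDl// mule_ge0//.
  by rewrite lee_fin subr_ge0; case/andP: e01 => _ /ltW.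
by apply: integral_ge0 => s _; exact: integral_ge0.
Qed.

Lemma resolvent_ge_step p beta (eps : R) (e01 : (0 < eps < 1)%R) s t :
  (1 - eps)%:E * (p [set s] * resolvent e01 p beta [set t]) <=
  resolvent e01 p beta [set s ++ t].
Proof.
have [e0 e1] := andP e01.
rewrite (integral_word_set _ [set s ++ t]) integral_resolvent//.
apply: (@le_trans _ _ ((1 - eps)%:E * \int[p]_s0 \int[resolvent e01 p beta]_t0
    (\1_[set s ++ t] (s0 ++ t0))%:E)); last first.
  by rewrite leeDr// mule_ge0 ?integral_ge0// lee_fin ltW.
apply: lee_wpmul2l; first by rewrite lee_fin subr_ge0 ltW.
apply: le_trans (integral_word_ge _ s _); last by move=> x; exact: integral_ge0.
apply: lee_wpmul2l => //; apply: le_trans (integral_word_ge _ t _) => //.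
by rewrite indicE mem_set// mule1.
Qed.

(** Subadditivity and the first-step equation bound the moment [E] by [Ib + (1 - eps) * (E + Ip)].
    Solving for [E] requires it to be finite, so [L] is first truncated at a level [M]. *)
Lemma resolvent_moment p beta (eps : R) (e01 : (0 < eps < 1)%R) (L : word W -> R) :
  (forall g, 0 <= L g)%R -> (forall s t, L (s ++ t) <= L s + L t)%R ->
  \int[p]_x (L x)%:E < +oo -> \int[beta]_x (L x)%:E < +oo ->
  \int[resolvent e01 p beta]_x (L x)%:E < +oo.
Proof.
move=> L0 Ls Lp Lb; have [e0 e1] := andP e01.
set nu := resolvent _ _ _.
pose Ip := \int[p]_x (L x)%:E; pose Ib := \int[beta]_x (L x)%:E.
have Ip0 : 0 <= Ip by apply: integral_ge0 => x _; rewrite lee_fin.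
have Ib0 : 0 <= Ib by apply: integral_ge0 => x _; rewrite lee_fin.
have trunc (M : R) : (0 <= M)%R ->
    eps%:E * \int[nu]_x (Num.min (L x) M)%:E <= Ip + Ib.
  move=> M0; set E := \int[nu]_x _.
  have m0 x : 0 <= (Num.min (L x) M)%:E by rewrite lee_fin le_min L0.
  have E0 : 0 <= E by exact: integral_ge0.
  have Ef : E \is a fin_num.
    rewrite ge0_fin_numE//; apply: (@le_lt_trans _ _ M%:E); last exact: ltry.
    by apply: le_integral_prob => g; rewrite m0 lee_fin ge_min lexx orbT.
  have : E <= Ib + (1 - eps)%:E * (E + Ip).
    rewrite {1}/E /nu integral_resolvent//; apply: leeD.
      rewrite -[leRHS]mul1e; apply: lee_pmul => //.
      - by rewrite lee_fin ltW.
      - exact: integral_ge0.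
      - by rewrite lee_fin ltW.
      - apply: ge0_le_integral => // x _.
        by rewrite lee_fin ge_min lexx.
    apply: lee_wpmul2l; first by rewrite lee_fin subr_ge0 ltW.
    have -> : E + Ip = \int[p]_s (E + (L s)%:E).
      by rewrite (probability_integralDl p)// => g; rewrite lee_fin.
    apply: ge0_le_integral => //; first by move=> x _; exact: integral_ge0.
    move=> s _.
    rewrite addeC; have -> : (L s)%:E + E = \int[nu]_t ((L s)%:E + (Num.min (L t) M)%:E).
      by rewrite (probability_integralDl nu)// lee_fin.
    apply: ge0_le_integral => // t _; rewrite -EFinD lee_fin.
    have := Ls s t; have := L0 s; have := L0 t.
    case: (leP (L t) M) => ?; case: (leP (L (s ++ t)) M) => ?; lra.
  rewrite ge0_muleDr// => EI.
  have -> : eps%:E * E = E - (1 - eps)%:E * E.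
    by rewrite -[in RHS](fineK Ef) -[in LHS](fineK Ef) -!EFinM -EFinB; congr EFin; ring.
  rewrite leeBlDr ?fin_numM//; apply: (le_trans EI).
  rewrite addeCA addeC leeD2r// addeC leeD2r//.
  rewrite -[leRHS]mul1e; apply: lee_wpmul2r => //.
  by rewrite lee_fin gerBl ltW.
suff : \int[nu]_x (L x)%:E <= eps^-1%:E * (Ip + Ib).
  move/le_lt_trans; apply; rewrite lte_mul_pinfty//.
    by rewrite lee_fin invr_ge0 ltW.
  by rewrite lte_add_pinfty.
rewrite integral_word; last by move=> x; rewrite lee_fin.
apply: ge_ereal_sup => _ [X [finX _] <-].
(* Truncation at this level changes nothing on the finite set [X], so every finite partial sum
   inherits the bound. *)
pose M := (\sum_(x <- fset_set X) L x)%R.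
have LM x : X x -> (L x <= M)%R.
  move=> Xx; rewrite /M (big_fsetD1 x)/=; last by rewrite in_fset_set// mem_set.
  by rewrite lerDl sumr_ge0.
have M0 : (0 <= M)%R by rewrite sumr_ge0.
apply: (@le_trans _ _ (\int[nu]_x (Num.min (L x) M)%:E)).
  rewrite integral_word; last by move=> x; rewrite lee_fin le_min L0.
  apply: ereal_sup_ubound; exists X => //; apply: eq_fsbigr => x /set_mem Xx.
  by rewrite min_l// LM.
rewrite -[leLHS]mul1e -(@mulVf _ eps) ?gt_eqF// EFinM -muleA.
by rewrite lee_wpmul2l ?lee_fin ?invr_ge0 ?(ltW e0)// trunc.
Qed.

End harmonic.

(** * The w-norm *)

Section wnorm.
Context {W : alphabet}.
Implicit Types w g h : word W.

Lemma le_card_fset_set (T : choiceType) (A B : set T) : finite_set B -> A `<=` B ->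
  (#|` fset_set A| <= #|` fset_set B|)%N.
Proof.
move=> fB AB; apply: fsubset_leq_card; rewrite -fset_set_sub//.
exact: sub_finite_set fB.
Qed.

Lemma card_fset_setU (T : choiceType) (A B : set T) : finite_set A -> finite_set B ->
  (#|` fset_set (A `|` B)| <= #|` fset_set A| + #|` fset_set B|)%N.
Proof. by move=> fA fB; rewrite fset_setU// cardfsU leq_subr. Qed.

Lemma card_fset_set_image (T U : choiceType) (f : T -> U) (A : set T) : finite_set A ->
  (#|` fset_set (f @` A)| <= #|` fset_set A|)%N.
Proof. by move=> fA; rewrite fset_set_image// leq_imfset_card. Qed.

Lemma cat_eq_cat (T : Type) (a b c d : seq T) : a ++ b = c ++ d ->
  (size a <= size c)%N -> exists2 t, c = a ++ t & b = t ++ d.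
Proof.
move=> abcd ac; have aE : a = take (size a) c.
  by have := congr1 (take (size a)) abcd; rewrite take_size_cat// takel_cat.
have cE : c = a ++ drop (size a) c by rewrite {1}aE cat_take_drop.
exists (drop (size a) c) => //.
move: abcd; rewrite {1}cE -catA => /(congr1 (drop (size a))).
by rewrite !drop_size_cat.
Qed.

Lemma wnorm_gt0 w g : w <> [::] -> (0 < wnorm w g)%N.
Proof. by case: w => // a w _; rewrite /wnorm addnS. Qed.

Lemma wnorm_nil w : w <> [::] -> wnorm w [::] = size w.
Proof.
move=> w0; rewrite /wnorm (_ : occurrences w [::] = set0); first by rewrite fset_set0 cardfs0.
by apply/seteqP; split => // g' [g'' /(congr1 size)]; case: w w0 => //= a w _;
   rewrite !size_cat/= => /eqP; rewrite addnS.
Qed.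

(** An occurrence in [g ++ h] lies in [g], lies in [h], or starts in [g] and ends in [h]. The last
    kind has fewer than [size w] starting points, which the summand [size w] of the norm pays
    for. *)
Lemma wnorm_cat w g h : (wnorm w (g ++ h) <= wnorm w g + wnorm w h)%N.
Proof.
rewrite /wnorm addnA leq_add2r -addnA (addnC (size w)) addnA.
pose C := (fun i => take (size g - i) (g ++ h)) @` `I_(size w).
have fI n : finite_set `I_n by exact: finite_II.
have fC : finite_set C by exact: finite_image.
have sub : occurrences w (g ++ h) `<=`
    (occurrences w g `|` (cat g @` occurrences w h)) `|` C.
  move=> g' [g'' gE].
  have g'E : g' = take (size g') (g ++ h) by rewrite gE take_size_cat.
  have [gg'|g'g] := leqP (size g) (size g').
    have [t g't ht] := cat_eq_cat gE gg'.
    by left; right; exists t => //; exists g''.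
  have [gw|gw] := leqP (size g' + size w) (size g).
    have [//||t gt _] := @cat_eq_cat _ (g' ++ w) g'' g h; first by rewrite gE catA.
      by rewrite size_cat.
    by left; left; exists t; rewrite catA.
  right; exists (size g - size g')%N; first by rewrite /= ltn_subLR// ltnW.
  by rewrite subKn ?(ltnW g'g).
apply: (leq_trans (le_card_fset_set _ sub)).
  by rewrite !finite_setU; split => //; split; [|apply: finite_image];
     exact: finite_occurrences.
apply: (leq_trans (card_fset_setU _ fC)).
  by rewrite finite_setU; split; [|apply: finite_image]; exact: finite_occurrences.
apply: leq_add.
  apply: (leq_trans (card_fset_setU _ _)); [exact: finite_occurrences| |].
    by apply: finite_image; exact: finite_occurrences.
  rewrite leq_add2l; apply: card_fset_set_image; exact: finite_occurrences.
apply: (leq_trans (card_fset_set_image _ (fI _))).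
by rewrite (@card_fset_set _ _ (size w)).
Qed.

(** The occurrence of [w] at the end of [g ++ h] does not fit into [g]. *)
Lemma wnorm_lt w g u h : (size g < size (u ++ w))%N -> g ++ h = u ++ w ->
  (wnorm w g < wnorm w (g ++ h))%N.
Proof.
move=> gu gh; rewrite /wnorm ltn_add2r; apply: fproper_ltn_card.
have fo := @finite_occurrences W w.
rewrite fproperE; apply/andP; split.
  by rewrite -fset_set_sub// => g' [g'' ->]; exists (g'' ++ h); rewrite !catA.
apply/negP; rewrite -fset_set_sub// => /(_ u); case.
  by exists [::]; rewrite cats0.
by move=> g'' gE; move: gu; rewrite gE !size_cat addnA ltnNge leq_addr.
Qed.

(** An occurrence of [w ++ w] starts with one of [w], so only the length term doubles. This carries
    the moment assumption over to the doubled word. *)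
Lemma wnorm_double w g : (wnorm (w ++ w) g <= 2 * wnorm w g)%N.
Proof.
rewrite /wnorm size_cat mulnDr addnn -mul2n leq_add2r.
apply: leq_trans (leq_pmull _ _) => //; apply: le_card_fset_set.
  exact: finite_occurrences.
by move=> g' [g'' ->]; exists (w ++ g''); rewrite !catA.
Qed.

End wnorm.

(** * The sampled step law *)

Section sampling.
Context {R : realType} {W : alphabet}.
Implicit Types mu nu kappa : probability (word W) R.
Local Open Scope ereal_scope.

(** A letter is not a product of two non-empty words, so the words of length other than one,
    together with the charged letters, already form a subsemigroup. *)
Lemma generating_letter mu (a : W) : generating mu -> 0 < mu [set [:: a]].
Proof.
pose S := [set g : word W | size g = 1%N -> 0 < mu [set g]].
suff gS : smallest subsemigroup_with_identity [set g | 0 < mu [set g]] `<=` S.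
  by move=> gen; apply: (gS [:: a]) => //; rewrite gen.
apply: smallest_sub; last by move=> g /= g0 _.
split=> // -[|b [|c g]] [|x h] Sg Sh //.
Qed.

(** The factor 2 makes this subadditive, because [a + b <= 2 * a * b] for [a, b >= 1]. *)
Definition log_wnorm (w g : word W) : R := ln (2 * (wnorm w g)%:R).

Lemma log_wnorm_ge0 w g : w <> [::] -> (0 <= log_wnorm w g)%R.
Proof.
move=> w0; apply: ln_ge0; rewrite -natrM ler1n muln_gt0.
by rewrite wnorm_gt0.
Qed.

Lemma log_wnorm_cat w s t : w <> [::] ->
  (log_wnorm w (s ++ t) <= log_wnorm w s + log_wnorm w t)%R.
Proof.
move=> w0; have p g : (0 < wnorm w g)%N by exact: wnorm_gt0.
rewrite /log_wnorm -lnM ?posrE -?natrM ?ltr0n ?muln_gt0 ?p//.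
rewrite ler_ln ?posrE ?ltr0n ?muln_gt0 ?p// ler_nat.
apply: (@leq_trans (2 * (wnorm w s + wnorm w t))).
  by rewrite leq_mul2l wnorm_cat.
rewrite mulnACA -mulnA leq_mul2l/= mul2n -addnn.
by rewrite leq_add ?leq_pmulr ?leq_pmull.
Qed.

Section sampled_measure.
Variables (mu : probability (word W) R) (mu_letter : forall a : W, 0 < mu [set [:: a]]).
Variables (w : word W) (w2 : (1 < size w)%N).
Hypothesis mu_moment : \int[mu]_g (log_wnorm w g)%:E < +oo.

Let w0 : w <> [::]. Proof. by case: w w2. Qed.

Let half01 : (0 < (2^-1 : R) < 1)%R.
Proof. by rewrite invr_gt0 ltr0n invf_lt1 ?ltr1n ?ltr0n. Qed.

(** The position of the walk at an independent geometric time. Every letter is charged by [mu], so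
    every word is charged here. *)
Let kappa : probability (word W) R := resolvent half01 mu (dirac ([::] : word W)).

Let kappa_gt0 g : 0 < kappa [set g].
Proof.
have [h0 h1] := andP half01.
elim: g => [|a g IHg].
  apply: lt_le_trans (resolvent_ge_end _ _ _ _).
  apply: mule_gt0; first by rewrite lte_fin.
  by rewrite /= diracE mem_set// lte01.
apply: lt_le_trans (resolvent_ge_step _ _ half01 [:: a] g).
by rewrite !mule_gt0// lte_fin subr_gt0.
Qed.

Let kappa_harmonic (C : R) h : (forall g, 0 <= h g <= C%:E) ->
  harmonic kappa h <-> harmonic mu h.
Proof.
move=> hC; have [h0 h1] := andP half01.
have hge g : 0 <= h g by case/andP: (hC g).
have half : (1 - 2^-1)%R = (2^-1)%R :> R by rewrite [X in (X - _)%R](splitr 1) div1r addrK.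
rewrite (harmonic_resolvent _ _ half01 hC) half.
have E g : \int[dirac ([::] : word W)]_x h (g ++ x) = h g.
  by rewrite integral_dirac// diracT mul1e cats0.
have hf g : h g \is a fin_num.
  by rewrite ge0_fin_numE// (le_lt_trans _ (ltry C))//; case/andP: (hC g).
have hE g : h g = (2^-1)%:E * h g + (2^-1)%:E * h g.
  by rewrite -ge0_muleDl ?lee_fin ?ltW// -EFinD -[(2^-1)%R]div1r -splitr mul1e.
split=> hh g; last by rewrite E hh -hE.
have If : \int[mu]_s h (g ++ s) \is a fin_num.
  rewrite ge0_fin_numE ?integral_ge0// (le_lt_trans _ (ltry C))//.
  exact: le_integral_prob.
have := hh g; rewrite E -(fineK (hf g)) -(fineK If) -!EFinM -EFinD.
by move=> [hI]; congr EFin; lra.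
Qed.

Let kappa_lt1 : kappa [set w] < 1.
Proof.
apply: (@le_lt_trans _ _ (kappa (~` [set [::]]))).
  by apply: le_measure; rewrite ?inE// => g /= ->.
have ef : kappa [set [::]] \is a fin_num by exact: fin_num_measure.
rewrite probability_setC// -(fineK ef) -EFinB lte_fin gtrBl -lte_fin fineK//.
Qed.

Let kappaE : (fine (kappa [set w]))%:E = kappa [set w].
Proof. by rewrite fineK// fin_num_measure. Qed.

Let kappa1 : (0 < fine (kappa [set w]) < 1)%R.
Proof. by rewrite -!lte_fin kappaE kappa_lt1 kappa_gt0. Qed.

(** The displacement of the walk with steps [kappa] up to and including its first step equal to [w]:
    a geometric number of steps conditioned to avoid [w], then [w] itself. Taking [kappa [set w]] as
    geometric parameter makes the resolvent equation for harmonic functions the decomposition of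
    [kappa] into [w] and the rest. *)
Definition sampled : probability (word W) R :=
  resolvent kappa1 (avoiding kappa w) (dirac w).

Lemma sampled_harmonic (C : R) h : (forall g, 0 <= h g <= C%:E) ->
  harmonic sampled h <-> harmonic mu h.
Proof.
move=> hC; rewrite -(kappa_harmonic hC) (harmonic_resolvent _ _ kappa1 hC).
have hge g : 0 <= h g by case/andP: (hC g).
suff E g : \int[kappa]_s h (g ++ s) =
    (fine (kappa [set w]))%:E * \int[dirac w]_x h (g ++ x) +
    (1 - fine (kappa [set w]))%:E * \int[avoiding kappa w]_s h (g ++ s).
  by split=> hh g; rewrite ?E -?hh//; exact/esym/E.
rewrite (@integral_avoiding _ _ kappa w)// EFinB kappaE; congr (_ * _ + _).
by rewrite integral_dirac// diracT mul1e.
Qed.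

Let avoiding_gt0 g : g != w -> 0 < avoiding kappa w [set g].
Proof.
move=> gw; rewrite lt0e measure_ge0 andbT; apply/eqP => av0.
have := kappa_gt0 g; rewrite (integral_word_set kappa) (@integral_avoiding _ _ kappa w)//.
rewrite (etrans (esym (integral_word_set (avoiding kappa w) [set g])) av0) mule0 adde0 indicE memNset ?mule0 ?ltxx//=.
by move=> wg; rewrite wg eqxx in gw.
Qed.

(** The word [g] is built letter by letter; as [w] has at least two letters, conditioning excludes
    no letter. *)
Lemma sampled_gt0 g : 0 < sampled [set g ++ w].
Proof.
have [h0 h1] := andP kappa1.
elim: g => [|a g IHg].
  apply: lt_le_trans (resolvent_ge_end _ _ _ _).
  apply: mule_gt0; first by rewrite lte_fin.
  by rewrite /= diracE mem_set// lte01.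
apply: lt_le_trans (resolvent_ge_step _ _ kappa1 [:: a] (g ++ w)).
rewrite !mule_gt0 ?lte_fin ?subr_gt0//; apply: avoiding_gt0.
by apply/eqP => aw; move: w2; rewrite -aw.
Qed.

(** If [s ++ t] does not end with [w], neither does [t]. The first-step equation thus gives
    [a <= (1 - k) * a] for the mass [a] of words not ending with [w], where [k > 0]. *)
Lemma sampled_end g : sampled [set g] != 0 -> exists u, g = u ++ w.
Proof.
have [h0 h1] := andP kappa1.
pose A := [set g : word W | ~ exists u, g = u ++ w].
suff A0 : sampled A = 0.
  move=> g0; apply: contrapT => Ag; move/eqP: g0; apply.
  by apply: (subset_measure0 _ _ _ A0) => // x ->.
have Af : sampled A \is a fin_num by exact: fin_num_measure.
have : sampled A <= (1 - fine (kappa [set w]))%:E * sampled A.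
  rewrite {1}integral_word_set /sampled integral_resolvent//.
  rewrite integral_dirac// diracT mul1e indicE memNset; last by apply; exists [::].
  rewrite mule0 add0e; apply: lee_wpmul2l; first by rewrite lee_fin subr_ge0 ltW.
  apply: le_integral_prob => s; rewrite integral_ge0//= (integral_word_set _ A).
  apply: ge0_le_integral => // t _; rewrite lee_fin !indicE ler_nat.
  case: (boolP (s ++ t \in A)) => //= /set_mem At.
  by rewrite mem_set// => -[u tu]; apply: At; exists (s ++ u); rewrite tu catA.
rewrite -(fineK Af) -EFinM lee_fin => Ale; congr EFin.
have : (0 <= fine (sampled A))%R by exact: fine_ge0.
move: (fine (sampled A)) (fine (kappa [set w])) h0 Ale => a k k0 ak a0.
have ka : (k * a <= 0)%R by lra.
by apply/eqP; rewrite eq_le a0 andbT -(pmulr_rle0 _ k0).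
Qed.

Lemma sampled_moment : \int[sampled]_g (log_wnorm w g)%:E < +oo.
Proof.
have L0 g := @log_wnorm_ge0 w g w0.
have Ls s t := @log_wnorm_cat w s t w0.
have Ld x : \int[dirac x]_g (log_wnorm w g)%:E < +oo.
  by rewrite integral_dirac// diracT mul1e ltry.
apply: resolvent_moment => //; last exact: Ld.
have [h0 h1] := andP kappa1.
have : (1 - fine (kappa [set w]))%:E *
    \int[avoiding kappa w]_g (log_wnorm w g)%:E < +oo.
  apply: (@le_lt_trans _ _ (\int[kappa]_g (log_wnorm w g)%:E)).
    rewrite (@integral_avoiding _ _ kappa w)// EFinB kappaE leeDr//.
    by rewrite mule_ge0// lee_fin.
  by apply: resolvent_moment => //; exact: Ld.
move=> fin; rewrite ltey; apply/eqP => int; move: fin; rewrite int.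
by rewrite gt0_muley ?ltxx// lte_fin subr_gt0.
Qed.

End sampled_measure.
End sampling.

(** * The action on infinite words and stationary measures *)

Section seq_space_measurability.
Context {A : alphabet}.

Lemma measurable_coordinate (n : nat) (B : set A) :
  measurable [set x : seq_space A | B (x n)].
Proof.
by apply: sub_sigma_algebra; exists n => //; exists B => //; rewrite setTI.
Qed.

Lemma measurable_fun_seq_space d (T : measurableType d) (f : T -> seq_space A) :
  (forall n a, measurable [set t | f t n = a]) -> measurable_fun setT f.
Proof.
move=> mf; apply: (@measurability _ _ _ _ _ _ (@coordinate_sets A)) => //.
move=> _ [_ [n _ [B _ <-]] <-]; rewrite !setTI.
rewrite (_ : _ @^-1` _ = \bigcup_(a in B) [set t | f t n = a]); last first.
    apply/seteqP; split => [t Bt|t [a Ba /= fta]]; first by exists (f t n).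
  by rewrite /= fta.
rewrite bigcup_mkcond; apply: countable_bigcupT_measurable => [|a].
  exact: countableP.
by case: ifP.
Qed.

End seq_space_measurability.

Section action.
Context {W : alphabet}.
Implicit Types (g s t : word W) (x : infinite_word W).

Definition act g x : infinite_word W :=
  fun i => if (i < size g)%N then nth point g i else x (i - size g)%N.

Definition unact g x : infinite_word W := fun i => x (size g + i)%N.

Lemma actK g : cancel (act g) (unact g).
Proof.
by move=> x; apply/funext => i; rewrite /unact /act ltnNge leq_addr/= addKn.
Qed.

Lemma act_nil x : act [::] x = x.
Proof. by apply/funext => i; rewrite /act subn0. Qed.

Lemma act_cat s t x : act (s ++ t) x = act s (act t x).
Proof.
apply/funext => i; rewrite /act size_cat nth_cat.
have [lt_is|le_si] := ltnP i (size s); first by rewrite ltn_addr.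
by rewrite -{1}(subnKC le_si) ltn_add2l; case: ifP => // _; rewrite subnDA.
Qed.

Lemma measurable_act g : measurable_fun setT (act g).
Proof.
apply: measurable_fun_seq_space => n a; rewrite /act; have [_|_] := ltnP n (size g).
  have [na|na] := pselect (nth point g n = a).
    by rewrite (_ : mkset _ = setT)//; apply/seteqP; split.
  by rewrite (_ : mkset _ = set0)//; apply/seteqP; split.
exact: (measurable_coordinate (n - size g) [set a]).
Qed.

Lemma measurable_unact g : measurable_fun setT (unact g).
Proof.
apply: measurable_fun_seq_space => n a.
exact: (measurable_coordinate (size g + n) [set a]).
Qed.

Definition begins_with g : set (infinite_word W) := [set x | mkseq x (size g) = g].

Lemma measurable_begins_with g : measurable (begins_with g).
Proof.
rewrite (_ : begins_with g =
    \bigcap_(i in `I_(size g)) [set x | [set nth point g i] (x i)]); last first.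
  apply/seteqP; split => [x /= xg i /= ig|x xg]; first by rewrite -xg nth_mkseq.
  apply: (@eq_from_nth _ point); rewrite size_mkseq// => i ig.
  by rewrite nth_mkseq//; exact: xg.
by apply: fin_bigcap_measurable => // i _; exact: measurable_coordinate.
Qed.

Lemma begins_with_act g x : begins_with g (act g x).
Proof.
apply: (@eq_from_nth _ point); rewrite size_mkseq// => i ig.
by rewrite nth_mkseq// /act ig.
Qed.

End action.

Section stationary.
Context {R : realType} {W : alphabet}.
Local Open Scope ereal_scope.

Lemma measurable_act_pair :
  measurable_fun setT (fun z : word W * infinite_word W => act z.1 z.2).
Proof. by apply: measurable_fun_word_prod => g; exact: measurable_act. Qed.

Definition stationary (nu : probability (word W) R)
    (lam : probability (infinite_word W) R) :=
  forall E, measurable E -> lam E = \int[nu]_g lam (act g @^-1` E).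

Lemma integral_stationary nu lam (f : infinite_word W -> \bar R) :
  stationary nu lam -> (forall x, 0 <= f x) -> measurable_fun setT f ->
  \int[lam]_x f x = \int[nu]_g \int[lam]_x f (act g x).
Proof.
move=> st f0 mf.
pose F (z : word W * infinite_word W) := act z.1 z.2.
have mF : measurable_fun setT F := measurable_act_pair.
have mfF : measurable_fun setT (fun z : word W * infinite_word W => f (act z.1 z.2)).
  exact: (measurableT_comp mf mF).
pose Fm : {mfun (word W * infinite_word W)%type >-> infinite_word W} :=
  HB.pack F (isMeasurableFun.Build _ _ _ _ F mF).
rewrite -(fubini_tonelli1 (fun z : word W * infinite_word W => f (act z.1 z.2)))//.
rewrite -(@ge0_integral_distribution _ _ _ _ _ (nu \x lam) Fm)//.
apply: eq_measure_integral => E mE _; apply: etrans (st E mE) _.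
apply: eq_integral => g _; rewrite /=; congr (lam _).
by apply/seteqP; split => x; rewrite /xsection/= ?inE.
Qed.

Lemma stationary_convol_iter nu lam n :
  stationary nu lam -> stationary (convol_iter nu n) lam.
Proof.
move=> st; elim: n => [|n IHn] E mE.
  rewrite integral_convol_iter0; congr (lam _).
  by apply/seteqP; split => x; rewrite /= act_nil.
rewrite integral_convol_iterS// st//; apply: eq_integral => s _.
rewrite IHn; last by rewrite -[X in measurable X]setTI; exact: measurable_act.
apply: eq_integral => t _; congr (lam _).
by apply/seteqP; split => x; rewrite /= act_cat.
Qed.

End stationary.

(** * Bounded Radon-Nikodym densities *)

Section density.
Local Open Scope ereal_scope.

(** The Radon-Nikodym derivative exceeds [c] only on a null set, so truncating it at [c] gives a
    version bounded at every point. *)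
Lemma bounded_density d (T : measurableType d) (R : realType)
    (m1 m2 : {finite_measure set T -> \bar R}) (c : R) :
  (0 <= c)%R -> (forall E, measurable E -> m1 E <= c%:E * m2 E) ->
  exists D : T -> R, [/\ measurable_fun setT D, forall x, (0 <= D x <= c)%R &
    forall f : T -> \bar R, (forall x, 0 <= f x) -> measurable_fun setT f ->
      \int[m1]_x f x = \int[m2]_x (f x * (D x)%:E)].
Proof.
move=> c0 m12.
have dom : m1 `<< m2.
  apply/null_content_dominatesP => E mE E0; apply/eqP.
  by rewrite eq_le measure_ge0 andbT (le_trans (m12 E mE))// E0 mule0.
pose q := Radon_Nikodym_SigmaFinite.f m1 m2.
have q0 x : 0 <= q x := Radon_Nikodym_SigmaFinite.f_ge0 dom x.
have qf x : q x \is a fin_num := Radon_Nikodym_SigmaFinite.f_fin_num dom x.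
have mq : measurable_fun setT q.
  exact: measurable_int (Radon_Nikodym_SigmaFinite.f_integrable dom).
pose D x := Num.min (fine (q x)) c.
have mD : measurable_fun setT D.
  by apply: measurable_minr => //; apply: measurableT_comp mq => //; exact: fine_measurable.
pose E n := [set x | (c + n.+1%:R^-1)%:E <= q x].
have mE n : measurable (E n).
  by rewrite -[X in measurable X]setTI; exact: emeasurable_fun_c_infty.
have E0 n : m2 (E n) = 0.
  have : (c + n.+1%:R^-1)%:E * m2 (E n) <= c%:E * m2 (E n).
    apply: le_trans (m12 _ (mE n)).
    rewrite (Radon_Nikodym_SigmaFinite.f_integral dom (mE n)) -integral_cst//.
    apply: ge0_le_integral => //.
    - by move=> x _; rewrite lee_fin addr_ge0.
    - exact: measurable_funS mq.
  have /fineK <- : m2 (E n) \is a fin_num by exact: fin_num_measure.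
  rewrite -!EFinM lee_fin mulrDl gerDl => h; congr EFin; apply/eqP.
  rewrite eq_le fine_ge0 // andbT -(@pmulr_rle0 _ n.+1%:R^-1)//.
have UE : [set x | D x != fine (q x)] `<=` \bigcup_n E n.
  move=> x /= Dx; have cq : (c < fine (q x))%R.
    rewrite ltNge; apply: contra Dx => qc; by rewrite /D min_l.
  have [k kq] := ltr_add_invr cq; exists k => //.
  by rewrite /E /= -(fineK (qf x)) lee_fin ltW.
have UE0 : m2.-negligible (\bigcup_n E n).
  by apply: negligible_bigcup => n; exists (E n); split => //; exact: E0.
exists D; split.
- exact: mD.
- by move=> x; rewrite /D le_min fine_ge0//= c0 ge_min lexx orbT.
move=> f f0 mf.
rewrite -(Radon_Nikodym_SigmaFinite.change_of_variables dom)//.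
apply: ge0_ae_eq_integral => //.
- exact: emeasurable_funM.
- apply: emeasurable_funM => //; exact/measurable_EFinP.
- by move=> x _; exact: mule_ge0.
- by move=> x _; rewrite mule_ge0// lee_fin le_min fine_ge0.
apply: negligibleS UE0 => x /= Dq; apply: UE => /=; apply: contra_not_neq Dq => Dq _.
by rewrite Dq fineK.
Qed.

End density.

(** * Conditional entropy given the limit word *)

HB.instance Definition _ (W : alphabet) (g : word W) :=
  isMeasurableFun.Build _ _ _ _ (act g) (measurable_act g).

Section entropy.
Context {R : realType} {W : alphabet}.
Variables (nu : probability (word W) R) (lam : probability (infinite_word W) R).
Hypothesis st : stationary nu lam.
Local Open Scope ereal_scope.
Implicit Types (z s t g u : word W) (x y : infinite_word W).

Definition mass n z : R := fine (convol_iter nu n [set z]).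

Lemma massE n z : (mass n z)%:E = convol_iter nu n [set z].
Proof. by rewrite fineK// fin_num_measure. Qed.

Lemma mass_ge0 n z : (0 <= mass n z)%R. Proof. exact: fine_ge0. Qed.

Lemma mass_le1 n z : (mass n z <= 1)%R.
Proof. by rewrite -lee_fin massE probability_le1. Qed.

(** For the words that the walk can reach, stationarity dominates the law of [act z x] by a multiple
    of [lam]. *)
Definition charged z := exists n, (0 < mass n z)%R.

Lemma mass_gt0 n z : convol_iter nu n [set z] != 0 -> (0 < mass n z)%R.
Proof. by move=> nz; rewrite -lte_fin massE lt0e nz measure_ge0. Qed.

Let mass_translate_le n z E : measurable E ->
  (mass n z)%:E * lam (act z @^-1` E) <= lam E.
Proof.
move=> mE; rewrite massE (stationary_convol_iter n st mE).
exact: (@integral_word_ge _ _ _ (fun z => lam (act z @^-1` E))).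
Qed.

(* The bound [mass n z * D x <= 1] holds almost everywhere for every version of
   the density of the law of [act z x]; asking for it everywhere keeps
   [posterior] below [1]. *)
Definition is_density z (D : infinite_word W -> R) : Prop :=
  [/\ measurable_fun setT D, forall x, (0 <= D x)%R,
    forall n x, (mass n z * D x <= 1)%R &
    charged z -> forall f : infinite_word W -> \bar R,
      (forall x, 0 <= f x) -> measurable_fun setT f ->
      \int[lam]_x f (act z x) = \int[lam]_x (f x * (D x)%:E)].

(** All convolution powers are stationary, so [mass n z] times the law of [act z x] is below [lam]
    for each [n]. The supremum [S] of these masses turns this into the single bound [S^-1] on the
    density. *)
Lemma density_exists z : exists D, is_density z D.
Proof.
have [cz|ncz] := pselect (charged z); last first.
  by exists (cst 0%R); split => // n x; rewrite mulr0.
pose S := sup (range (mass ^~ z)).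
have hs : has_sup (range (mass ^~ z)).
  split; first by exists (mass 0 z), 0%N.
  by exists 1%R => _ [n _ <-]; exact: mass_le1.
have leS n : (mass n z <= S)%R by apply: sup_upper_bound => //; exists n.
have S0 : (0 < S)%R by have [n nz] := cz; exact: lt_le_trans (leS n).
have dom E : measurable E -> distribution lam (act z) E <= (S^-1)%:E * lam E.
  move=> mE; rewrite /distribution /pushforward.
  have mzE : measurable (act z @^-1` E).
    by rewrite -[X in measurable X]setTI; exact: measurable_act.
  have aE : (fine (lam (act z @^-1` E)))%:E = lam (act z @^-1` E).
    by rewrite fineK// fin_num_measure.
  have bE : (fine (lam E))%:E = lam E by rewrite fineK// fin_num_measure.
  have h n := mass_translate_le n z mE.
  rewrite -aE -bE -EFinM lee_fin -(ler_pM2l S0) mulrA divff ?gt_eqF// mul1r.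
  have [->|a0] := eqVneq (fine (lam (act z @^-1` E))) 0%R.
    by rewrite mulr0 fine_ge0.
  have {}a0 : (0 < fine (lam (act z @^-1` E)))%R by rewrite lt0r a0 fine_ge0.
  rewrite -ler_pdivlMr//; apply: sup_le_ub; first by case: hs.
  move=> _ [n _ <-]; rewrite ler_pdivlMr//.
  by rewrite -lee_fin EFinM aE bE.
have Si0 : (0 <= S^-1)%R by rewrite invr_ge0 ltW.
have [D [mD D1 DE]] := bounded_density Si0 dom.
exists D; split => //.
- by move=> x; case/andP: (D1 x).
- move=> n x; have /andP[D0 DS] := D1 x.
  rewrite -(@divff _ S) ?gt_eqF//; apply: ler_pM => //; exact: mass_ge0.
by move=> _ f f0 mf; rewrite -DE// ge0_integral_distribution.
Qed.

Definition dens z := projT1 (cid (density_exists z)).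

Lemma dens_spec z : is_density z (dens z).
Proof. exact: projT2 (cid (density_exists z)). Qed.

Lemma measurable_dens z : measurable_fun setT (dens z).
Proof. by case: (dens_spec z). Qed.

Lemma dens_ge0 z x : (0 <= dens z x)%R. Proof. by case: (dens_spec z). Qed.

Lemma mass_dens_le1 n z x : (mass n z * dens z x <= 1)%R.
Proof. by case: (dens_spec z). Qed.

Lemma integral_dens z (f : infinite_word W -> \bar R) : charged z ->
  (forall x, 0 <= f x) -> measurable_fun setT f ->
  \int[lam]_x f (act z x) = \int[lam]_x (f x * (dens z x)%:E).
Proof. by move=> cz; case: (dens_spec z) => _ _ _ /(_ cz); exact. Qed.

Lemma integral_dens1 z : charged z -> \int[lam]_x (dens z x)%:E = 1.
Proof.
move=> cz; have := @integral_dens z (cst 1) cz (fun=> @lee01 R) (measurable_cst _).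
by rewrite probability_integral_cst => ->; apply: eq_integral => x _; rewrite mul1e.
Qed.

Lemma ae_act z (B : set (infinite_word W)) : charged z -> measurable B ->
  \int[lam]_x ((\1_B x)%:E * (dens z x)%:E) = 0 -> {ae lam, forall x, ~ B (act z x)}.
Proof.
move=> cz mB; rewrite -(@integral_dens z (fun x => (\1_B x)%:E))//; last first.
  exact/measurable_EFinP/measurable_indic.
have mzB : measurable (act z @^-1` B).
  by rewrite -[X in measurable X]setTI; exact: measurable_act.
move=> B0; apply: (@ae_not_indic _ _ _ _ (act z @^-1` B)) => //.
have := integral_indic lam measurableT mzB; rewrite setIT => <-.
exact: B0.
Qed.

Lemma ae_act_negligible z (B : set (infinite_word W)) : charged z -> measurable B ->
  lam B = 0 -> {ae lam, forall x, ~ B (act z x)}.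
Proof.
move=> cz mB B0; apply: ae_act => //.
have mI : measurable_fun setT (fun x => (\1_B x)%:E : \bar R).
  exact/measurable_EFinP/measurable_indic.
have mD := measurable_dens z.
rewrite (ae_eq_integral (cst 0))// ?integral0//.
  by apply: emeasurable_funM => //; exact/measurable_EFinP.
exists B; split => // x /= h; apply: contrapT => nB; apply: h => _.
by rewrite indicE memNset// mul0e.
Qed.

(** The zero set of the density is null for the law having that density, which is the law of
    [act z x]; its [lam]-measure may be positive. *)
Lemma dens_gt0 z : charged z -> {ae lam, forall x, (0 < dens z (act z x))%R}.
Proof.
move=> cz; pose B := [set x | dens z x = 0%R].
have mB : measurable B.
  rewrite -[X in measurable X]setTI.
  exact: (measurable_dens z measurableT (measurable_set1 0%R)).
have : {ae lam, forall x, ~ B (act z x)}.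
  apply: ae_act => //; apply: integral0_eq => x _.
  by rewrite indicE; have [/set_mem->|_] := boolP (x \in B); rewrite ?mule0 ?mul0e.
by apply: filterS => x /eqP Bx; rewrite lt0r Bx dens_ge0.
Qed.

(** Chain rule. Testing against indicators and changing variables through [t] and then [s]
    identifies the two densities [lam]-almost everywhere; the law of [act (s ++ t) x] is dominated
    by [lam], so the identity persists at these points. *)
Lemma dens_cat s t : charged s -> charged t -> charged (s ++ t) ->
  {ae lam, forall x, dens (s ++ t) (act (s ++ t) x) =
                     (dens s (act (s ++ t) x) * dens t (act t x))%R}.
Proof.
move=> cs ct cst.
have mDs := measurable_dens s; have mDt := measurable_dens t.
have mDst := measurable_dens (s ++ t).
pose E y : R := (dens t (unact s y) * dens s y)%R.
have mDtu : measurable_fun setT (fun y => dens t (unact s y)).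
  exact: (measurableT_comp mDt (measurable_unact s)).
have mE : measurable_fun setT E by exact: measurable_funM.
have E0 y : (0 <= E y)%R by rewrite mulr_ge0 ?dens_ge0.
pose B := [set y | dens (s ++ t) y != E y].
have mB : measurable B.
  have mBE : measurable_fun setT (fun y => dens (s ++ t) y - E y)%R.
    exact: measurable_funB.
  have := mBE measurableT _ (measurableC (measurable_set1 (0 : R))).
  rewrite setTI; congr measurable; apply/seteqP.
  by split => y /=; rewrite /B/= -subr_eq0 => /eqP.
have B0 : lam B = 0.
  have : ae_eq lam setT (EFin \o dens (s ++ t)) (EFin \o E).
    apply: integral_ae_eq => //.
    - apply/integrableP; split; first exact/measurable_EFinP.
      under eq_integral do rewrite /= ger0_norm ?dens_ge0//.
      by rewrite integral_dens1// ltry.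
    - exact/measurable_EFinP.
    move=> F _ mF.
    have mIF : measurable_fun setT (fun x => (\1_F x)%:E : \bar R).
      exact/measurable_EFinP/measurable_indic.
    have IE (f : infinite_word W -> R) : \int[lam]_(y in F) (EFin \o f) y =
        \int[lam]_y ((\1_F y)%:E * (f y)%:E).
      rewrite integral_mkcond; apply: eq_integral => y _.
      by rewrite epatch_indic/= muleC.
    rewrite !IE -(@integral_dens (s ++ t) (fun y => (\1_F y)%:E))//.
    under eq_integral do rewrite act_cat.
    rewrite (@integral_dens t (fun y => (\1_F (act s y))%:E))//; last first.
      exact: (measurableT_comp mIF (measurable_act s)).
    (* This makes the whole integrand a function of [act s y], ready for the change of variables
       through [s]. *)
    under eq_integral do rewrite -[X in dens t X](actK s).
    rewrite (@integral_dens s (fun y => (\1_F y)%:E * (dens t (unact s y))%:E))//.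
    + by apply: eq_integral => y _; rewrite -muleA -EFinM.
    + by move=> y; rewrite mule_ge0// lee_fin dens_ge0.
    + by apply: emeasurable_funM => //; exact/measurable_EFinP.
  case=> N [mN N0 BN]; apply: (subset_measure0 mB mN _ N0).
  move=> y /= By; apply: BN => /= /(_ I) [] /eqP; exact/negP.
have := ae_act_negligible cst mB B0; apply: filterS => x /negP/negPn/eqP ->.
by rewrite /E {1}act_cat actK mulrC.
Qed.

(* The conditional probability that the walk is at [z] at time [n], given the
   limit word [act z x]; [entropy] is the corresponding conditional entropy. *)
Definition posterior n z x : R := (mass n z * dens z (act z x))%R.

Lemma posterior_le1 n z x : (posterior n z x <= 1)%R.
Proof. exact: mass_dens_le1. Qed.

Lemma measurable_posterior n z : measurable_fun setT (posterior n z).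
Proof.
apply: measurable_funM; first exact: measurable_cst.
exact: (measurableT_comp (measurable_dens z) (measurable_act z)).
Qed.

Lemma posterior_gt0 n z : (0 < mass n z)%R ->
  {ae lam, forall x, (0 < posterior n z x)%R}.
Proof.
move=> nz; have cz : charged z by exists n.
by have := dens_gt0 cz; apply: filterS => x ?; rewrite /posterior mulr_gt0.
Qed.

Definition info n z : \bar R := \int[lam]_x (- ln (posterior n z x))%:E.

Definition entropy n : \bar R := \int[convol_iter nu n]_z info n z.

Lemma neg_ln_posterior_ge0 n z x : (0 <= - ln (posterior n z x))%R.
Proof. by rewrite oppr_ge0 ln_le0// posterior_le1. Qed.

Lemma measurable_neg_ln_posterior n z :
  measurable_fun setT (fun x => (- ln (posterior n z x))%:E : \bar R).
Proof.
apply/measurable_EFinP; apply: measurable_funN => //.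
exact: (measurableT_comp (@measurable_ln R) (measurable_posterior n z)).
Qed.

Lemma info_ge0 n z : 0 <= info n z.
Proof. by apply: integral_ge0 => x _; rewrite lee_fin neg_ln_posterior_ge0. Qed.

Lemma entropy_ge0 n : 0 <= entropy n.
Proof. by apply: integral_ge0 => z _; exact: info_ge0. Qed.

End entropy.

Section entropy_bound.
Context {R : realType} {W : alphabet}.
Variables (nu : probability (word W) R) (lam : probability (infinite_word W) R).
Hypothesis st : stationary nu lam.
Local Open Scope ereal_scope.
Implicit Types (z s t g u : word W) (x y : infinite_word W).

Local Notation mass := (mass nu).
Local Notation dens := (dens st).
Local Notation posterior := (posterior st).
Local Notation info := (info st).
Local Notation entropy := (entropy st).

(* Gibbs' inequality, comparing the conditional law of the position given the
   limit word with the subprobability [r] on the prefixes of that word. *)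
Lemma entropy_le n (r : word W -> R) : (forall z, 0 < r z <= 1)%R ->
  (forall (X : seq (word W)) x, uniq X -> {in X, forall z, mass n z != 0%R} ->
     (\sum_(z <- X | mkseq x (size z) == z) r z <= 1)%R) ->
  entropy n <= \int[convol_iter nu n]_z (- ln (r z))%:E.
Proof.
move=> r01 rsum.
have r0 z : (0 < r z)%R by case/andP: (r01 z).
(* The inverse of the posterior, as a function of the limit word. Where the density vanishes,
   [ln 0 = 0] makes it 1, and there it gets multiplied by that zero density. *)
pose E n z y : R := expR (- ln (mass n z * dens z y)).
pose k z : \bar R := \int[lam]_x (r z * E n z (act z x))%:E.
have E0 z y : (0 <= E n z y)%R by exact: expR_ge0.
have k0 z : 0 <= k z.
  by apply: integral_ge0 => x _; rewrite lee_fin mulr_ge0// ltW.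
have mE z : measurable_fun setT (E n z).
  apply: (measurableT_comp (@measurable_expR R)); apply: measurable_funN.
  apply: (measurableT_comp (@measurable_ln R)); apply: measurable_funM => //.
  exact: measurable_dens.
have mrE z : measurable_fun setT (fun x => (r z * E n z (act z x))%:E : \bar R).
  apply/measurable_EFinP; apply: measurable_funM => //.
  exact: (measurableT_comp (mE z) (measurable_act z)).
have lnr0 z : 0 <= (- ln (r z))%:E.
  by rewrite lee_fin oppr_ge0 ln_le0//; case/andP: (r01 z).
(* The inequality [1 + ln t <= t] at the ratio of [r z] to the posterior, integrated over [lam]. *)
have pointwise z : 1 + info n z <= (- ln (r z))%:E + k z.
  rewrite -(probability_integralDl lam)//; last first.
  - by move=> x; rewrite lee_fin neg_ln_posterior_ge0.
  - exact: measurable_neg_ln_posterior.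
  rewrite -(probability_integralDl lam)//; last first.
    by move=> x; rewrite lee_fin mulr_ge0// ltW.
  apply: ge0_le_integral => //.
  - by move=> x _; rewrite adde_ge0// lee_fin neg_ln_posterior_ge0.
  - by apply: emeasurable_funD => //; exact: measurable_neg_ln_posterior.
  - by apply: emeasurable_funD.
  move=> x _; rewrite -!EFinD lee_fin /E -/(posterior n z x).
  rewrite -{2}[r z]lnK ?posrE// -expRD.
  have h := expR_ge1Dx (ln (r z) - ln (posterior n z x))%R.
  by rewrite -lerBlDl opprK (le_trans _ h)// addrA addrAC.
have kle : \int[convol_iter nu n]_z k z <= 1.
  rewrite integral_word//; apply: ge_ereal_sup => _ [X [finX _] <-].
  rewrite fsbig_finite//=.
  pose X' := [seq z <- fset_set X | mass n z != 0%R].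
  have uX' : uniq X' by apply: filter_uniq; exact: fset_uniq.
  have kz z : mass n z != 0%R -> convol_iter nu n [set z] * k z <=
      \int[lam]_x (r z * \1_(begins_with z) x)%:E.
    move=> nz; have {}nz : (0 < mass n z)%R by rewrite lt0r nz mass_ge0.
    have mF : measurable_fun setT
        (fun y => (r z * (E n z y * \1_(begins_with z) y))%:E : \bar R).
      apply/measurable_EFinP; apply: measurable_funM => //; apply: measurable_funM => //.
      by apply: measurable_indic; exact: measurable_begins_with.
    (* The inserted indicator equals 1 at [act z x], but after the change of variables it confines
       the integral to infinite words with prefix [z], where [rsum] applies. *)
    have -> : k z = \int[lam]_x (r z * (E n z (act z x) *
        \1_(begins_with z) (act z x)))%:E.
      apply: eq_integral => x _; rewrite indicE mem_set ?mulr1//.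
      exact: begins_with_act.
    rewrite (@integral_dens _ _ _ _ st z
      (fun y => (r z * (E n z y * \1_(begins_with z) y))%:E))//; last 2 first.
    - by exists n.
    - by move=> y; rewrite lee_fin !mulr_ge0// ltW.
    rewrite -massE -ge0_integralZl_EFin//; last 3 first.
    - move=> y _; rewrite -EFinM lee_fin !mulr_ge0 ?dens_ge0//; exact: ltW.
    - apply: emeasurable_funM => //; apply/measurable_EFinP; exact: measurable_dens.
    - exact: mass_ge0.
    apply: ge0_le_integral => //.
    - move=> y _; rewrite -!EFinM lee_fin !mulr_ge0 ?dens_ge0 ?mass_ge0//; exact: ltW.
    - apply: measurable_funeM; apply: emeasurable_funM => //; apply/measurable_EFinP.
      exact: measurable_dens.
    - apply/measurable_EFinP; apply: measurable_funM => //.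
      by apply: measurable_indic; exact: measurable_begins_with.
    move=> y _; rewrite -!EFinM lee_fin /E.
    have := dens_ge0 st z y; rewrite le_eqVlt => /predU1P[<-|d0].
      by rewrite !mulr0 mulr_ge0// ltW.
    rewrite expRN lnK ?posrE ?mulr_gt0// invfM.
    rewrite [leLHS](_ : _ = r z * \1_(begins_with z) y)%R//.
    by field; rewrite !gt_eqF.
  apply: (@le_trans _ _ (\sum_(z <- X') \int[lam]_x (r z * \1_(begins_with z) x)%:E)).
    rewrite /X' big_filter [leRHS]big_mkcond/=; apply: lee_sum => z _.
    case: ifPn => [/kz//|/negPn/eqP z0]; by rewrite -massE z0 mul0e.
  have mI z : measurable_fun setT (fun x => (r z * \1_(begins_with z) x)%:E : \bar R).
    apply/measurable_EFinP; apply: measurable_funM => //.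
    by apply: measurable_indic; exact: measurable_begins_with.
  have I0 z x : 0 <= (r z * \1_(begins_with z) x)%:E.
    by rewrite lee_fin mulr_ge0// ltW.
  rewrite -ge0_integral_sum// -[leRHS](probability_integral_cst lam).
  apply: ge0_le_integral => //.
  - by move=> x _; apply: sume_ge0.
  - exact: emeasurable_sum.
  move=> x _; rewrite sumEFin lee_fin; apply: le_trans (rsum X' x uX' _).
    rewrite [leRHS]big_mkcond/=; apply: ler_sum => z _.
    rewrite indicE; case: ifPn => [_|/eqP xz]; first by case: (x \in _); rewrite ?mulr1 ?mulr0// ltW.
    by rewrite memNset ?mulr0.
  by move=> z; rewrite mem_filter => /andP[].
rewrite -(leeD2lE (x := 1))//.
rewrite -(probability_integralDl (convol_iter nu n))//; last by move=> z; exact: info_ge0.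
apply: (@le_trans _ _ (\int[convol_iter nu n]_z ((- ln (r z))%:E + k z))).
  by apply: ge0_le_integral => // z _; rewrite adde_ge0// info_ge0.
by rewrite ge0_integralD// addeC leeD2r.
Qed.

End entropy_bound.

(** * Entropy gained in one step *)

Section entropy_step.
Context {R : realType} {W : alphabet}.
Variables (nu : probability (word W) R) (lam : probability (infinite_word W) R).
Hypothesis st : stationary nu lam.
Local Open Scope ereal_scope.
Implicit Types (z s t g u : word W) (x y : infinite_word W).

Local Notation mass := (mass nu).
Local Notation dens := (dens st).
Local Notation posterior := (posterior st).
Local Notation info := (info st).
Local Notation entropy := (entropy st).

(** The tangent of [ln] at [1 / (c + 1)]. The price [c - ln (c + 1)] is of second order in [c], so a
    first-order discrepancy wins for small [c]. *)
Lemma tangent_bound (c rho : R) : (0 <= c)%R -> (0 < rho)%R ->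
  (c + 1 + ln rho <= c ^+ 2 + (c + 1) * rho)%R.
Proof.
move=> c0 rho0; have c10 : (0 < c + 1)%R by rewrite ltr_wpDl.
have h1 : (ln ((c + 1) * rho) <= (c + 1) * rho - 1)%R.
  rewrite -[X in ln X](subrKC 1) le_ln1Dx// ltrBrDl subrr mulr_gt0//.
have h2 : (ln (c + 1)^-1 <= (c + 1)^-1 - 1)%R.
  rewrite -[X in ln X](subrKC 1) le_ln1Dx// ltrBrDl subrr invr_gt0//.
rewrite lnM ?posrE// in h1; rewrite lnV ?posrE// in h2.
have h3 : (c - c ^+ 2 <= 1 - (c + 1)^-1)%R.
  have -> : (1 - (c + 1)^-1 = c / (c + 1))%R by field; rewrite gt_eqF.
  rewrite ler_pdivlMr// -subr_ge0.
  rewrite [X in (0 <= X)%R](_ : _ = c ^+ 3)%R ?exprn_ge0//; ring.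
lra.
Qed.

(** Up to the factor [nu [set g]], the conditional probability given the limit word that the first
    increment is [g], averaged over the continuations of a walk that has reached [u]. *)
Definition mean_dens g u : \bar R := \int[lam]_x (dens g (act u x))%:E.

Lemma mean_dens_ge0 g u : 0 <= mean_dens g u.
Proof. by apply: integral_ge0 => x _; rewrite lee_fin dens_ge0. Qed.

Lemma measurable_dens_act g u :
  measurable_fun setT (fun x => (dens g (act u x))%:E : \bar R).
Proof.
apply/measurable_EFinP.
exact: (measurableT_comp (measurable_dens st g) (measurable_act u)).
Qed.

(* The expectation, given the first increment [g] and the position [g ++ z] at
   time [n.+1], of the ratio of the conditional laws of the first increment
   given the limit word and given the position at time [n.+1]. *)
Definition ratio n g z : \bar R :=
  (mass n.+1 (g ++ z) / mass n z)%:E * mean_dens g (g ++ z).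

Lemma ratio_ge0 n g z : 0 <= ratio n g z.
Proof. by rewrite mule_ge0 ?mean_dens_ge0// lee_fin divr_ge0 ?mass_ge0. Qed.

(** The weight [mass n z] cancels the denominator of [ratio], and prepending [g] is injective; the
    right-hand side also counts the words outside its range. *)
Lemma integral_ratio_le n g (b : word W -> \bar R) : (forall u, 0 <= b u) ->
  \int[convol_iter nu n]_z (b (g ++ z) * ratio n g z) <=
  \int[convol_iter nu n.+1]_u (b u * mean_dens g u).
Proof.
move=> b0.
have bm0 u : 0 <= b u * mean_dens g u by rewrite mule_ge0 ?mean_dens_ge0.
rewrite !integral_word//; last by move=> z; rewrite mule_ge0 ?ratio_ge0.
pose F u := convol_iter nu n.+1 [set u] * (b u * mean_dens g u).
have F0 u : 0 <= F u by rewrite mule_ge0.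
apply: (@le_trans _ _ (\esum_(z in setT) F (g ++ z))).
  apply: le_esum => z _; rewrite /F -massE /ratio.
  change (convol_iter nu n [set z] *
    (b (g ++ z) * ((mass n.+1 (g ++ z) / mass n z)%:E * mean_dens g (g ++ z))) <=
    (mass n.+1 (g ++ z))%:E * (b (g ++ z) * mean_dens g (g ++ z))).
  rewrite -massE; have [z0|nz] := eqVneq (mass n z) 0%R.
    by rewrite z0 mul0e mule_ge0// lee_fin mass_ge0.
  rewrite [X in _ * X]muleCA [leLHS]muleA -EFinM.
  by rewrite mulrC divfK.
rewrite -(@esum_image _ _ _ setT (cat g) F); last first.
  by move=> s t _ _ /= /(congr1 (drop (size g))); rewrite !drop_size_cat.
rewrite [leLHS]esum_mkcond; apply: le_esum => u _.
by case: ifP => _; [exact: lexx|exact: F0].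
Qed.

(** By the chain rule for densities the posterior at time [n.+1] is [rho] times the posterior at
    time [n]; [tangent_bound] controls the logarithm of [rho]. *)
Lemma info_step n g z (c : R) : (0 <= c)%R ->
  (0 < mass 1 g)%R -> (0 < mass n z)%R -> (0 < mass n.+1 (g ++ z))%R ->
  (c + 1)%:E + info n z <=
  (c ^+ 2)%:E + ((c + 1)%:E * ratio n g z + info n.+1 (g ++ z)).
Proof.
move=> c0 ng nz ngz.
have cg : charged nu g by exists 1%N.
have cz : charged nu z by exists n.
have cgz : charged nu (g ++ z) by exists n.+1.
have mL m u := measurable_neg_ln_posterior st m u.
have mD := measurable_dens_act g (g ++ z).
have L0 m u x : 0 <= (- ln (posterior m u x))%:E.
  by rewrite lee_fin neg_ln_posterior_ge0.
have c10 : (0 <= c + 1)%R by rewrite addr_ge0.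
have q0 : (0 <= mass n.+1 (g ++ z) / mass n z)%R by rewrite divr_ge0 ?mass_ge0.
pose q := (mass n.+1 (g ++ z) / mass n z)%R.
pose rho x := (q * dens g (act (g ++ z) x))%R.
have rho0 x : (0 <= rho x)%R by rewrite mulr_ge0 ?dens_ge0.
have mrho : measurable_fun setT (fun x => ((c + 1) * rho x)%:E : \bar R).
  apply/measurable_EFinP; apply: measurable_funM => //; apply: measurable_funM => //.
  exact/measurable_EFinP.
have -> : (c + 1)%:E * ratio n g z = \int[lam]_x ((c + 1) * rho x)%:E.
  rewrite /ratio muleA -EFinM -ge0_integralZl_EFin//.
  - by apply: eq_integral => x _; rewrite -EFinM -mulrA.
  - by move=> x _; rewrite lee_fin dens_ge0.
  - by rewrite mulr_ge0.
rewrite -(probability_integralDl lam) ?lee_fin//.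
rewrite -ge0_integralD//; last by move=> x _; rewrite lee_fin mulr_ge0.
have mR : measurable_fun setT (fun x =>
   ((c + 1) * rho x)%:E + (- ln (posterior n.+1 (g ++ z) x))%:E : \bar R).
  exact: emeasurable_funD.
have R0 x : 0 <= ((c + 1) * rho x)%:E + (- ln (posterior n.+1 (g ++ z) x))%:E.
  by rewrite adde_ge0// lee_fin mulr_ge0.
rewrite -(probability_integralDl lam) ?lee_fin ?sqr_ge0//.
apply: ae_ge0_le_integral => //.
- by move=> x _; rewrite adde_ge0// lee_fin.
- exact: emeasurable_funD.
- by move=> x _; rewrite adde_ge0// lee_fin sqr_ge0.
- exact: emeasurable_funD.
have := dens_cat st cg cz cgz; have := posterior_gt0 st nz.
have := posterior_gt0 st ngz.
apply: filterS3 => x pgz pz Dx _.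
have pE : (posterior n.+1 (g ++ z) x = rho x * posterior n z x)%R.
  rewrite /posterior Dx /rho /q; field; by rewrite gt_eqF.
have rx : (0 < rho x)%R by rewrite -(pmulr_lgt0 _ pz) -pE.
rewrite -!EFinD lee_fin pE lnM ?posrE//.
have := tangent_bound c0 rx; lra.
Qed.

Lemma integral_mean_dens n g : charged nu g ->
  \int[convol_iter nu n]_u mean_dens g u = 1.
Proof.
move=> cg; rewrite -(@integral_dens1 _ _ _ _ st g)//.
rewrite (@integral_stationary _ _ (convol_iter nu n) lam (fun x => (dens g x)%:E))//.
- exact: stationary_convol_iter.
- by move=> x; rewrite lee_fin dens_ge0.
- by apply/measurable_EFinP; exact: measurable_dens.
Qed.

Lemma mass1_gt0 g : 0 < nu [set g] -> (0 < mass 1 g)%R.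
Proof.
move=> nug; rewrite -lte_fin massE -(cats0 g); apply: convol_iter_gt0 => //.
by rewrite /= diracE mem_set// lte01.
Qed.

(** The entropy gained is the mean of [- ln rho], a relative entropy. It is tested with [c = dl * h]
    on the event that the first increment is [g], and with [c = 0] elsewhere; harmonicity evaluates
    the mean of [h] on that event. *)
Lemma entropy_step n g (h : word W -> R) (dl : R) :
  (0 < dl)%R -> (forall u, 0 <= h u <= 1)%R -> harmonic nu (EFin \o h) ->
  0 < nu [set g] ->
  (dl)%:E * (nu [set g] * (h g)%:E) + entropy n <=
  (dl)%:E * (nu [set g] *
    \int[convol_iter nu n.+1]_u ((h u)%:E * mean_dens g u)) +
  (dl ^+ 2)%:E + entropy n.+1.
Proof.
move=> dl0 h01 hh nug.
have h0 u : (0 <= h u)%R by case/andP: (h01 u).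
pose a g' z : R := (dl * ((g' == g)%:R * h (g' ++ z)))%R.
have a0 g' z : (0 <= a g' z)%R by rewrite !mulr_ge0// ltW.
have ale g' z : (a g' z <= dl)%R.
  rewrite /a ler_piMr ?(ltW dl0)//; case: (_ == _); rewrite ?mul0r// mul1r.
  by case/andP: (h01 (g' ++ z)).
pose A := \int[convol_iter nu n.+1]_u ((h u)%:E * mean_dens g u).
have A0 : 0 <= A.
  by apply: integral_ge0 => u _; rewrite mule_ge0 ?mean_dens_ge0// lee_fin.
have i0 m u : 0 <= info m u by exact: info_ge0.
have r0 := @ratio_ge0 n.
have ar0 g' z : 0 <= (a g' z)%:E * ratio n g' z by rewrite mule_ge0// lee_fin.
(* The summand 1 here is matched by the plain [ratio] in [f2], whose mean is at most 1; both are
   cancelled at the end. *)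
pose f1 g' z : \bar R := (a g' z)%:E + (1 + info n z).
pose f2 g' z : \bar R := (dl ^+ 2)%:E +
  ((a g' z)%:E * ratio n g' z + (ratio n g' z + info n.+1 (g' ++ z))).
have f10 g' z : 0 <= f1 g' z by apply: adde_ge0; [rewrite lee_fin|apply: adde_ge0; [exact: lee01|]].
have dl20 : 0 <= (dl ^+ 2)%:E by rewrite lee_fin sqr_ge0.
have f20 g' z : 0 <= f2 g' z by apply: adde_ge0 => //; apply: adde_ge0 => //; apply: adde_ge0.
have f12 : \int[nu]_g' \int[convol_iter nu n]_z f1 g' z <=
           \int[nu]_g' \int[convol_iter nu n]_z f2 g' z.
  apply: le_integral_word => [g'|g'|g' ng']; [exact: integral_ge0..|].
  have {}ng' : 0 < nu [set g'] by rewrite lt0e ng' measure_ge0.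
  apply: le_integral_word => [//|//|z nz].
  have {}nz : (0 < mass n z)%R by exact: mass_gt0.
  have ngz : (0 < mass n.+1 (g' ++ z))%R.
    by rewrite -lte_fin massE; apply: convol_iter_gt0; rewrite -?massE ?lte_fin.
  have := info_step (a0 g' z) (mass1_gt0 ng') nz ngz.
  rewrite EFinD -addeA => /le_trans; apply; rewrite /f2; apply: leeD.
    by rewrite lee_fin ler_sqr ?nnegrE// ltW.
  rewrite ge0_muleDl ?lee_fin// mul1e [leRHS]addeA. exact: lexx.
have If1 : (dl)%:E * (nu [set g] * (h g)%:E) + (1 + entropy n) <=
    \int[nu]_g' \int[convol_iter nu n]_z f1 g' z.
  under eq_integral => g' _.
    rewrite ge0_integralD//; last 2 first.
    - by move=> z _; rewrite lee_fin.
    - by move=> z _; rewrite adde_ge0.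
    rewrite (probability_integralDl (convol_iter nu n))//.
    over.
  rewrite ge0_integralD//; last 2 first.
  - by move=> g' _; apply: integral_ge0 => z _; rewrite lee_fin.
  - by move=> g' _; rewrite adde_ge0 ?entropy_ge0.
  apply: leeD; last by rewrite probability_integral_cst; exact: lexx.
  apply: le_trans (integral_word_ge _ g _); last first.
    by move=> g'; apply: integral_ge0 => z _; rewrite lee_fin.
  rewrite muleCA; apply: lee_wpmul2l => //.
  have hn : \int[convol_iter nu n]_z (h (g ++ z))%:E = (h g)%:E.
    by apply: (@harmonic_convol_iter _ _ nu (EFin \o h)) => // u; rewrite lee_fin.
  rewrite -hn -ge0_integralZl_EFin//; last 2 first.
  - by move=> u _; rewrite lee_fin.
  - exact: ltW.
  apply: ge0_le_integral => // z _.
    by rewrite mule_ge0// lee_fin// ltW.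
  by rewrite -EFinM lee_fin /a eqxx mul1r.
have If2 : \int[nu]_g' \int[convol_iter nu n]_z f2 g' z <= (dl ^+ 2)%:E +
    ((dl)%:E * (nu [set g] * A) + (1 + entropy n.+1)).
  under eq_integral => g' _.
    rewrite (probability_integralDl (convol_iter nu n))//; last first.
      by move=> z; apply: adde_ge0 => //; apply: adde_ge0.
    rewrite ge0_integralD//; last by move=> z _; rewrite adde_ge0.
    rewrite ge0_integralD//.
    over.
  rewrite (probability_integralDl nu)//; last first.
    move=> g'; apply: adde_ge0; first exact: integral_ge0.
    by apply: adde_ge0; exact: integral_ge0.
  apply: leeD => //; rewrite ge0_integralD//; last 2 first.
  - by move=> g' _; exact: integral_ge0.
  - by move=> g' _; apply: adde_ge0; exact: integral_ge0.
  apply: leeD; last first.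
    rewrite ge0_integralD//; last 2 first.
    - by move=> g' _; exact: integral_ge0.
    - by move=> g' _; exact: integral_ge0.
    apply: leeD; last by rewrite -integral_convol_iterS//; exact: lexx.
    rewrite -[leRHS](probability_integral_cst nu 1); apply: le_integral_word => //.
      by move=> g'; exact: integral_ge0.
    move=> g' ng'.
    have cg' : charged nu g'.
      by exists 1%N; apply: mass1_gt0; rewrite lt0e ng' measure_ge0.
    rewrite -(integral_mean_dens n.+1 cg').
    have := @integral_ratio_le n g' (cst 1) (fun=> @lee01 R).
    rewrite (eq_integral (ratio n g')); last by move=> z _; exact: mul1e.
    rewrite [X in _ <= X](eq_integral (mean_dens g'))//.
    by move=> z _; exact: mul1e.
  apply: (@le_trans _ _ (\int[nu]_g' ((\1_[set g] g')%:E * ((dl)%:E * A)))).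
    apply: le_integral_word => [g'|g'|g' _]; first exact: integral_ge0.
      by rewrite !mule_ge0// lee_fin ltW.
    rewrite indicE; have [->|gg'] := eqVneq g' g; last first.
      rewrite integral0_eq; last first.
        by move=> z _; rewrite /a (negbTE gg') mul0r mulr0 mul0e.
      apply: mule_ge0; first by rewrite lee_fin.
      by apply: mule_ge0 => //; rewrite lee_fin ltW.
    rewrite mem_set// mul1e.
    apply: (@le_trans _ _ ((dl)%:E *
        \int[convol_iter nu n]_z ((h (g ++ z))%:E * ratio n g z))).
      rewrite -ge0_integralZl_EFin//; last 2 first.
      - by move=> z _; rewrite mule_ge0// lee_fin.
      - exact: ltW.
      apply: ge0_le_integral => // z _.
      rewrite /a eqxx mul1r EFinM -muleA; exact: lexx.
    apply: lee_wpmul2l; first by rewrite lee_fin ltW.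
    by apply: (integral_ratio_le n g (b := EFin \o h)) => u; rewrite lee_fin.
  have dA0 : 0 <= (dl)%:E * A by rewrite mule_ge0// lee_fin ltW.
  have -> : \int[nu]_g' ((\1_[set g] g')%:E * ((dl)%:E * A)) = nu [set g] * ((dl)%:E * A).
    by rewrite ge0_integralZr// (integral_word_set nu [set g]).
  rewrite muleCA; exact: lexx.
have E (o b e e' : \bar R) : o + (b + e + e') = e + (b + (o + e')).
  by rewrite (addeC b) -addeA (addeCA o e) (addeCA o b).
rewrite -(leeD2lE (x := 1))// (E 1) (addeCA 1).
exact: le_trans If1 (le_trans f12 If2).
Qed.

End entropy_step.

(** * Growth of the entropy *)

Section log_growth.
Context {R : realType} {W : alphabet}.
Variables (nu : probability (word W) R) (w : word W).
Hypothesis w0 : w <> [::].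
Local Open Scope ereal_scope.
Hypothesis moment : \int[nu]_g (log_wnorm w g)%:E < +oo.

Local Notation K := (wnorm w).

Definition log_tail (c : nat) (g : word W) : R :=
  if (c < K g)%N then log_wnorm w g else 0%R.

Lemma log_tail_ge0 c g : (0 <= log_tail c g)%R.
Proof. by rewrite /log_tail; case: ifP => // _; exact: log_wnorm_ge0. Qed.

Lemma log_tail_small (e : R) : (0 < e)%R ->
  exists c, \int[nu]_g (log_tail c g)%:E <= e%:E.
Proof.
move=> e0.
have : \int[nu]_g (log_tail n g)%:E @[n --> \oo] --> \int[nu]_g (cst 0 g : \bar R).
  apply: (@dominated_cvg _ _ _ nu setT measurableT
    (fun n g => (log_tail n g)%:E) (cst 0) (fun g => (log_wnorm w g)%:E)) => //.
  - move=> g _; apply: cvg_near_cst; exists (K g) => // n /= Kn.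
    by rewrite /log_tail ltnNge Kn.
  - apply/integrableP; split => //.
    by under eq_integral do rewrite /= ger0_norm ?log_wnorm_ge0//.
  - move=> n g _ /=; rewrite ger0_norm ?log_tail_ge0// lee_fin /log_tail.
    by case: ifP => // _; exact: log_wnorm_ge0.
rewrite integral0 => /fine_cvgP[[N _ hN]] /cvgr0Pnorm_le/(_ e e0)[M _ hM].
exists (maxn N M); have /= := hM _ (leq_maxr N M).
have := hN _ (leq_maxl N M); set I := integral _ _ _ => /= If /(le_trans (ler_norm _)).
by rewrite -[in X in _ -> X](fineK If) lee_fin.
Qed.

(** An increment of norm at most [c] adds at most [c] inside the logarithm; a larger one multiplies
    the argument by at most twice its norm, which costs its [log_wnorm]. The shift [a] lets the
    induction absorb the norm of the first increment. *)
Lemma log_growth (c n : nat) (a : R) : (1 <= a)%R ->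
  \int[convol_iter nu n]_z (ln (a + (K z)%:R))%:E <=
  (ln (a + (size w)%:R + (n * c)%:R))%:E + n%:R%:E * \int[nu]_g (log_tail c g)%:E.
Proof.
have T0 : 0 <= \int[nu]_g (log_tail c g)%:E.
  by apply: integral_ge0 => g _; rewrite lee_fin log_tail_ge0.
have l0 b m : (1 <= b)%R -> 0 <= (ln (b + m%:R) : R)%:E.
  by move=> b1; rewrite lee_fin ln_ge0// (le_trans b1)// lerDl.
elim: n a => [|n IHn] a a1.
  by rewrite integral_convol_iter0 wnorm_nil// mul0e adde0 mul0n addr0; exact: lexx.
rewrite integral_convol_iterS; last by move=> z; exact: l0.
apply: (@le_trans _ _ (\int[nu]_s (n%:R%:E * \int[nu]_g (log_tail c g)%:E +
    ((ln (a + (size w)%:R + (n.+1 * c)%:R))%:E + (log_tail c s)%:E)))).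
  apply: ge0_le_integral => //.
    by move=> s _; apply: integral_ge0 => t _; exact: l0.
  move=> s _.
  have aK1 : (1 <= a + (K s)%:R)%R by rewrite (le_trans a1)// lerDl.
  apply: (@le_trans _ _ (\int[convol_iter nu n]_t (ln (a + (K s)%:R + (K t)%:R))%:E)).
    apply: ge0_le_integral => //; first by move=> t _; exact: l0.
    move=> t _; rewrite lee_fin ler_ln ?posrE; last 2 first.
    - by rewrite (lt_le_trans ltr01)// (le_trans a1)// lerDl.
    - by rewrite (lt_le_trans ltr01)// (le_trans aK1)// lerDl.
    by rewrite -addrA lerD2l -natrD ler_nat wnorm_cat.
  apply: (le_trans (IHn _ aK1)); rewrite addeC leeD2l// -EFinD lee_fin.
  set b := (a + (size w)%:R + (n * c)%:R)%R.
  have b1 : (1 <= b)%R by rewrite /b -addrA (le_trans a1)// lerDl addr_ge0.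
  have -> : (a + (K s)%:R + (size w)%:R + (n * c)%:R = b + (K s)%:R)%R by rewrite /b; ring.
  have -> : (a + (size w)%:R + (n.+1 * c)%:R = b + c%:R)%R.
    by rewrite /b mulSn natrD; ring.
  have b0 : (0 < b)%R by exact: lt_le_trans b1.
  have bc0 : (0 < b + c%:R)%R by rewrite ltr_wpDr.
  have bK0 : (0 < b + (K s)%:R)%R by rewrite ltr_wpDr.
  rewrite /log_tail; case: ltnP => [_|Kc]; last first.
    by rewrite addr0 ler_ln ?posrE// lerD2l ler_nat.
  have K1 : (1 <= (K s)%:R :> R)%R by rewrite ler1n wnorm_gt0.
  have K0 : (0 < (K s)%:R :> R)%R by rewrite (lt_le_trans ltr01).
  rewrite /log_wnorm -lnM ?posrE ?mulr_gt0// ler_ln ?posrE ?mulr_gt0//.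
  have c0 : (0 <= c%:R :> R)%R by [].
  by nra.
have t0 s : 0 <= (log_tail c s)%:E by rewrite lee_fin log_tail_ge0.
set B := (ln (a + (size w)%:R + (n.+1 * c)%:R))%:E.
have lb0 : 0 <= B.
  by rewrite l0// (le_trans a1)// lerDl.
rewrite (probability_integralDl nu (f := fun s => B + (log_tail c s)%:E))//; last 2 first.
- by rewrite mule_ge0.
- by move=> s; rewrite adde_ge0.
rewrite (probability_integralDl nu (f := fun s => (log_tail c s)%:E))//.
rewrite addeCA; apply: leeD; first exact: lexx.
by rewrite -natr1 EFinD ge0_muleDl ?lee_fin// mul1e; exact: lexx.
Qed.

End log_growth.

(** * Linear against sublinear growth of the entropy *)

Section limit_inequality.
Context {R : realType} {W : alphabet}.
Variables (nu : probability (word W) R) (lam : probability (infinite_word W) R).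
Hypothesis st : stationary nu lam.
Variable w : word W.
Hypothesis w0 : w <> [::].
Local Open Scope ereal_scope.
Hypothesis moment : \int[nu]_g (log_wnorm w g)%:E < +oo.
Hypothesis nu_end : forall g, nu [set g] != 0 -> exists u, g = u ++ w.

Local Notation K := (wnorm w).

Lemma sum_telescope_le1 (s : seq nat) : uniq s -> all (leq 1) s ->
  (\sum_(k <- s) (k%:R * k.+1%:R)^-1 <= 1 :> R)%R.
Proof.
move=> us s1; pose M := (\max_(k <- s) k).+1.
pose t k : R := (k%:R * k.+1%:R)^-1%R.
have t0 k : (0 <= t k)%R by rewrite invr_ge0 mulr_ge0.
have -> : (\sum_(k <- s) (k%:R * k.+1%:R)^-1 = \sum_(1 <= k < M | k \in s) t k :> R)%R.
  rewrite -[RHS]big_filter; apply: perm_big; apply: uniq_perm => //.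
    by rewrite filter_uniq// iota_uniq.
  move=> k; rewrite mem_filter mem_index_iota; case: (boolP (k \in s)) => //= ks.
  by rewrite (allP s1 k ks) ltnS (@leq_bigmax_seq _ s predT id k ks isT).
apply: (@le_trans _ _ (\sum_(1 <= k < M) t k)%R).
  by rewrite big_mkcond/=; apply: ler_sum => k _; case: ifP.
have -> : (\sum_(1 <= k < M) t k = \sum_(1 <= k < M) ((- k.+1%:R^-1) - (- k%:R^-1)))%R.
  apply: eq_big_nat => k /andP[k1 _]; rewrite /t.
  have kn : (k%:R != 0 :> R)%R by rewrite pnatr_eq0 -lt0n.
  have k1n : (k.+1%:R != 0 :> R)%R by rewrite pnatr_eq0.
  by rewrite -natr1 in k1n *; field; rewrite kn natr1 pnatr_eq0.
by rewrite telescope_sumr// invr1 opprK gerDr oppr_le0 invr_ge0.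
Qed.

Lemma convol_iter_end n z : mass nu n.+1 z != 0%R -> exists u, z = u ++ w.
Proof.
move=> nz; apply: contrapT => nend; move/eqP: nz; apply.
rewrite /mass (_ : convol_iter nu n.+1 [set z] = 0)//.
rewrite (integral_word_set (convol_iter nu n.+1)) integral_convol_iterSr//.
apply: integral0_eq => s _.
rewrite (@eq_integral_word _ _ nu _ (cst 0)) ?integral0// => t /nu_end[u tu].
rewrite indicE memNset//= => stz; apply: nend; exists (s ++ u).
by rewrite -stz tu catA.
Qed.

(** Of two different prefixes of one word, the longer has an additional occurrence of [w], namely at
    its end. *)
Lemma wnorm_prefix_inj (x : infinite_word W) z z' :
  mkseq x (size z) = z -> mkseq x (size z') = z' ->
  (exists u, z = u ++ w) -> (exists u, z' = u ++ w) -> K z = K z' -> z = z'.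
Proof.
wlog : z z' / (size z <= size z')%N.
  move=> H zx z'x ze z'e Kz; have [zz|zz] := leqP (size z) (size z'); first exact: H.
  by apply/esym/H => //; exact: ltnW.
rewrite leq_eqVlt => /predU1P[zz zx z'x|lt_zz zx z'x _ [u' z'u] Kz].
  by rewrite -zx -z'x zz.
have z'E : z ++ drop (size z) z' = z'.
  rewrite -[RHS](cat_take_drop (size z)); congr (_ ++ _).
  by rewrite -z'x -map_take take_iota (minn_idPl (ltnW lt_zz)).
have := @wnorm_lt _ w z u' (drop (size z) z').
by rewrite z'E -z'u Kz ltnn => /(_ lt_zz erefl).
Qed.

(** The weights [1 / (k * (k + 1))] have sum 1 over the positive integers, and the possible
    positions among the prefixes of one infinite word have distinct norms. The time is [n.+1]
    because the empty word, the position at time 0, does not end with [w]. *)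
Lemma entropy_le_log n : entropy st n.+1 <=
  2%:E * \int[convol_iter nu n.+1]_z (ln (1 + (K z)%:R))%:E.
Proof.
have K0 z : (0 < (K z)%:R :> R)%R by rewrite ltr0n wnorm_gt0.
pose r z : R := ((K z)%:R * (K z).+1%:R)^-1%R.
have r0 z : (0 < r z <= 1)%R.
  rewrite invr_gt0 mulr_gt0//= invf_le1 ?mulr_gt0//.
  by rewrite -natrM ler1n muln_gt0 wnorm_gt0.
have ln0 z : 0 <= (ln (1 + (K z)%:R) : R)%:E by rewrite lee_fin ln_ge0// lerDl.
apply: (le_trans (@entropy_le _ _ _ _ st n.+1 r r0 _)).
  move=> X x uX Xn.
  have -> : (\sum_(z <- X | mkseq x (size z) == z) r z =
    \sum_(k <- [seq K z | z <- X & mkseq x (size z) == z]) (k%:R * k.+1%:R)^-1)%R.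
    by rewrite big_map big_filter.
  apply: sum_telescope_le1; last by rewrite all_map; apply/allP => z _ /=; rewrite wnorm_gt0.
  rewrite map_inj_in_uniq ?filter_uniq// => z z'.
  rewrite !mem_filter => /andP[/eqP zx zX] /andP[/eqP z'x z'X] Kzz.
  by apply: (wnorm_prefix_inj zx z'x) => //; apply: convol_iter_end; exact: Xn.
rewrite -ge0_integralZl_EFin//; apply: ge0_le_integral => //.
  by move=> z _; rewrite lee_fin oppr_ge0 ln_le0//; case/andP: (r0 z).
move=> z _; rewrite -EFinM lee_fin /r lnV ?posrE ?mulr_gt0// opprK lnM ?posrE//.
rewrite -natr1 [(1 + _)%R]addrC mulr_natl mulr2n lerD2r ler_ln ?posrE ?lerDl//.
Qed.

Let log_growth_arith (k1 e ly ld m db kdc : R) :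
  (k1 * e <= 2 * (ly + (m + k1) * (e / 16)) ->
   ly <= db + kdc - ld -> kdc <= k1 * (e / 16) ->
   k1 * (3 / 4 * e) <= 2 * (db - ld) + m * e / 8)%R.
Proof. by move=> h1 h2 h3; lra. Qed.

(** Multiplied by [nu [set g]], the left side is the mean of [h] at time [n] on the event that the
    first increment is [g]; the integral on the right replaces that event by its conditional
    probability given the limit word. A gap [eta] at all late times would make the entropy grow
    linearly. *)
Lemma limit_inequality g (h : word W -> R) (eta : R) n0 :
  0 < nu [set g] -> (forall u, 0 <= h u <= 1)%R -> harmonic nu (EFin \o h) ->
  (0 < eta)%R ->
  exists2 n, (n0 <= n)%N &
    (h g)%:E <= \int[convol_iter nu n]_u ((h u)%:E * mean_dens st g u) + eta%:E.
Proof.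
move=> nug h01 hh eta0; apply: contrapT => H.
pose A n := \int[convol_iter nu n]_u ((h u)%:E * mean_dens st g u).
have hA n : (n0 <= n)%N -> A n + eta%:E < (h g)%:E.
  by move=> n0n; rewrite ltNge; apply/negP => Ale; apply: H; exists n.
have A0 n : 0 <= A n.
  apply: integral_ge0 => u _; rewrite mule_ge0 ?mean_dens_ge0// lee_fin.
  by case/andP: (h01 u).
have Af n : (n0 <= n)%N -> A n \is a fin_num.
  move=> /hA Ah; rewrite ge0_fin_numE//; apply: (@le_lt_trans _ _ (A n + eta%:E)).
    by rewrite leeDl// lee_fin ltW.
  exact: lt_trans Ah (ltry _).
pose p := fine (nu [set g]).
have pE : p%:E = nu [set g] by rewrite fineK// fin_num_measure.
have p0 : (0 < p)%R by rewrite -lte_fin pE.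
(* With this choice the gain [dl * p * eta] is [2 * dl ^+ 2], so a net [dl ^+ 2] per step remains
   after the loss. *)
pose dl := (p * eta / 2)%R.
have dl0 : (0 < dl)%R by rewrite divr_gt0// mulr_gt0.
pose e := (dl ^+ 2)%R; have e0 : (0 < e)%R by rewrite exprn_gt0.
have step n : (n0 <= n)%N -> e%:E + entropy st n <= entropy st n.+1.
  move=> n0n; have := entropy_step st n dl0 h01 hh nug.
  have := hA _ (leqW n0n); rewrite -[X in _ * (_ * X) + _ + _]/(A n.+1).
  rewrite -(fineK (Af _ (leqW n0n))) -pE; move: (fine (A n.+1)) => a.
  rewrite -EFinD lte_fin => ah le.
  rewrite -(@leeD2lE _ (dl * (p * a) + e)%:E)//.
  apply: le_trans le; rewrite addeA -EFinD -!EFinM leeD2r// lee_fin.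
  have ee : (e + e = dl * (p * eta))%R by rewrite /e /dl; field.
  by rewrite -addrA ee -!mulrDr ler_pM2l// ler_pM2l// ltW.
have grow k : (k%:R * e)%:E <= entropy st (n0 + k).
  elim: k => [|k IHk]; first by rewrite mul0r entropy_ge0.
  rewrite addnS; apply: le_trans (step _ (leq_addr _ _)).
  by rewrite -natr1 mulrDl mul1r addrC EFinD leeD2l.
(* The tail and the slope [delta * c] of the linear bound on the logarithm are both at most
   [e / 16]. Doubled by [entropy_le_log], they take at most [e / 8] each from the slope [e], which
   leaves [3 / 4 * e]. *)
have e16 : (0 < e / 16)%R by rewrite divr_gt0.
have [c cT] := log_tail_small w0 moment e16.
pose b := (1 + (size w)%:R + (n0 * c)%:R : R)%R.
have b0 : (0 < b)%R by rewrite /b -addrA ltr_wpDr.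
pose delta := (e / (16 * c.+1%:R))%R.
have delta0 : (0 < delta)%R by rewrite divr_gt0// mulr_gt0.
pose C := (2 * (delta * b - ln delta) + n0%:R * e / 8)%R.
have bound k : (0 < k)%N -> (k%:R * (3 / 4 * e) <= C)%R.
  case: k => // k _; have := le_trans (grow k.+1) _.
  rewrite addnS => /(_ _ (entropy_le_log _)) ke.
  have lg := log_growth nu w0 c (n0 + k).+1 (lexx 1%R).
  set N := (n0 + k).+1 in ke lg.
  set y := (1 + (size w)%:R + (N * c)%:R)%R in lg.
  have y0 : (0 < y)%R by rewrite /y -addrA ltr_wpDr.
  have {}ke : (k.+1%:R * e <= 2 * (ln y + N%:R * (e / 16)))%R.
    rewrite -lee_fin; apply: (le_trans ke); rewrite EFinM lee_wpmul2l ?lee_fin//.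
    apply: (le_trans lg); rewrite EFinD leeD2l// EFinM lee_wpmul2l// lee_fin//.
  have lny : (ln y <= delta * y - ln delta)%R.
    rewrite lerBrDr addrC -lnM ?posrE// ltW// ln_sublinear// mulr_gt0//.
  have yE : (y = b + k.+1%:R * c%:R)%R.
    by rewrite /y /b /N -addnS !natrM natrD; ring.
  have dc : (delta * c%:R <= e / 16)%R.
    have c1n : (c.+1%:R != 0 :> R)%R by rewrite pnatr_eq0.
    have -> : (delta * c%:R = e / 16 * (c%:R / c.+1%:R))%R.
      by rewrite /delta; field; rewrite ?[(1 + _)%R]addrC ?natr1.
    apply: ler_piMr; first exact: ltW.
    by rewrite ler_pdivrMr// mul1r ler_nat.
  have kc : (k.+1%:R * (delta * c%:R) <= k.+1%:R * (e / 16))%R by rewrite ler_wpM2l.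
  have NE : (N%:R = n0%:R + k.+1%:R :> R)%R by rewrite /N -addnS natrD.
  rewrite [X in (_ <= delta * X - _)%R]yE mulrDr [(delta * (_ * _))%R]mulrCA in lny; rewrite NE in ke.
  exact: log_growth_arith ke lny kc.
have := archi_boundP (normr_ge0 (C / (3 / 4 * e))%R).
set k := Num.bound _ => Ck.
have k0 : (0 < k)%N by rewrite -(ltr0n R) (le_lt_trans _ Ck).
have := bound k k0; rewrite -ler_pdivlMr ?mulr_gt0// leNgt.
by rewrite (le_lt_trans (ler_norm _) Ck).
Qed.

End limit_inequality.

(** * The law of the increments and tail events *)

Section rectangles.
Context {A : alphabet}.
Implicit Types (B : nat -> set A) (x : seq_space A).

Definition rectangle n B : set (seq_space A) :=
  [set x | forall i, (i < n)%N -> B i (x i)].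

Definition rectangles : set (set (seq_space A)) :=
  [set R | exists n B, R = rectangle n B].

Lemma measurable_rectangle n B : measurable (rectangle n B).
Proof.
have -> : rectangle n B = \bigcap_(i in `I_n) [set x | B i (x i)] by [].
by apply: fin_bigcap_measurable => // i _; exact: measurable_coordinate.
Qed.

Lemma setI_closed_rectangles : setI_closed rectangles.
Proof.
move=> _ _ [n [B ->]] [m [C ->]].
exists (maxn n m), (fun i => [set a | ((i < n)%N -> B i a) /\ ((i < m)%N -> C i a)]).
apply/seteqP; split => [x [Bx Cx] i _|x BC]; first by split=> ?; [exact: Bx|exact: Cx].
split => i im; have /BC[] : (i < maxn n m)%N by rewrite leq_max im ?orbT.
  by move=> /(_ im).
by move=> _ /(_ im).
Qed.

Lemma measurable_rectanglesE : measurable = <<s rectangles >>.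
Proof.
apply/seteqP; split.
  apply: smallest_sub; first exact: smallest_sigma_algebra.
  move=> _ [n _ [B _ <-]]; apply: sub_sigma_algebra.
  exists n.+1, (fun i => if i == n then B else setT); apply/seteqP; split.
    by move=> x [_ Bx] i _; case: eqP => // ->.
  by move=> x /(_ n (ltnSn n)); rewrite eqxx.
apply: smallest_sub; first exact: sigma_algebra_measurable.
by move=> _ [n [B ->]]; exact: measurable_rectangle.
Qed.

Lemma rectangle_measure_unique (R : realType)
    (m1 m2 : {measure set (seq_space A) -> \bar R}) : (m1 setT < +oo)%E ->
  (forall n B, m1 (rectangle n B) = m2 (rectangle n B)) ->
  forall E, measurable E -> m1 E = m2 E.
Proof.
move=> m1T m12 E mE.
apply: (measure_unique rectangles (fun=> setT)) => //.
- exact: measurable_rectanglesE.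
- exact: setI_closed_rectangles.
- by move=> _; exists 0%N, (fun=> setT); apply/seteqP; split.
- by rewrite bigcup_const//; exists 0%N.
- by move=> _ [n [B ->]]; exact: m12.
Qed.

End rectangles.

Section increments.
Context {R : realType} {W : alphabet}.
Local Open Scope ereal_scope.

Definition scons (A : Type) (a : A) (x : seq_space A) : seq_space A :=
  fun n => if n is n'.+1 then x n' else a.

Lemma measurable_scons (s : word W) : measurable_fun setT (scons s).
Proof.
apply: measurable_fun_seq_space => -[|n] a; last exact: (measurable_coordinate n [set a]).
have [sa|sa] := pselect (s = a).
  by rewrite (_ : mkset _ = setT)//; apply/seteqP; split.
by rewrite (_ : mkset _ = set0)//; apply/seteqP; split.
Qed.

Definition scons_pair (z : word W * seq_space (word W)) := scons z.1 z.2.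

Lemma measurable_scons_pair : measurable_fun setT scons_pair.
Proof. by apply: measurable_fun_word_prod => g; exact: measurable_scons. Qed.

HB.instance Definition _ :=
  isMeasurableFun.Build _ _ _ _ scons_pair measurable_scons_pair.

(** First-step decomposition of a law of independent increments; it is the form in which the
    arguments about tail events use independence. *)
Definition self_similar (mu : probability (word W) R)
    (M : probability (seq_space (word W)) R) :=
  forall E, measurable E -> M E = \int[mu]_s M (scons s @^-1` E).

Context d (T : measurableType d) (Pr : probability T R).
Variables (mu : probability (word W) R) (xi : nat -> {mfun T >-> word W}).
Hypothesis xi_iid : iid Pr mu xi.

Definition increments (t : T) : seq_space (word W) := fun i => xi i t.

Lemma measurable_increments : measurable_fun setT increments.
Proof.
apply: measurable_fun_seq_space => n a.
rewrite -[X in measurable X]setTI.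
by have := @measurable_funP _ _ _ _ setT (xi n) measurableT [set a]; exact.
Qed.

HB.instance Definition _ :=
  isMeasurableFun.Build _ _ _ _ increments measurable_increments.

Definition increments_law : probability (seq_space (word W)) R :=
  distribution Pr increments.

Lemma increments_law_rectangle n B :
  increments_law (rectangle n B) = \prod_(i < n) mu (B i).
Proof.
have [xi_law xi_ind] := xi_iid.
have := xi_ind [fset val i | i in 'I_n]%fset B.
rewrite (_ : \bigcap_(_ in _) _ = increments @^-1` rectangle n B); last first.
  apply/seteqP; split => [t Bt i ni|t Bt i /= /imfsetP[/= j _ ->]]; last exact: Bt.
  by apply: (Bt i) => /=; apply/imfsetP; exists (Ordinal ni).
move=> E; apply: (etrans E); rewrite big_imfset/=; last by move=> ? ? ? ?; exact: val_inj.
by rewrite big_enum/=; apply: eq_bigr => i _; exact: xi_law.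
Qed.

(** Both sides are probability measures in [E], and by independence they agree on rectangles, which
    generate the sigma-algebra. *)
Lemma increments_law_self_similar : self_similar mu increments_law.
Proof.
move=> E mE; have -> : \int[mu]_s increments_law (scons s @^-1` E) =
    distribution (mu \x increments_law) scons_pair E.
  apply: eq_integral => g _; rewrite /=; congr (Pr _).
  by apply/seteqP; split => x; rewrite /xsection/= ?inE.
apply: (rectangle_measure_unique (m2 := distribution (mu \x increments_law) scons_pair)) => //.
  exact: le_lt_trans (probability_le1 _ measurableT) (ltry _).
move=> [|n] B.
  rewrite (_ : rectangle 0 B = setT); first exact: (etrans (probability_setT _) (esym (probability_setT _))).
  by apply/seteqP; split.
apply: etrans (increments_law_rectangle _ _) _; rewrite big_ord_recl.
rewrite /distribution/= /pushforward/=.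
rewrite (_ : scons_pair @^-1` _ = B 0%N `*` rectangle n (fun i => B i.+1)); last first.
  apply/seteqP; split => [[s x] Bsx|[s x] [/= Bs Bx] [|i] ni //]; last exact: Bx.
  by split => [|i ni]; [exact: (Bsx 0%N)|exact: (Bsx i.+1)].
rewrite product_measure1E//; last exact: measurable_rectangle.
by congr (_ * _); exact: esym (increments_law_rectangle n (fun i => B i.+1)).
Qed.

End increments.

(** * Approximation by cylinders *)

Section cylinder_approximation.
Context {A : alphabet} {R : realType} (M : probability (seq_space A) R).
Local Open Scope ereal_scope.

Definition depends_on_first (n : nat) (C : set (seq_space A)) :=
  forall x y, (forall i, (i < n)%N -> x i = y i) -> C x -> C y.

Definition approximable : set (set (seq_space A)) :=
  [set E | measurable E /\ forall e : R, (0 < e)%R ->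
    exists n C, [/\ depends_on_first n C, measurable C & M (E `+` C) < e%:E]].

Let approximableC E : approximable E -> approximable (~` E).
Proof.
move=> [mE appE]; split=> [|e e0]; first exact: measurableC.
have [n [C [dC mC EC]]] := appE e e0; exists n, (~` C); split.
- by move=> x y xy nCx Cy; apply: nCx; apply: dC Cy => i /xy ->.
- exact: measurableC.
- suff -> : ~` E `+` ~` C = E `+` C by [].
  by apply/seteqP; split => x; rewrite /setY/=; have [] := pselect (E x);
    have [] := pselect (C x); tauto.
Qed.

Let measurable_setY (E F : set (seq_space A)) :
  measurable E -> measurable F -> measurable (E `+` F).
Proof. by move=> mE mF; apply: measurableU; exact: measurableD. Qed.

Let approximableU E F : approximable E -> approximable F -> approximable (E `|` F).
Proof.
move=> [mE appE] [mF appF]; split=> [|e e0]; first exact: measurableU.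
have e20 : (0 < e / 2)%R by rewrite divr_gt0.
have [n [C [dC mC EC]]] := appE _ e20.
have [m [D [dD mD FD]]] := appF _ e20.
exists (maxn n m), (C `|` D); split.
- move=> x y xy [Cx|Dx]; [left; apply: dC Cx => i im|right; apply: dD Dx => i im];
    by apply: xy; rewrite leq_max im ?orbT.
- exact: measurableU.
apply: (@le_lt_trans _ _ (M ((E `+` C) `|` (F `+` D)))).
  apply: le_measure; rewrite ?inE.
  - by apply: measurable_setY; exact: measurableU.
  - by apply: measurableU; exact: measurable_setY.
  move=> x; rewrite /setY/=; have [] := pselect (E x); have [] := pselect (C x);
    have [] := pselect (F x); have [] := pselect (D x); tauto.
rewrite (splitr e) EFinD; apply: (@le_lt_trans _ _ (M (E `+` C) + M (F `+` D))).
  by apply: measureU2; exact: measurable_setY.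
exact: lteD.
Qed.

(** Approximable sets form a sigma-algebra containing the coordinate sets. A countable union is
    first cut to a finite one, which uses half of the error. *)
Lemma measurable_approximable E : measurable E -> approximable E.
Proof.
have app0 : approximable set0.
  split=> // e e0; exists 0%N, set0; split=> //.
  by rewrite setYK measure0 lte_fin.
move: E; apply: smallest_sub; last first.
  move=> _ [n _ [B _ <-]]; rewrite setTI.
  have mB : measurable ((fun x : seq_space A => x n) @^-1` B).
    exact: measurable_coordinate.
  split=> // e e0; exists n.+1, ((fun x : seq_space A => x n) @^-1` B); split => //.
    by move=> x y xy; rewrite /= xy.
  by rewrite setYK measure0 lte_fin.
split => //; first by move=> E appE; rewrite setTD; exact: approximableC.
move=> F appF; have mF i : measurable (F i) by case: (appF i).
split=> [|e e0]; first exact: bigcupT_measurable.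
have e20 : (0 < e / 2)%R by rewrite divr_gt0.
pose G N := \big[setU/set0]_(i < N) F i.
have appG N : approximable (G N).
  by rewrite /G; elim/big_ind : _ => // *; exact: approximableU.
have mG N : measurable (G N) by case: (appG N).
pose H N := (\bigcup_i F i) `\` G N.
have mU : measurable (\bigcup_i F i) by exact: bigcupT_measurable.
have mH N : measurable (H N) by exact: measurableD.
have H0 : \bigcap_N H N = set0.
  apply/seteqP; split => // x Hx; have [[i _ Fx] _] := Hx 0%N I.
  have [_] := Hx i.+1 I; apply; rewrite /G big_ord_recr/=; by right.
have := @nonincreasing_cvg_mu _ _ _ M H.
rewrite H0 measure0 => /(_ _ mH measurable0) cvgH.
have {cvgH} : M (H N) @[N --> \oo] --> 0.
  apply: cvgH; first by rewrite (le_lt_trans (probability_le1 _ (mH _)))// ltry.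
  move=> i j ij; apply/subsetPset => x [Ux Gx]; split=> // Gix; apply: Gx.
  move: Gix; rewrite /G; apply: subset_bigsetU => //.
move=> /fine_cvgP[_] /cvgr0Pnorm_lt/(_ _ e20)[N _ /(_ N (leqnn N))]/=.
rewrite ger0_norm ?fine_ge0// => HN.
have [_ /(_ _ e20)[n [C [dC mC GC]]]] := appG N.
exists n, C; split => //.
apply: (@le_lt_trans _ _ (M (H N `|` (G N `+` C)))).
  apply: le_measure; rewrite ?inE.
  - exact: measurable_setY.
  - by apply: measurableU => //; exact: measurable_setY.
  move=> x [[Ux nCx]|[Cx nUx]].
    by have [Gx|Gx] := pselect (G N x); [right; left|left].
  right; right; split => //; apply: contra_not nUx.
  by rewrite /G -bigcup_mkord => -[i _ Fix]; exists i.
rewrite (splitr e) EFinD; apply: (@le_lt_trans _ _ (M (H N) + M (G N `+` C))).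
  by apply: measureU2 => //; exact: measurable_setY.
apply: lteD => //; rewrite -[X in X < _](@fineK _ (M (H N))) ?fin_num_measure//.
Qed.

End cylinder_approximation.

Section walk_path.
Context {W : alphabet}.
Implicit Types (u s : word W) (x : seq_space (word W)).

Definition walk_path u x : path_space W := fun n => u ++ flatten (mkseq x n).

Lemma walk_path0 u x : walk_path u x 0%N = u.
Proof. by rewrite /walk_path cats0. Qed.

Lemma walk_path_cat u s x n : walk_path (u ++ s) x n = u ++ walk_path s x n.
Proof. by rewrite /walk_path catA. Qed.

Lemma walk_path_scons u s x n :
  walk_path u (scons s x) n.+1 = walk_path (u ++ s) x n.
Proof.
rewrite /walk_path -catA; congr (_ ++ _).
by rewrite /mkseq /= (iotaDl 1 0) -map_comp.
Qed.

Lemma walk_pathS u x n : walk_path u x n.+1 = walk_path u x n ++ x n.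
Proof.
by rewrite /walk_path -catA mkseqS -cats1 flatten_cat/= cats0.
Qed.

Lemma tail_equiv_walk_path u s x :
  tail_equiv (walk_path u (scons s x)) (walk_path (u ++ s) x).
Proof. by exists 1%N, 0%N => n; rewrite addn1 addn0 walk_path_scons. Qed.

Lemma tail_equiv_sym (x y : path_space W) : tail_equiv x y -> tail_equiv y x.
Proof. by move=> [i [j xy]]; exists j, i => n; rewrite xy. Qed.

Lemma measurable_walk_path u : measurable_fun setT (walk_path u).
Proof.
apply: measurable_fun_seq_space => n a; elim: n a => [|n IHn] a.
  have [ua|ua] := pselect (u = a).
    by rewrite (_ : mkset _ = setT)//; apply/seteqP; split => // x; rewrite /= walk_path0.
  by rewrite (_ : mkset _ = set0)//; apply/seteqP; split => // x; rewrite /= walk_path0.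
rewrite (_ : mkset _ = \bigcup_(v in setT) \bigcup_(s in [set s | v ++ s = a])
  ([set x | walk_path u x n = v] `&` [set x | x n = s])); last first.
  apply/seteqP; split => [x /=|x [v _ [s /= vs [xv xs]]]]; rewrite /= walk_pathS.
    by move=> xa; exists (walk_path u x n) => //; exists (x n).
  by rewrite xv xs.
apply: countable_bigcupT_measurable => [|v]; first exact: countableP.
rewrite bigcup_mkcond; apply: countable_bigcupT_measurable => [|s]; first exact: countableP.
case: ifP => // _; apply: measurableI; first exact: IHn.
exact: (@measurable_coordinate (word W) n [set s]).
Qed.

End walk_path.

HB.instance Definition _ (W : alphabet) (u : word W) :=
  isMeasurableFun.Build _ _ _ _ (walk_path u) (measurable_walk_path u).

(** * Harmonic functions of tail events and the 0-1 law *)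

Section invariant_functions.
Context {R : realType} {W : alphabet}.
Variables (mu : probability (word W) R) (M : probability (seq_space (word W)) R).
Hypothesis M_self_similar : self_similar mu M.
Local Open Scope ereal_scope.

Lemma integral_self_similar (f : seq_space (word W) -> \bar R) :
  (forall x, 0 <= f x) -> measurable_fun setT f ->
  \int[M]_x f x = \int[mu]_s \int[M]_x f (scons s x).
Proof.
move=> f0 mf.
have mfF : measurable_fun setT (fun z : word W * seq_space (word W) => f (scons z.1 z.2)).
  exact: (measurableT_comp mf measurable_scons_pair).
rewrite -(fubini_tonelli1 (fun z : word W * seq_space (word W) => f (scons z.1 z.2)))//.
rewrite -(@ge0_integral_distribution _ _ _ _ _ (mu \x M) scons_pair)//.
apply: eq_measure_integral => E mE _; apply: etrans (M_self_similar mE) _.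
apply: eq_integral => g _; rewrite /=; congr (M _).
by apply/seteqP; split => x; rewrite /xsection/= ?inE.
Qed.

Definition path_mean (Phi : path_space W -> \bar R) (u : word W) : \bar R :=
  \int[M]_x Phi (walk_path u x).

Lemma path_mean_harmonic (Phi : path_space W -> \bar R) :
  (forall y, 0 <= Phi y) -> measurable_fun setT Phi ->
  (forall y z, tail_equiv y z -> Phi y = Phi z) -> harmonic mu (path_mean Phi).
Proof.
move=> Phi0 mPhi Phi_inv u; rewrite /path_mean.
rewrite (integral_self_similar (f := fun x => Phi (walk_path u x)))//; last first.
  exact: (measurableT_comp mPhi (measurable_walk_path u)).
apply: eq_integral => s _; apply: eq_integral => x _.
exact/esym/Phi_inv/tail_equiv_walk_path.
Qed.

Definition hit (B : set (path_space W)) (u : word W) : \bar R := M (walk_path u @^-1` B).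

Lemma measurable_walk_path_preimage (u : word W) (B : set (path_space W)) :
  measurable B -> measurable (walk_path u @^-1` B).
Proof. by move=> mB; rewrite -[X in measurable X]setTI; exact: measurable_walk_path. Qed.

Lemma hitE B u : measurable B -> hit B u = path_mean (fun y => (\1_B y)%:E) u.
Proof.
move=> mB; have mpB := measurable_walk_path_preimage u mB.
have := integral_indic M measurableT mpB; rewrite setIT => /esym; exact.
Qed.

Lemma hit_ge0 B u : 0 <= hit B u. Proof. exact: measure_ge0. Qed.

Lemma hit_le1 B u : measurable B -> hit B u <= 1.
Proof. by move=> mB; apply: probability_le1; exact: measurable_walk_path_preimage. Qed.

Lemma hit_setC B u : measurable B -> hit B u + hit (~` B) u = 1.
Proof.
move=> mB; have mpB := measurable_walk_path_preimage u mB.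
rewrite /hit preimage_setC probability_setC// addeC subeK// fin_num_measure//.
Qed.

Lemma tail_measurableC (B : set (path_space W)) : tail_measurable B -> tail_measurable (~` B).
Proof.
move=> [mB Binv]; split; first exact: measurableC.
by move=> x y xy nBx By; apply: nBx; apply: Binv By; exact: tail_equiv_sym.
Qed.

Lemma hit_harmonic B : tail_measurable B -> harmonic mu (hit B).
Proof.
move=> [mB Binv] u; rewrite hitE//.
rewrite -(path_mean_harmonic (Phi := fun y => (\1_B y)%:E))//.
- by apply: eq_integral => s _; rewrite hitE.
- exact/measurable_EFinP/measurable_indic.
move=> y z yz; rewrite !indicE; congr ((nat_of_bool _)%:R%:E).
by apply/idP/idP => /set_mem h; apply/mem_set; [exact: Binv h|];
  apply: Binv h; exact: tail_equiv_sym.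
Qed.

(* A form of Levy's 0-1 law: no mass escapes from [min (hit B) (hit (~` B))]. *)
Lemma harmonic_below_hit_eq0 (B : set (path_space W)) (k : word W -> \bar R) :
  tail_measurable B -> (forall u, 0 <= k u) -> harmonic mu k ->
  (forall u, k u <= hit B u) -> (forall u, k u <= hit (~` B) u) -> k [::] = 0.
Proof.
move=> [mB Binv] k0 hk kB kBC.
have mpB u := measurable_walk_path_preimage u mB.
(* A set depending on no coordinate is empty or full, so its symmetric difference with the event is
   the event or its complement, and both dominate [k]. Harmonicity of [k] and self-similarity of [M]
   carry the bound to longer cylinders. *)
have bound n C u : depends_on_first n C -> measurable C ->
    k u <= M ((walk_path u @^-1` B) `+` C).
  elim: n C u => [|n IHn] C u dC mC.
    have [[x0 Cx0]|C0] := pselect (exists x, C x).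
      have -> : C = setT by apply/seteqP; split => // x _; exact: dC Cx0.
      by rewrite setYTC; exact: kBC.
    have -> : C = set0 by apply/seteqP; split => // x Cx; apply: C0; exists x.
    by rewrite setY0; exact: kB.
  have mY : measurable ((walk_path u @^-1` B) `+` C).
    by apply: measurableU; exact: measurableD.
  rewrite -hk (M_self_similar mY); apply: ge0_le_integral => // s _.
  have := IHn (scons s @^-1` C) (u ++ s).
  have msC : measurable (scons s @^-1` C).
    by rewrite -[X in measurable X]setTI; exact: measurable_scons.
  move=> /(_ _ msC); rewrite (_ : _ `+` _ = scons s @^-1` (walk_path u @^-1` B `+` C)).
    apply => x y xy; apply: dC => -[|i] ni //=; exact: xy.
  have PB x : B (walk_path u (scons s x)) <-> B (walk_path (u ++ s) x).
    by split; apply: Binv; [|apply: tail_equiv_sym]; exact: tail_equiv_walk_path.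
  by apply/seteqP; split => x; rewrite /setY/= PB.
apply/eqP; rewrite eq_le k0 andbT; apply/lee_addgt0Pr => e e0; rewrite add0e.
have [_ /(_ e e0)[n [C [dC mC BC]]]] := measurable_approximable M (mpB [::]).
exact: le_trans (bound n C [::] dC mC) (ltW BC).
Qed.

End invariant_functions.

(** * Convergence to infinite words *)

Section limit_word.
Context {W : alphabet}.
Implicit Types (u s p : word W) (y z : path_space W) (g : infinite_word W).

Lemma mkseq_prefix (g : infinite_word W) k p : prefix (mkseq g k) p ->
  forall i, (i < k)%N -> nth point p i = g i.
Proof.
move=> /prefixP[t ->] i ik.
by rewrite nth_cat size_mkseq ik nth_mkseq.
Qed.

Lemma prefix_mkseq (g : infinite_word W) k p : (k <= size p)%N ->
  (forall i, (i < k)%N -> nth point p i = g i) -> prefix (mkseq g k) p.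
Proof.
move=> kp pg; apply/prefixP; exists (drop k p); rewrite -[LHS](cat_take_drop k).
congr (_ ++ _); apply: (@eq_from_nth _ point); rewrite size_takel// ?size_mkseq// => i ik.
by rewrite nth_take// nth_mkseq// pg.
Qed.

Lemma converges_unique y g g' : converges y g -> converges y g' -> g = g'.
Proof.
move=> yg yg'; apply/funext => i.
have [N _ hN] := yg i.+1; have [N' _ hN'] := yg' i.+1.
pose n := maxn N N'.
rewrite -(mkseq_prefix (hN n (leq_maxl _ _)) (ltnSn i)).
by rewrite -(mkseq_prefix (hN' n (leq_maxr _ _)) (ltnSn i)).
Qed.

Lemma limit_wordE y g : converges y g -> limit_word y = g.
Proof. by move=> yg; apply: xget_unique => // g' yg'; exact: converges_unique yg. Qed.

Lemma tail_equiv_converges y z g : tail_equiv y z -> converges y g -> converges z g.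
Proof.
move=> [i [j yz]] yg k; have [N _ hN] := yg k; exists (N + j)%N => // n /= Nn.
have jn : (j <= n)%N by rewrite (leq_trans _ Nn)// leq_addl.
rewrite -(subnK jn) -yz; apply: hN => /=.
by rewrite (leq_trans _ (leq_addr _ _))// leq_subRL// addnC.
Qed.

(** Both paths have the same set of limits, so the equality also holds for the junk value off the
    convergent paths. *)
Lemma limit_word_tail_equiv y z : tail_equiv y z -> limit_word y = limit_word z.
Proof.
move=> yz; rewrite /limit_word; congr (xget _ _); apply/seteqP.
by split => g; [|move: (tail_equiv_sym yz)]; exact: tail_equiv_converges.
Qed.

Definition eventually_begins p : set (path_space W) :=
  [set y | \forall n \near \oo, prefix p (y n)].

Lemma measurable_eventually_begins p : measurable (eventually_begins p).
Proof.
rewrite (_ : eventually_begins p =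
    \bigcup_N \bigcap_(n in [set n | (N <= n)%N]) [set y | [set q | prefix p q] (y n)]).
  apply: bigcupT_measurable => N; apply: bigcap_measurableType => n _.
  exact: (@measurable_coordinate (word W)).
by apply/seteqP; split => [y [N _ hN]|y [N _ hN]]; exists N.
Qed.

(** Convergence is rewritten through countably many prefix events, which makes it measurable. *)
Definition convergent : set (path_space W) :=
  \bigcap_k \bigcup_(p in [set p | size p = k]) eventually_begins p.

Lemma measurable_bigcup_word d (T : measurableType d) (D : set (word W))
    (F : word W -> set T) : (forall p, measurable (F p)) ->
  measurable (\bigcup_(p in D) F p).
Proof.
move=> mF; rewrite bigcup_mkcond; apply: countable_bigcupT_measurable => [|p].
  exact: countableP.
by case: ifP.
Qed.

Lemma measurable_convergent : measurable convergent.
Proof.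
apply: bigcapT_measurable => k; apply: measurable_bigcup_word => p.
exact: measurable_eventually_begins.
Qed.

Lemma convergentP y : convergent y <-> exists g, converges y g.
Proof.
split=> [cy|[g yg] k _]; last first.
  by exists (mkseq g k); [rewrite /= size_mkseq|exact: yg].
have /choice[p pP] : forall k, exists p : word W, size p = k /\ eventually_begins p y.
  by move=> k; have [p pk yp] := cy k I; exists p.
exists (fun i => nth point (p i.+1) i) => k.
have [sk [N _ hN]] := pP k; exists N => // n Nn.
have pk := hN n Nn; rewrite (_ : mkseq _ k = p k)//.
apply: (@eq_from_nth _ point); rewrite size_mkseq ?sk// => i ik.
rewrite nth_mkseq//; have [si [N' _ hN']] := pP i.+1.
have /prefixP[t tE] := hN (maxn N N') (leq_maxl _ _).
have /prefixP[t' t'E] := hN' (maxn N N') (leq_maxr _ _).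
have := congr1 (nth point ^~ i) tE.
by rewrite t'E !nth_cat si sk ltnSn ik.
Qed.

Lemma measurable_limit_word : measurable_fun setT (@limit_word W).
Proof.
apply: measurable_fun_seq_space => n a.
rewrite (_ : mkset _ = (convergent `&` \bigcup_(p in [set p | size p = n.+1 /\
    nth point p n = a]) eventually_begins p) `|`
    (~` convergent `&` [set _ | point = a :> W])); last first.
  apply/seteqP; split => [y /=|y].
    have [cy|ncy] := pselect (convergent y).
      have [g yg] := (convergentP y).1 cy.
      rewrite (limit_wordE yg) => ga; left; split => //.
      exists (mkseq g n.+1); last exact: yg.
      by split; [rewrite size_mkseq|rewrite nth_mkseq].
    rewrite /limit_word xgetPN; last first.
      by move=> g yg; apply: ncy; apply/convergentP; exists g.
    by move=> pa; right.
  move=> [[cy [p [sp pa] [N _ hN]]]|[ncy pa]] /=; last first.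
    rewrite /limit_word xgetPN => [//|g yg].
    by apply: ncy; apply/convergentP; exists g.
  have [g yg] := (convergentP y).1 cy; rewrite (limit_wordE yg).
  have [N' _ hN'] := yg n.+1.
  rewrite -(mkseq_prefix (hN' _ (leq_maxr N N')) (ltnSn n)) -pa.
  have /prefixP[t ->] := hN _ (leq_maxl N N').
  by rewrite nth_cat sp ltnSn.
apply: measurableU; apply: measurableI.
- exact: measurable_convergent.
- by apply: measurable_bigcup_word => p; exact: measurable_eventually_begins.
- by apply: measurableC; exact: measurable_convergent.
have [pa|pa] := pselect (point = a :> W).
  by rewrite (_ : mkset _ = setT)//; apply/seteqP; split.
by rewrite (_ : mkset _ = set0)//; apply/seteqP; split.
Qed.

Lemma converges_act u (x : seq_space (word W)) g :
  converges (walk_path [::] x) g -> converges (walk_path u x) (act u g).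
Proof.
move=> xg k; have [N _ hN] := xg k; exists N => // n Nn.
have /prefixP[t tE] := hN n Nn.
rewrite -[u]cats0 walk_path_cat tE; apply: prefix_mkseq.
  by rewrite !size_cat size_mkseq addnCA leq_addr.
move=> i ik; rewrite cats0 nth_cat /act; case: ltnP => // ui.
have iuk : (i - size u < k)%N by rewrite (leq_ltn_trans (leq_subr _ _)).
by rewrite nth_cat size_mkseq iuk nth_mkseq.
Qed.

Lemma prefix_walk_path u (x : seq_space (word W)) n m :
  prefix (walk_path u x n) (walk_path u x (n + m)%N).
Proof.
elim: m => [|m IHm]; first by rewrite addn0 prefix_refl.
by rewrite addnS walk_pathS; apply: prefix_trans IHm (prefix_prefix _ _).
Qed.

(** Each position is a prefix of the next, so a letter once read never changes, and infinitely many
    non-empty increments make the length unbounded. *)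
Lemma converges_walk_path (x : seq_space (word W)) :
  (forall n, exists2 m, (n <= m)%N & x m <> [::]) ->
  exists g, converges (walk_path [::] x) g.
Proof.
move=> xN.
have le_size n m : (n <= m)%N ->
    (size (walk_path [::] x n) <= size (walk_path [::] x m))%N.
  move=> nm; rewrite -(subnKC nm).
  have /prefixP[t ->] := prefix_walk_path [::] x n (m - n).
  by rewrite [leqRHS]size_cat leq_addr.
have long k : exists n, (k <= size (walk_path [::] x n))%N.
  elim: k => [|k [n kn]]; first by exists 0%N.
  have [m nm xm] := xN n; exists m.+1; rewrite walk_pathS [leqRHS]size_cat.
  rewrite -addn1 leq_add// ?(leq_trans kn)// ?le_size//.
  by rewrite lt0n size_eq0; apply/eqP.
have /choice[N NP] := long.
pose g i := nth point (walk_path [::] x (N i.+1)) i.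
exists g => k; exists (N k) => // n /= Nn; apply: prefix_mkseq.
  exact: leq_trans (NP k) (le_size _ _ Nn).
move=> i ik; rewrite /g.
have nthE a b : (a <= b)%N -> (i < size (walk_path [::] x a))%N ->
    nth point (walk_path [::] x b) i = nth point (walk_path [::] x a) i.
  move=> ab ia; rewrite -(subnKC ab).
  have /prefixP[t ->] := prefix_walk_path [::] x a (b - a).
  by rewrite nth_cat ia.
have iN := NP i.+1; have ikN := leq_trans ik (NP k).
by case: (leqP n (N i.+1)) => [nN|/ltnW nN]; [apply/esym|]; apply: nthE => //;
   exact: leq_trans ikN (le_size _ _ Nn).
Qed.

End limit_word.

HB.instance Definition _ (W : alphabet) :=
  isMeasurableFun.Build _ _ _ _ (@limit_word W) (@measurable_limit_word W).

Section almost_sure_convergence.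
Context {R : realType} {W : alphabet}.
Variables (mu : probability (word W) R) (M : probability (seq_space (word W)) R).
Hypothesis M_self_similar : self_similar mu M.
Local Open Scope ereal_scope.
Hypothesis mu_nil : mu [set [::]] < 1.

Let Z n : set (seq_space (word W)) := [set x | forall i, (n <= i)%N -> x i = [::]].

Let mZ n : measurable (Z n).
Proof.
rewrite (_ : Z n = \bigcap_(i in [set i | (n <= i)%N]) [set x | [set [::]] (x i)]).
  apply: bigcap_measurableType => i _.
  exact: (@measurable_coordinate (word W) i ([set [::]] : set (word W))).
by apply/seteqP; split.
Qed.

(** Peeling off the first increment multiplies this probability by [mu [set [::]]], which is less
    than 1. *)
Let Z0 : M (Z 0) = 0.
Proof.
have Zf : M (Z 0) \is a fin_num by exact: fin_num_measure.
have nf : mu [set [::]] \is a fin_num by exact: fin_num_measure.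
have ZE : M (Z 0) = mu [set [::]] * M (Z 0).
  rewrite {1}(M_self_similar (mZ 0)).
  rewrite (eq_integral (fun s : word W => (\1_[set [::]] s)%:E * M (Z 0))).
    by rewrite ge0_integralZr// integral_indic// setIT.
  move=> s _; rewrite indicE; have [->|/eqP s0] := eqVneq s [::].
    rewrite mem_set// mul1e; congr (M _); apply/seteqP; split => x h i _.
      exact: (h i.+1).
    by case: i => //= i; exact: h.
  rewrite memNset; last by move=> /= /s0.
  rewrite mul0e (_ : _ @^-1` _ = set0) ?measure0//.
  by apply/seteqP; split => // x h; exact: s0 (h 0%N isT).
move: ZE mu_nil; rewrite -(fineK Zf) -(fineK nf) -EFinM lte_fin => -[ZE n1].
congr EFin; apply/eqP; move/eqP: ZE; rewrite -subr_eq0 -[X in (X - _)%R]mul1r -mulrBl.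
by rewrite mulf_eq0 subr_eq0 => /orP[/eqP n1'|//]; rewrite -n1' ltxx in n1.
Qed.

Let Z_null n : M (Z n) = 0.
Proof.
elim: n => [//|n IHn]; rewrite (M_self_similar (mZ n.+1)).
apply: integral0_eq => s _; rewrite -[RHS]IHn; congr (M _).
apply/seteqP; split => x h i ni; first exact: (h i.+1).
by case: i ni => //= i; exact: h.
Qed.

(** Almost surely infinitely many increments are non-empty. The exceptional set depends only on the
    increments, so one null set serves all starting words [u]. *)
Lemma ae_converges :
  {ae M, forall x, forall u, limit_word (walk_path u x) =
     act u (limit_word (walk_path [::] x))}.
Proof.
have : M.-negligible (\bigcup_n Z n).
  by apply: negligible_bigcup => n; exists (Z n); split => //; exact: Z_null.
apply: negligibleS => x /= h; apply: contrapT => nZ; apply: h => u.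
have [g xg] : exists g, converges (walk_path [::] x) g.
  apply: converges_walk_path => n; apply: contrapT => nex; apply: nZ.
  exists n => // m nm; apply: contrapT => xm; apply: nex; by exists m.
by rewrite (limit_wordE xg); apply: limit_wordE; exact: converges_act.
Qed.

End almost_sure_convergence.

(** * Conditional probabilities and the hitting measure *)

Section conditional_probability.
Local Open Scope ereal_scope.

Lemma integral_mrestr d (T : measurableType d) (R : realType)
    (P : {measure set T -> \bar R}) (B : set T) (mB : measurable B) (f : T -> \bar R) :
  (forall x, 0 <= f x) -> measurable_fun setT f ->
  \int[mrestr P mB]_x f x = \int[P]_x ((\1_B x)%:E * f x).
Proof.
move=> f0 mf; have mBC := measurableC mB.
have N0 : mrestr P mB (~` B) = 0 by rewrite /mrestr setICl measure0.
rewrite (ge0_negligible_integral mBC measurableT mf (fun x _ => f0 x) N0).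
rewrite setTD setCK (@eq_measure_integral _ _ _ _ P); last first.
  by move=> A mA AB; rewrite /= /mrestr (setIidl AB).
rewrite integral_mkcond; apply: eq_integral => x _.
by rewrite epatch_indic/= muleC.
Qed.

(** The law of [X] restricted to [B] is below the law of [X], so its density can be chosen at most 1
    at every point; this density is the conditional probability of [B] given [X]. *)
Lemma conditional_probability d d' (T : measurableType d) (T' : measurableType d')
    (R : realType) (P : probability T R) (X : {mfun T >-> T'}) (B : set T) :
  measurable B ->
  exists F : T' -> R, [/\ measurable_fun setT F, forall x, (0 <= F x <= 1)%R &
    forall f : T' -> \bar R, (forall x, 0 <= f x) -> measurable_fun setT f ->
      \int[P]_x ((\1_B x)%:E * f (X x)) = \int[distribution P X]_y (f y * (F y)%:E)].
Proof.
move=> mB; have mfX : measurable_fun setT X := measurable_funP X.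
pose m1 : {measure set T' -> \bar R} :=
  @measure_function_pushforward__canonical__measure_function_Measure _ _ _ _ _ (mrestr P mB) X mfX.
have mX E : measurable E -> measurable (X @^-1` E).
  by move=> mE; rewrite -[X in measurable X]setTI; exact: (measurable_funP X).
have m1fin : fin_num_fun m1.
  move=> E mE; exact/fin_num_measure/mX.
pose m1F : {finite_measure set T' -> \bar R} :=
  HB.pack (m1 : set T' -> \bar R) m1 (Measure_isFinite.Build _ _ _ m1 m1fin).
have [|F [mF F1 FE]] := @bounded_density _ _ _ m1F (distribution P X) 1 ler01.
  move=> E mE; rewrite mul1e; apply: le_measure; rewrite ?inE//; last by exact: mX.
  by apply: measurableI => //; exact: mX.
exists F; split => // f f0 mf; rewrite -FE// -integral_mrestr//; last first.
  exact: (measurableT_comp mf (measurable_funP X)).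
by rewrite [RHS]ge0_integral_pushforward.
Qed.

End conditional_probability.

Section hitting_law.
Context {R : realType} {W : alphabet}.
Variables (mu : probability (word W) R) (M : probability (seq_space (word W)) R).
Hypothesis M_self_similar : self_similar mu M.
Hypothesis mu_nil : (mu [set [::]] < 1)%E.
Local Open Scope ereal_scope.

Definition path_law : probability (path_space W) R := distribution M (walk_path [::]).

Definition hitting_law : probability (infinite_word W) R :=
  distribution path_law (@limit_word W).

Lemma integral_path_law (Phi : path_space W -> \bar R) : (forall y, 0 <= Phi y) ->
  measurable_fun setT Phi -> \int[path_law]_y Phi y = path_mean M Phi [::].
Proof. by move=> Phi0 mPhi; rewrite ge0_integral_distribution. Qed.

Lemma integral_hitting_law (f : infinite_word W -> \bar R) : (forall y, 0 <= f y) ->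
  measurable_fun setT f -> \int[hitting_law]_x f x = path_mean M (f \o @limit_word W) [::].
Proof.
move=> f0 mf; rewrite ge0_integral_distribution// integral_path_law//; first by move=> y; exact: f0.
exact: (measurableT_comp mf (@measurable_limit_word W)).
Qed.

Lemma path_mean_limit (f : infinite_word W -> \bar R) u : (forall y, 0 <= f y) ->
  measurable_fun setT f ->
  path_mean M (f \o @limit_word W) u = \int[hitting_law]_x f (act u x).
Proof.
move=> f0 mf; have ml := @measurable_limit_word W.
have mfu : measurable_fun setT (f \o act u) := measurableT_comp mf (measurable_act u).
rewrite integral_hitting_law//; apply: ge0_ae_eq_integral => //; [| |by move=> x _; exact: f0..|].
- exact: (measurableT_comp mf (measurableT_comp ml (measurable_walk_path u))).
- exact: (measurableT_comp mfu (measurableT_comp ml (measurable_walk_path [::]))).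
have := ae_converges M_self_similar mu_nil; apply: filterS => x xu _.
by rewrite /= xu.
Qed.

Lemma path_mean_limit_harmonic (f : infinite_word W -> \bar R) : (forall y, 0 <= f y) ->
  measurable_fun setT f -> harmonic mu (fun u => \int[hitting_law]_x f (act u x)).
Proof.
move=> f0 mf u; rewrite -path_mean_limit// -(path_mean_harmonic M_self_similar)//.
- by apply: eq_integral => s _; rewrite path_mean_limit.
- by move=> y; exact: f0.
- exact: (measurableT_comp mf (@measurable_limit_word W)).
- by move=> y z yz /=; rewrite (limit_word_tail_equiv yz).
Qed.

End hitting_law.

Section superharmonic.
Context {R : realType} {W : alphabet}.
Variables (nu : probability (word W) R) (f : word W -> \bar R) (C : R).
Local Open Scope ereal_scope.
Hypothesis f_bounded : forall u, 0 <= f u <= C%:E.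
Hypothesis f_super : forall u, \int[nu]_s f (u ++ s) <= f u.

Let f0 u : 0 <= f u. Proof. by case/andP: (f_bounded u). Qed.

Let F n u := \int[convol_iter nu n]_z f (u ++ z).

Let F0 n u : 0 <= F n u. Proof. exact: integral_ge0. Qed.

Let F_nonincreasing u : {homo F ^~ u : n m / (n <= m)%N >-> m <= n}.
Proof.
apply/nonincreasing_seqP => n; rewrite /F integral_convol_iterSr//.
apply: ge0_le_integral => // s _; first exact: integral_ge0.
by under eq_integral do rewrite catA; exact: f_super.
Qed.

Let F_le n u : F n u <= C%:E.
Proof. by apply: le_integral_prob => s; exact: f_bounded. Qed.

Let k u := ereal_inf (range (F ^~ u)).

Let F_cvg u : F ^~ u @ \oo --> k u.
Proof. exact: ereal_nonincreasing_cvgn. Qed.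

(** The successive averages of a superharmonic function decrease, and dominated convergence makes
    their limit harmonic. *)
Lemma superharmonic_limit : exists k : word W -> \bar R,
  [/\ harmonic nu k, forall u, 0 <= k u <= f u &
    forall u, (fun n => \int[convol_iter nu n]_z f (u ++ z)) @ \oo --> k u].
Proof.
exists k; split => //.
  move=> u; have kF : [sequence F n.+1 u]_n @ \oo --> k u by rewrite (cvg_shiftS (F ^~ u)).
  apply: (cvg_unique _ _ kF); first exact: ereal_hausdorff.
  rewrite (_ : (fun n => F n.+1 u) = fun n => \int[nu]_s F n (u ++ s)).
    have [//|//||||_ _] := @dominated_convergence _ _ _ nu setT measurableT
        (fun n s => F n (u ++ s)) (fun s => k (u ++ s)) (cst C%:E).
    - by apply: aeW => s _; exact: F_cvg.
    - apply/integrableP; split => //.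
      apply: (@le_lt_trans _ _ `|C|%:E); last exact: ltry.
      by apply: le_integral_prob => s; rewrite /= lexx lee_fin normr_ge0.
    - by apply: aeW => s n _; rewrite gee0_abs.
    by apply.
  apply/funext => n; rewrite /F integral_convol_iterS//.
  by apply: eq_integral => s _; under eq_integral do rewrite catA.
move=> u; apply/andP; split.
  by apply: le_ereal_inf_tmp => _ [n _ <-].
apply: (@le_trans _ _ (F 0 u)); first by apply: ereal_inf_lbound; exists 0%N.
by rewrite /F integral_convol_iter0 cats0 lexx.
Qed.

End superharmonic.

(** * Tail events are determined by the limit word *)

Section tail_events.
Context {R : realType} {W : alphabet}.
Variables (mu : probability (word W) R) (M : probability (seq_space (word W)) R).
Hypothesis M_self_similar : self_similar mu M.
Local Open Scope ereal_scope.
Hypothesis mu_nil : mu [set [::]] < 1.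
Variables (nu : probability (word W) R) (w : word W).
Hypothesis nu_harmonic : forall (C : R) h, (forall g, 0 <= h g <= C%:E) ->
  harmonic nu h <-> harmonic mu h.
Hypothesis w0 : w <> [::].
Hypothesis nu_end : forall g, nu [set g] != 0 -> exists u, g = u ++ w.
Hypothesis nu_gt0 : forall g, 0 < nu [set g ++ w].
Hypothesis moment : \int[nu]_g (log_wnorm w g)%:E < +oo.

Local Notation lam := (hitting_law M).
Local Notation hit := (hit M).

Lemma hitting_law_stationary : stationary nu lam.
Proof.
move=> E mE; pose k u := \int[lam]_x (\1_E (act u x))%:E.
have mI : measurable_fun setT (fun x => (\1_E x)%:E : \bar R).
  exact/measurable_EFinP/measurable_indic.
have kE u : k u = lam (act u @^-1` E).
  have maE : measurable (act u @^-1` E).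
    by rewrite -[X in measurable X]setTI; exact: measurable_act.
  have := integral_indic lam measurableT maE; rewrite setIT; exact.
have k01 u : 0 <= k u <= 1%:E.
  rewrite kE measure_ge0 probability_le1//.
  by rewrite -[X in measurable X]setTI; exact: measurable_act.
have hk : harmonic mu k.
  apply: (path_mean_limit_harmonic M_self_similar mu_nil (f := fun x => (\1_E x)%:E)) => //.
have := (nu_harmonic k01).2 hk [::].
rewrite [in RHS]kE (_ : act [::] @^-1` E = E).
  by move=> <-; apply: eq_integral => s _; exact: kE.
by apply/seteqP; split => x /=; rewrite act_nil.
Qed.

Let st := hitting_law_stationary.

Let nu_hit B : tail_measurable B -> harmonic nu (hit B).
Proof.
move=> tB; have [mB _] := tB; have h01 u : 0 <= hit B u <= 1%:E.
  by rewrite hit_ge0 hit_le1.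
exact: (nu_harmonic h01).2 (hit_harmonic M_self_similar tB).
Qed.

Let min_hit B u := mine (hit B u) (hit (~` B) u).

(** A minimum of harmonic functions is superharmonic. The limit of its averages along [nu] is
    harmonic for [mu] too and lies below both hitting probabilities, so the 0-1 law of the original
    walk kills it at the empty word. *)
Lemma min_hit_vanishes B : tail_measurable B ->
  (fun n => \int[convol_iter nu n]_z min_hit B z) @ \oo --> 0.
Proof.
move=> tB; have [mB _] := tB; have tBC := tail_measurableC tB.
have f01 u : 0 <= min_hit B u <= 1%:E.
  by rewrite le_min !hit_ge0/= ge_min hit_le1.
have f0 u : 0 <= min_hit B u by case/andP: (f01 u).
have fs u : \int[nu]_s min_hit B (u ++ s) <= min_hit B u.
  rewrite le_min; apply/andP; split.
    rewrite -[leRHS](nu_hit tB u); apply: ge0_le_integral => // s _.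
    by rewrite ge_min lexx.
  rewrite -[leRHS](nu_hit tBC u); apply: ge0_le_integral => // s _.
  by rewrite ge_min lexx orbT.
have [k [hk kf kl]] := superharmonic_limit f01 fs.
have k01 u : 0 <= k u <= 1%:E.
  have /andP[-> ku]/= := kf u; apply: le_trans ku _; by case/andP: (f01 u).
suff k0 : k [::] = 0 by have := kl [::]; rewrite k0.
apply: (harmonic_below_hit_eq0 M_self_similar tB).
- by move=> u; case/andP: (kf u).
- exact: (nu_harmonic k01).1 hk.
- by move=> u; have /andP[_] := kf u; rewrite le_min => /andP[].
- by move=> u; have /andP[_] := kf u; rewrite le_min => /andP[].
Qed.

(** Its mean [J] from the empty word is what the probability of [B] after a first increment [g]
    would be if the increment and [B] were conditionally independent given the limit word. *)
Let weighted B g (y : path_space W) : \bar R :=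
  (\1_B y)%:E * (dens st g (limit_word y))%:E.

Let weighted_ge0 B g y : 0 <= weighted B g y.
Proof. by rewrite mule_ge0// lee_fin dens_ge0. Qed.

Let measurable_dens_limit g :
  measurable_fun setT (fun y => (dens st g (limit_word y))%:E : \bar R).
Proof.
apply/measurable_EFinP.
exact: (measurableT_comp (measurable_dens st g) (@measurable_limit_word W)).
Qed.

Let measurable_weighted B g : measurable B -> measurable_fun setT (weighted B g).
Proof.
move=> mB; apply: emeasurable_funM; last exact: measurable_dens_limit.
exact/measurable_EFinP/measurable_indic.
Qed.

Let dens_le g x : 0 < nu [set g] -> (dens st g x <= (mass nu 1 g)^-1)%R.
Proof.
move=> g0; have m0 := mass1_gt0 g0.
by rewrite -[leRHS]mul1r ler_pdivlMr// mulrC mass_dens_le1.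
Qed.

Let path_mean_weighted_le B g u : measurable B -> 0 < nu [set g] ->
  path_mean M (weighted B g) u <= ((mass nu 1 g)^-1)%:E * hit B u.
Proof.
move=> mB g0; have m0 := mass1_gt0 g0; have mI : measurable_fun setT (\1_B : path_space W -> R) := measurable_indic mB.
have mIu : measurable_fun setT (fun x => (\1_B (walk_path u x))%:E : \bar R).
  by apply/measurable_EFinP; exact: (measurableT_comp mI (measurable_walk_path u)).
rewrite hitE// /path_mean -ge0_integralZl_EFin//; last by rewrite invr_ge0 ltW.
apply: ge0_le_integral => //.
- exact: measurableT_comp (measurable_weighted g mB) (measurable_walk_path u).
- by apply: emeasurable_funM.
move=> x _; rewrite /weighted muleC; apply: lee_wpmul2r; first by rewrite lee_fin.
by rewrite lee_fin dens_le.
Qed.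

Let mean_dens_weighted B g u : measurable B ->
  mean_dens st g u = path_mean M (weighted B g) u + path_mean M (weighted (~` B) g) u.
Proof.
move=> mB; have mBC := measurableC mB.
have mw := measurable_walk_path u.
rewrite /path_mean -ge0_integralD//; last 2 first.
- exact: measurableT_comp (measurable_weighted g mB) mw.
- exact: measurableT_comp (measurable_weighted g mBC) mw.
have f0 x : 0 <= (dens st g x)%:E by rewrite lee_fin dens_ge0.
have mf : measurable_fun setT (fun x => (dens st g x)%:E : \bar R).
  by apply/measurable_EFinP; exact: measurable_dens.
rewrite /mean_dens -(path_mean_limit M_self_similar mu_nil u f0 mf).
apply: eq_integral => x _; rewrite /weighted !indicE in_setC.
by case: (_ \in B); rewrite !(mul0e, mul1e) ?adde0 ?add0e.
Qed.

(** For [a <= b] this follows from [m <= c], and otherwise from [a * p <= p] and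
    [a * q <= q <= c * b]. *)
Let mixed_bound (a b p q m c : R) : (0 <= a -> 0 <= b -> a + b = 1 -> 0 <= p ->
  0 <= q -> p <= c * a -> q <= c * b -> m = p + q -> a * m <= p + c * Num.min a b)%R.
Proof.
move=> a0 b0 ab p0 q0 pc qc mE.
have [le_ab|lt_ba] := leP a b; last by nra.
have mc : (m <= c)%R by rewrite mE -[leRHS]mulr1 -ab mulrDr lerD.
by apply: ler_wpDl => //; rewrite mulrC ler_wpM2r.
Qed.

Let J B g := path_mean M (weighted B g) [::].

Let hit_fin B u : measurable B -> hit B u \is a fin_num.
Proof.
by move=> mB; apply: fin_num_measure; exact: measurable_walk_path_preimage.
Qed.

Let weighted_fin B g u : measurable B -> 0 < nu [set g] ->
  path_mean M (weighted B g) u \is a fin_num.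
Proof.
move=> mB g0; rewrite ge0_fin_numE; last exact: integral_ge0.
apply: le_lt_trans (path_mean_weighted_le u mB g0) _.
by rewrite -(fineK (hit_fin u mB)) -EFinM ltry.
Qed.

Let weighted_harmonic B g : tail_measurable B -> 0 < nu [set g] ->
  harmonic nu (path_mean M (weighted B g)).
Proof.
move=> [mB Binv] g0.
have b u : 0 <= path_mean M (weighted B g) u <= ((mass nu 1 g)^-1)%:E.
  rewrite integral_ge0//=; apply: le_trans (path_mean_weighted_le u mB g0) _.
  rewrite -[leRHS]mule1; apply: lee_wpmul2l; last exact: hit_le1.
  by rewrite lee_fin invr_ge0 mass_ge0.
apply: (nu_harmonic b).2; apply: (path_mean_harmonic M_self_similar) => //.
  exact: measurable_weighted.
move=> y z yz; rewrite /weighted (limit_word_tail_equiv yz) !indicE.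
congr (_%:R%:E * _); congr nat_of_bool; apply/idP/idP => /set_mem h; apply/mem_set.
  exact: Binv h.
by apply: Binv h; exact: tail_equiv_sym.
Qed.

(** The entropy argument is applied to the harmonic function [hit B]. Far along the walk [hit B] is
    mostly close to 0 or 1, so its product with [mean_dens] is nearly the mean of [weighted B g],
    which is harmonic and keeps the average [J B g] at all times. *)
Lemma hit_le_weighted B g : tail_measurable B -> 0 < nu [set g] -> hit B g <= J B g.
Proof.
move=> tB g0; have [mB _] := tB; have mBC := measurableC mB.
pose c := ((mass nu 1 g)^-1)%R.
have c0 : (0 < c)%R by rewrite invr_gt0 mass1_gt0.
have h01 u : (0 <= fine (hit B u) <= 1)%R.
  by rewrite -!lee_fin fineK ?hit_fin// hit_ge0 hit_le1.
have hh : harmonic nu (EFin \o (fun u => fine (hit B u))).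
  move=> u; rewrite /= fineK ?hit_fin// -[RHS](nu_hit tB u).
  by apply: eq_integral => s _; rewrite fineK ?hit_fin.
have f0 u : 0 <= min_hit B u by rewrite le_min !hit_ge0.
have w_ge0 u : 0 <= path_mean M (weighted B g) u by exact: integral_ge0.
have pointwise u : (fine (hit B u))%:E * mean_dens st g u <=
    path_mean M (weighted B g) u + c%:E * min_hit B u.
  rewrite (mean_dens_weighted g u mB) /min_hit.
  have := hit_setC M u mB; have := hit_ge0 M B u; have := hit_ge0 M (~` B) u.
  have := path_mean_weighted_le u mB g0; have := path_mean_weighted_le u mBC g0.
  have : 0 <= path_mean M (weighted (~` B) g) u by exact: integral_ge0.
  have := w_ge0 u.
  case: (hit B u) (hit_fin u mB) => // a _; case: (hit (~` B) u) (hit_fin u mBC) => // b _.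
  case: (path_mean M (weighted B g) u) (weighted_fin u mB g0) => // p _.
  case: (path_mean M (weighted (~` B) g) u) (weighted_fin u mBC g0) => // q _.
  rewrite -EFin_min -EFinD -!EFinM -!EFinD !lee_fin.
  move=> p0 q0 qc pc b0 a0 [ab]; exact: mixed_bound p0 q0 pc qc erefl.
apply/lee_addgt0Pr => e e0; pose e2 := (e / 2)%R.
have e20 : (0 < e2)%R by rewrite divr_gt0.
have near0 : nbhs (0 : \bar R) [set x | x < (e2 / c)%:E].
  by apply: open_ereal_lt'; rewrite lte_fin divr_gt0.
have [n0 _ hn0] := min_hit_vanishes tB near0.
have [n n0n le_h] := limit_inequality st w0 moment nu_end n0 g0 h01 hh e20.
rewrite fineK ?hit_fin// in le_h; apply: (le_trans le_h).
have -> : e%:E = e2%:E + e2%:E by rewrite -EFinD -splitr.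
rewrite addeA leeD2r//; apply: (@le_trans _ _ (\int[convol_iter nu n]_u
    (path_mean M (weighted B g) u + c%:E * min_hit B u))).
  apply: ge0_le_integral => // u _.
  by rewrite mule_ge0// ?mean_dens_ge0// lee_fin; case/andP: (h01 u).
rewrite ge0_integralD//; last by move=> u _; rewrite mule_ge0// lee_fin ltW.
rewrite (_ : \int[_]_x path_mean _ _ _ = J B g); last first.
  exact: (harmonic_convol_iter n w_ge0 (weighted_harmonic tB g0) [::]).
apply: leeD2l; rewrite ge0_integralZl_EFin//; last exact: ltW.
have -> : e2%:E = c%:E * (e2 / c)%:E by rewrite -EFinM mulrC divfK ?gt_eqF.
by apply: lee_wpmul2l; [rewrite lee_fin ltW|exact/ltW/hn0].
Qed.

Lemma weighted_setC B g : measurable B -> 0 < nu [set g] -> J B g + J (~` B) g = 1.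
Proof.
move=> mB g0; rewrite /J -mean_dens_weighted//.
rewrite -[RHS](integral_dens1 st (z := g)); last by exists 1%N; exact: mass1_gt0.
by apply: eq_integral => x _; rewrite act_nil.
Qed.

(** The inequality holds for [B] and for its complement, and on each side the two values add up to
    1. *)
Lemma hit_weighted B g : tail_measurable B -> 0 < nu [set g] -> hit B g = J B g.
Proof.
move=> tB g0; have [mB _] := tB; have tBC := tail_measurableC tB; have [mBC _] := tBC.
have := hit_setC M g mB; have := weighted_setC mB g0.
have := hit_le_weighted tB g0; have := hit_le_weighted tBC g0; rewrite /J.
case: (hit B g) (hit_fin g mB) => // a _; case: (hit (~` B) g) (hit_fin g mBC) => // b _.
case: (path_mean M (weighted B g) _) (weighted_fin [::] mB g0) => // p _.
case: (path_mean M (weighted (~` B) g) _) (weighted_fin [::] mBC g0) => // q _.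
rewrite -!EFinD !lee_fin => h1 h2 [h3] [h4]; congr EFin; lra.
Qed.

Lemma hit_boundary B : tail_measurable B ->
  exists F : infinite_word W -> R, [/\ measurable_fun setT F,
    forall x, (0 <= F x <= 1)%R,
    forall f : infinite_word W -> \bar R, (forall x, 0 <= f x) -> measurable_fun setT f ->
      \int[path_law M]_y ((\1_B y)%:E * f (limit_word y)) = \int[lam]_x (f x * (F x)%:E) &
    forall u, \int[lam]_x (F (act u x))%:E = hit B u].
Proof.
move=> tB; have [mB _] := tB.
have [F [mF F01 FE]] := conditional_probability (path_law M) (@limit_word W) mB.
have F0 x : 0 <= (F x)%:E by rewrite lee_fin; case/andP: (F01 x).
have mF' : measurable_fun setT (fun x => (F x)%:E : \bar R) by apply/measurable_EFinP.
exists F; split => //.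
have supp g : 0 < nu [set g] -> \int[lam]_x (F (act g x))%:E = hit B g.
  move=> g0; rewrite hit_weighted// /J.
  have cg : charged nu g by exists 1%N; exact: mass1_gt0.
  rewrite (integral_dens st cg (f := fun x => (F x)%:E))//.
  under eq_integral do rewrite muleC.
  rewrite -(FE (fun x => (dens st g x)%:E)).
  - exact: (integral_path_law M (weighted_ge0 B g) (measurable_weighted g mB)).
  - by move=> x; rewrite lee_fin dens_ge0.
  - by apply/measurable_EFinP; exact: measurable_dens.
have k01 u : 0 <= \int[lam]_x (F (act u x))%:E <= 1%:E.
  apply/andP; split; first by apply: integral_ge0 => x _.
  rewrite -[leRHS](probability_integral_cst lam 1); apply: ge0_le_integral => //.
  - exact: (measurableT_comp mF' (measurable_act u)).
  - by move=> x _; rewrite lee_fin; case/andP: (F01 (act u x)).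
have hk := path_mean_limit_harmonic M_self_similar mu_nil F0 mF'.
have {}hk := (nu_harmonic k01).2 hk.
(* So far the identity is known at words charged by [nu]. Both sides are harmonic for [nu], and
   after one more step the word ends with [w], hence is charged. *)
move=> u; rewrite -[LHS]hk -[RHS](nu_hit tB u); apply: eq_integral_word.
- by move=> s; case/andP: (k01 (u ++ s)).
- by move=> s; exact: hit_ge0.
- by move=> s /nu_end[v ->]; apply: supp; rewrite catA.
Qed.

End tail_events.

Section tail_events_limit.
Context {R : realType} {W : alphabet}.
Variables (mu : probability (word W) R) (M : probability (seq_space (word W)) R).
Hypothesis M_self_similar : self_similar mu M.
Local Open Scope ereal_scope.
Hypothesis mu_nil : mu [set [::]] < 1.
Variables (nu : probability (word W) R) (w : word W).
Hypothesis nu_harmonic : forall (C : R) h, (forall g, 0 <= h g <= C%:E) ->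
  harmonic nu h <-> harmonic mu h.
Hypothesis w0 : w <> [::].
Hypothesis nu_end : forall g, nu [set g] != 0 -> exists u, g = u ++ w.
Hypothesis nu_gt0 : forall g, 0 < nu [set g ++ w].
Hypothesis moment : \int[nu]_g (log_wnorm w g)%:E < +oo.

Local Notation lam := (hitting_law M).

Lemma path_law_setD B (E : set (infinite_word W)) (F : infinite_word W -> R) :
  measurable B -> measurable E ->
  (forall f : infinite_word W -> \bar R, (forall x, 0 <= f x) -> measurable_fun setT f ->
    \int[path_law M]_y ((\1_B y)%:E * f (limit_word y)) = \int[lam]_x (f x * (F x)%:E)) ->
  path_law M (B `\` limit_word @^-1` E) = \int[lam]_x ((\1_(~` E) x)%:E * (F x)%:E).
Proof.
move=> mB mE FE; have mEC := measurableC mE.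
rewrite -(FE (fun x => (\1_(~` E) x)%:E)); last 2 first.
- by move=> x; rewrite lee_fin.
- exact/measurable_EFinP/measurable_indic.
have mD : measurable (B `\` limit_word @^-1` E).
  by apply: measurableD => //; rewrite -[X in measurable X]setTI; exact: measurable_limit_word.
have := integral_indic (path_law M) measurableT mD; rewrite setIT => <-.
apply: eq_integral => y _; rewrite -EFinM !indicE in_setD !in_setC -mulnb natrM.
by congr (_ * _)%R%:E.
Qed.

Lemma tail_event_limit_word B : tail_measurable B ->
  exists2 E : set (infinite_word W), measurable E &
    path_law M (B `+` limit_word @^-1` E) = 0.
Proof.
move=> tB; have [mB _] := tB; have tBC := tail_measurableC tB; have [mBC _] := tBC.
have [F [mF F01 FE Fhit]] := hit_boundary M_self_similar mu_nil nu_harmonic w0 nu_end nu_gt0 moment tB.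
have [G [mG G01 GE Ghit]] := hit_boundary M_self_similar mu_nil nu_harmonic w0 nu_end nu_gt0 moment tBC.
(* Here [G] stands for [1 - F]. Obtained from the complementary event, it has its own hitting
   identity, which gives the second upper bound directly. *)
pose FG x := (F x * G x)%:E.
have FG0 x : 0 <= FG x.
  by rewrite lee_fin mulr_ge0//; [case/andP: (F01 x)|case/andP: (G01 x)].
have mFG : measurable_fun setT FG.
  by apply/measurable_EFinP; exact: measurable_funM.
have mFe : measurable_fun setT (EFin \o F) by apply/measurable_EFinP.
have mGe : measurable_fun setT (EFin \o G) by apply/measurable_EFinP.
have k0 : \int[lam]_x FG (act [::] x) = 0.
  apply: (harmonic_below_hit_eq0 M_self_similar tB (k := fun u => \int[lam]_x FG (act u x))).
  - by move=> u; exact: integral_ge0.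
  - exact: path_mean_limit_harmonic.
  - move=> u; rewrite -Fhit; apply: ge0_le_integral => //.
    + exact: (measurableT_comp mFG (measurable_act u)).
    + exact: (measurableT_comp mFe (measurable_act u)).
    + move=> x _; rewrite lee_fin ler_piMr//; first by case/andP: (F01 (act u x)).
      by case/andP: (G01 (act u x)).
  - move=> u; rewrite -Ghit; apply: ge0_le_integral => //.
    + exact: (measurableT_comp mFG (measurable_act u)).
    + exact: (measurableT_comp mGe (measurable_act u)).
    + move=> x _; rewrite lee_fin ler_piMl//; first by case/andP: (G01 (act u x)).
      by case/andP: (F01 (act u x)).
pose E := [set x | F x != 0%R].
have mE : measurable E.
  rewrite (_ : E = ~` (F @^-1` [set 0%R])).
    by apply: measurableC; rewrite -[X in measurable X]setTI; exact: mF.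
  by apply/seteqP; split => x /=; [move/eqP|move=> ?; apply/eqP].
have mlE : measurable (limit_word @^-1` E).
  by rewrite -[X in measurable X]setTI; exact: measurable_limit_word.
have nBE : path_law M (B `\` limit_word @^-1` E) = 0.
  rewrite (path_law_setD mB mE FE); apply: integral0_eq => x _.
  rewrite indicE; case: (boolP (x \in ~` E)) => [/set_mem /= /negP/negPn/eqP ->|_].
    by rewrite mule0.
  by rewrite mul0e.
(* The product of [F] and [G] vanishes almost everywhere and [F] does not vanish on [E], so the
   complement of [B] has conditional probability zero there. *)
have nEB : path_law M (limit_word @^-1` E `\` B) = 0.
  rewrite setDE setIC (_ : limit_word @^-1` E = ~` (limit_word @^-1` (~` E))); last first.
    by rewrite preimage_setC setCK.
  rewrite -setDE (path_law_setD mBC (measurableC mE) GE) setCK.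
  rewrite -[RHS](integral0 lam setT); apply: ge0_ae_eq_integral => //.
  - by apply: emeasurable_funM => //; exact/measurable_EFinP/measurable_indic.
  - by move=> x _; rewrite mule_ge0 ?lee_fin//; case/andP: (G01 x).
  have : ae_eq lam setT FG (cst 0).
    apply/(ae_eq_integral_abs lam measurableT mFG).
    by rewrite -[RHS]k0; apply: eq_integral => x _; rewrite gee0_abs// act_nil.
  apply: filterS => x /(_ I) /= [/eqP]; rewrite mulf_eq0 => FGx _.
  rewrite indicE; case: (boolP (x \in E)) => [/set_mem /=/negPf Fx|_]; last by rewrite mul0e.
  by move: FGx; rewrite Fx /= => /eqP ->; rewrite mule0.
exists E => //.
exact: etrans (measureU0 (measurableD mB mlE) (measurableD mlE mB) nEB) nBE.
Qed.

End tail_events_limit.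

(** * Standard realizations of the boundary *)

Section almost_everywhere.
Context d (X : measurableType d) (R : realType) (P : {measure set X -> \bar R}).

Lemma ae_countable (I : countType) (Q : I -> X -> Prop) :
  (forall i, {ae P, forall x, Q i x}) -> {ae P, forall x, forall i, Q i x}.
Proof.
move=> aeQ.
pose Q' n x := if choice.unpickle n is Some i then Q i x else True.
have : {ae P, forall x, forall n, Q' n x}.
  apply: ae_foralln => n; rewrite /Q'; case: choice.unpickle => [i|]; first exact: aeQ.
  exact: aeW.
by apply: filterS => x Qx i; have := Qx (choice.pickle i); rewrite /Q' choice.pickleK.
Qed.

Lemma ae_setY (A B : set X) : measurable A -> measurable B -> P (A `+` B) = 0%E ->
  {ae P, forall x, A x <-> B x}.
Proof.
move=> mA mB AB0; exists (A `+` B); split => //.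
  by apply: measurableU; exact: measurableD.
move=> x /= nAB; have [Ax|nAx] := pselect (A x); have [Bx|nBx] := pselect (B x).
- by exfalso; apply: nAB.
- by left.
- by right.
- by exfalso; apply: nAB.
Qed.

Lemma ae_measure_eq0 (A : set X) : measurable A -> {ae P, forall x, ~ A x} -> P A = 0%E.
Proof.
move=> mA [N [mN N0 AN]]; apply: (subset_measure0 mA mN) N0 => x Ax.
by apply: AN => /=; apply.
Qed.

Lemma ae_measure_eq (A B : set X) : measurable A -> measurable B ->
  {ae P, forall x, A x <-> B x} -> P A = P B.
Proof.
move=> mA mB AB; rewrite -[A]setIT -[B]setIT -!integral_indic//.
apply: ge0_ae_eq_integral => //.
- exact/measurable_EFinP/measurable_indic.
- exact/measurable_EFinP/measurable_indic.
by move: AB; apply: filterS => x AB _; rewrite !indicE; congr (_%:R%:E);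
  congr nat_of_bool; apply/idP/idP => /set_mem /AB h; apply/mem_set.
Qed.

End almost_everywhere.

Section factor_isomorphism.
Context d0 (X : measurableType d0) d (G : measurableType d) (R : realType) (W : alphabet).
Variables (P : probability X R) (bnd : X -> G) (lim : X -> infinite_word W).
Variable L : G -> infinite_word W.
Hypotheses (mbnd : measurable_fun setT bnd) (mlim : measurable_fun setT lim).
Hypothesis mL : measurable_fun setT L.
Hypothesis L_bnd : {ae P, forall x, L (bnd x) = lim x}.
Hypothesis lim_generates : forall C, measurable C ->
  exists2 E, measurable E & P (bnd @^-1` C `+` lim @^-1` E) = 0%E.

Let preimage_measurable d1 d2 (T1 : measurableType d1) (T2 : measurableType d2)
  (f : T1 -> T2) C : measurable_fun setT f -> measurable C -> measurable (f @^-1` C).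
Proof. by move=> mf mC; rewrite -[X in measurable X]setTI; exact: mf. Qed.

Let q n : R := ratr (odflt 0 (choice.unpickle n)).

Let q_dense (x y : R) : x < y -> exists n, x < q n < y.
Proof.
move=> /rat_in_itvoo[r]; rewrite in_itv/= => xry.
by exists (choice.pickle r); rewrite /q choice.pickleK.
Qed.

(* The inverse of [L] is recovered, through the embedding [phi] of [G] in the
   reals, as the infimum of the rationals [q] such that [phi (bnd x) < q]. *)
Lemma factor_isomorphism : standard_borel R G ->
  isomorphism_mod0 (pushforward P bnd) (pushforward P lim) L.
Proof.
move=> [phi [phi_inj mphi phi_image]]; split.
  move=> C mC; apply: (@ae_measure_eq _ _ _ P).
  - exact: preimage_measurable mbnd (preimage_measurable mL mC).
  - exact: preimage_measurable mlim mC.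
  - by move: L_bnd; apply: filterS => x /= ->.
have mlt n : measurable [set g | phi g < q n].
  rewrite (_ : mkset _ = phi @^-1` `]-oo, q n[%classic); last first.
    by apply/seteqP; split => g; rewrite /= in_itv.
  exact: preimage_measurable mphi (measurable_itv _).
have /choice[E ES] : forall n, exists E : set (infinite_word W), measurable E /\
    P (bnd @^-1` [set g | phi g < q n] `+` lim @^-1` E) = 0%E.
  by move=> n; have [E mE E0] := lim_generates (mlt n); exists E.
have mE n : measurable (E n) by case: (ES n).
(* On this set of full measure [L g] decides the position of [phi g] among the rationals, so [L] is
   injective there. *)
pose A : set G := [set g | forall n, phi g < q n <-> E n (L g)].
have mA : measurable A.
  have mLE n : measurable (L @^-1` E n) by exact: preimage_measurable mL (mE n).
  rewrite (_ : A = \bigcap_n (([set g | phi g < q n] `&` L @^-1` E n) `|`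
      (~` [set g | phi g < q n] `&` ~` (L @^-1` E n)))).
    apply: bigcapT_measurable => n; apply: measurableU; apply: measurableI => //.
      exact: measurableC.
    exact: measurableC.
  apply/seteqP; split => [g Ag n _|g Ag n].
    have [lt|nlt] := pselect (phi g < q n); [left|right]; split => //.
      exact/Ag.
    by move=> /Ag.
  by have [[]|[]] := Ag n I.
have aeA : {ae P, forall x, A (bnd x)}.
  apply: filterS2 L_bnd _; last first.
    apply: ae_foralln => n; apply: ae_setY (ES n).2.
      exact: preimage_measurable mbnd (mlt n).
    exact: preimage_measurable mlim (mE n).
  by move=> x Lx /= Ax n; rewrite Lx; exact: Ax.
pose u n w : \bar R := if w \in E n then (q n)%:E else +oo%E.
have mu n : measurable_fun setT (u n).
  move=> _ Y mY; rewrite setTI (_ : _ @^-1` _ = (E n `&` [set _ | Y (q n)%:E]) `|`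
      (~` E n `&` [set _ | Y +oo%E])).
    have mcst (Q : Prop) : measurable [set _ : infinite_word W | Q].
      have [Qt|nQ] := pselect Q.
        by rewrite (_ : mkset _ = setT)//; apply/seteqP; split.
      by rewrite (_ : mkset _ = set0)//; apply/seteqP; split.
    by apply: measurableU; apply: measurableI => //; exact: measurableC.
  apply/seteqP; split => w; rewrite /u /=; case: (boolP (w \in E n)) => wE.
  - by left; split => //; exact/set_mem.
  - by right; split => //; move/mem_set; exact/negP.
  - by move=> [[]//|[nE _]]; exfalso; apply: nE; exact/set_mem.
  - by move=> [[/mem_set Ew _]|[]//]; rewrite Ew in wE.
pose inv w : R := fine (einfs (u ^~ w) 0).
have minv : measurable_fun setT inv.
  apply: measurableT_comp; first exact: fine_measurable.
  exact: measurable_fun_einfs.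
have invL g : A g -> inv (L g) = phi g.
  move=> Ag; rewrite /inv (_ : einfs _ _ = (phi g)%:E)//.
  apply/eqP; rewrite eq_le; apply/andP; split.
    apply/lee_addgt0Pr => e e0.
    have [|n /andP[gn ne]] := @q_dense (phi g) (phi g + e); first by rewrite ltrDl.
    apply: (@le_trans _ _ (u n (L g))); first by apply: ereal_inf_lbound; exists n.
    by rewrite /u mem_set ?lee_fin ?ltW//; exact/Ag.
  apply: le_ereal_inf_tmp => _ [n _ <-]; rewrite /u; case: ifPn; last by rewrite leey.
  by move=> /set_mem/Ag gn; rewrite lee_fin ltW.
have L_inj g h : A g -> A h -> L g = L h -> g = h.
  by move=> Ag Ah gh; apply: phi_inj; rewrite -!invL// gh.
(* This expresses the image by countably many measurable conditions. The points found for different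
   [k] have the same image [inv w] under the injective [phi], so they coincide, and together they
   determine all letters of [w]. *)
have image C : C `<=` A -> L @` C = \bigcap_k \bigcup_a
    ([set w | w k = a] `&` inv @^-1` (phi @` (C `&` [set g | L g k = a]))).
  move=> CA; apply/seteqP; split => [_ [g Cg <-] k _|w hw].
    by exists (L g k) => //; split => //; exists g => //; rewrite invL//; exact: CA.
  have [a _ [_ [g [Cg _] phig]]] := hw 0%N I.
  exists g => //; apply/funext => k; have [b _ [<- [h [Ch <-] phih]]] := hw k I.
  by congr (L _ k); apply: phi_inj; rewrite phig phih.
have mimage C : measurable C -> C `<=` A -> measurable (L @` C).
  move=> mC /image ->; apply: bigcapT_measurable => k.
  apply: countable_bigcupT_measurable => [|a]; first exact: countableP.
  apply: measurableI; first exact: (@measurable_coordinate W k [set a]).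
  apply: (preimage_measurable minv); apply: phi_image; apply: measurableI => //.
  exact: (preimage_measurable mL (@measurable_coordinate W k [set a])).
have mLA : measurable (L @` A) by exact: mimage.
exists A, (L @` A); split => //.
- split => //; apply: (@ae_measure_eq0 _ _ _ P).
    exact: preimage_measurable mbnd (measurableC mA).
  by move: aeA; apply: filterS => x Ax /=.
- split => //; apply: (@ae_measure_eq0 _ _ _ P).
    exact: preimage_measurable mlim (measurableC mLA).
  by apply: filterS2 L_bnd aeA => x Lx Ax /=; apply; exists (bnd x).
- split => //; first by move=> g h /set_mem Ag /set_mem Ah; exact: L_inj.
- exact: (measurable_funS measurableT _ mL).
Qed.

End factor_isomorphism.

Section tail_events_generating.
Context {R : realType} {W : alphabet}.
Local Open Scope ereal_scope.

Lemma integral_log_wnorm_square (mu : probability (word W) R) (w : word W) :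
  w <> [::] -> log_moment mu w < +oo ->
  \int[mu]_g (log_wnorm (w ++ w) g)%:E < +oo.
Proof.
move=> w0 fin.
have lw0 g : (0 <= ln (wnorm w g)%:R :> R)%R by rewrite ln_ge0// ler1n wnorm_gt0.
have momentE : log_moment mu w = \int[mu]_g (ln (wnorm w g)%:R)%:E.
  by rewrite integral_word// => g; rewrite lee_fin.
(* The constant 4 combines the factor 2 in [log_wnorm] with the factor 2 in [wnorm_double]. *)
have l4 : (0 <= ln 4 :> R)%R by rewrite ln_ge0// ler1n.
apply: (@le_lt_trans _ _ (\int[mu]_g ((ln 4)%:E + (ln (wnorm w g)%:R)%:E))).
  apply: ge0_le_integral => //.
    by move=> g _; rewrite lee_fin log_wnorm_ge0//; case: w w0 {fin lw0 momentE}.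
  move=> g _; rewrite -EFinD lee_fin -lnM ?posrE ?ltr0n ?wnorm_gt0//.
  rewrite /log_wnorm ler_ln ?posrE -?natrM ?ltr0n ?muln_gt0 ?wnorm_gt0//; last first.
    by case: w w0 {fin lw0 momentE}.
  by rewrite ler_nat -[4%N]/(2 * 2)%N -mulnA leq_mul2l wnorm_double.
rewrite (probability_integralDl mu) ?lee_fin//.
rewrite -momentE; exact: lte_add_pinfty (ltry _) fin.
Qed.

Lemma generating_nil (mu : probability (word W) R) : generating mu -> mu [set [::]] < 1.
Proof.
move=> gen; have a0 := generating_letter (point : W) gen.
apply: (@le_lt_trans _ _ (mu (~` [set [:: point : W]]))).
  by apply: le_measure; rewrite ?inE// => g /= ->.
have ef : mu [set [:: point : W]] \is a fin_num by exact: fin_num_measure.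
rewrite probability_setC// -(fineK ef) -EFinB lte_fin gtrBl -lte_fin fineK//.
Qed.

Lemma generating_tail_event (mu : probability (word W) R)
    (M : probability (seq_space (word W)) R) (w : word W) B :
  generating mu -> w <> [::] -> log_moment mu w < +oo -> self_similar mu M ->
  tail_measurable B ->
  exists2 E : set (infinite_word W), measurable E &
    path_law M (B `+` limit_word @^-1` E) = 0.
Proof.
move=> gen w0 fin ss tB.
have w2 : (1 < size (w ++ w))%N by case: w w0 {fin} => // a [|b w].
have mu_letter a := generating_letter a gen.
apply: (tail_event_limit_word ss (generating_nil gen) (nu := sampled mu_letter w2) (w := w ++ w) _ _ _ _ _ tB).
- by move=> C h hC; exact: sampled_harmonic hC.
- by case: (w) w0.
- by move=> g; exact: sampled_end.
- by move=> g; exact: sampled_gt0.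
- by apply: sampled_moment; exact: integral_log_wnorm_square.
Qed.

End tail_events_generating.

(** * Factoring the limit map through the boundary *)

Section limit_factor.
Context {R : realType} {W : alphabet}.
Context {d : measure_display} {T : measurableType d} (Pr : probability T R).
Variables (m : probability (word W) R) (xi : nat -> {mfun T >-> word W}).
Hypothesis m_gt0 : forall g, (0 < m [set g])%E.
Local Open Scope ereal_scope.

Local Notation M := (increments_law Pr xi).
Local Notation Pm := (walk_law_init Pr m xi).

(** Since [m] charges every word, null sets are null from every starting point. *)
Lemma walk_law_init_eq0 A : Pm A = 0 <-> forall g, hit M A g = 0.
Proof.
have E : Pm A = \int[m]_g hit M A g by rewrite integral_word.
rewrite E; split => [E0 g|h0]; last by apply: integral0_eq => g _; exact: h0.
apply/eqP; rewrite eq_le hit_ge0 andbT.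
have : m [set g] * hit M A g <= 0.
  rewrite -E0; apply: (integral_word_ge m (f := hit M A)) => s; exact: hit_ge0.
by rewrite pmule_rle0.
Qed.

Lemma tail_measurable_letter k (a : W) : tail_measurable [set x | limit_word x k = a].
Proof.
split; last by move=> x y /limit_word_tail_equiv /= ->.
rewrite -[X in measurable X]setTI.
exact: (measurable_limit_word measurableT (@measurable_coordinate W k [set a])).
Qed.

(** The event that letter [k] of the limit is [a] is tail measurable, hence agrees mod 0 with the
    preimage of some [C (k, a)] in [G]; countably many such sets suffice to spell the limit word. *)
Lemma limit_word_factor d' (G : measurableType d') (bnd : path_space W -> G) :
  is_bnd Pm bnd -> exists2 L : G -> infinite_word W, measurable_fun setT L &
    forall g, {ae (distribution M (walk_path g)), forall x, L (bnd x) = limit_word x}.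
Proof.
move=> [mbnd bnd_gen _].
have /choice[C CS] : forall ka : nat * W, exists C : set G, measurable C /\
    Pm ([set x | limit_word x ka.1 = ka.2] `+` bnd @^-1` C) = 0.
  move=> [k a]; have [|C mC C0] := bnd_gen [set x | limit_word x k = a].
    have tS := tail_measurable_letter k a; split; first by case: tS.
    exists [set x | limit_word x k = a] => //.
    by apply/walk_law_init_eq0 => g; rewrite setYK /hit preimage_set0 measure0.
  by exists C.
(* The sets for different letters at one position may overlap; removing the overlaps leaves at most
   one letter to choose from. *)
pose U k a := C (k, a) `\` \bigcup_(b in [set b | b <> a]) C (k, b).
pose L g : infinite_word W := fun k => xget point [set a | U k a g].
have LE k a g : U k a g -> L g k = a.
  move=> Uag; apply: xget_unique => // b [Cb _]; apply: contrapT => ba.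
  by case: Uag => _; apply; exists b.
have mC k a : measurable (C (k, a)) by case: (CS (k, a)).
have mU k a : measurable (U k a).
  apply: measurableD => //; rewrite bigcup_mkcond.
  apply: countable_bigcupT_measurable => [|b]; first exact: countableP.
  by case: ifP.
exists L.
  apply: measurable_fun_seq_space => k a.
  rewrite (_ : mkset _ = U k a `|` (~` (\bigcup_b U k b) `&` [set _ | point = a :> W])).
    apply: measurableU => //; apply: measurableI.
      apply: measurableC; apply: countable_bigcupT_measurable => //; exact: countableP.
    have [pa|pa] := pselect (point = a :> W).
      by rewrite (_ : mkset _ = setT)//; apply/seteqP; split.
    by rewrite (_ : mkset _ = set0)//; apply/seteqP; split.
  apply/seteqP; split => [g /= La|g [/LE//|[nU pa]]] /=.
    have [[b _ Ub]|nU] := pselect ((\bigcup_b U k b) g).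
      by left; rewrite -La (LE _ _ _ Ub).
    right; split => //; rewrite -La; apply/esym/xgetPN => b Ub; apply: nU; by exists b.
  by rewrite /L xgetPN// => b Ub; apply: nU; exists b.
move=> g; have : {ae (distribution M (walk_path g)), forall x,
    forall ka, limit_word x ka.1 = ka.2 <-> C ka (bnd x)}.
  apply: ae_countable => -[k a]; apply: ae_setY.
  - by case: (tail_measurable_letter k a).
  - by rewrite -[X in measurable X]setTI; exact: mbnd.
  - by have [_ /walk_law_init_eq0] := CS (k, a); exact.
apply: filterS => x Cx; apply/funext => k; apply: LE; split.
  exact/(Cx (k, limit_word x k)).
by move=> [b /= bx /(Cx (k, b))/= xb]; exact: bx.
Qed.

Lemma poisson_boundary_of_tail_events :
  (forall B, tail_measurable B ->
    exists2 E : set (infinite_word W), measurable E &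
      path_law M (B `+` limit_word @^-1` E) = 0) ->
  infinite_words_are_poisson_boundary (walk_law Pr xi [::]) Pm.
Proof.
move=> tail_limit.
have mlim (E : set (infinite_word W)) : measurable E -> measurable (limit_word @^-1` E).
  by move=> mE; rewrite -[X in measurable X]setTI; exact: measurable_limit_word.
have mod0_limit A : tail_measurable_mod0 Pm A ->
    exists2 E : set (infinite_word W), measurable E &
      path_law M (A `+` limit_word @^-1` E) = 0.
  move=> [mA [B tB /walk_law_init_eq0/(_ [::]) AB]]; have [mB _] := tB.
  have [E mE E0] := tail_limit B tB; exists E => //.
  have aeAB := ae_setY (P := path_law M) mA mB AB.
  have aeBE := ae_setY (P := path_law M) mB (mlim E mE) E0.
  apply: ae_measure_eq0; first by apply: measurableU; apply: measurableD => //; exact: mlim.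
  apply: filterS2 aeAB aeBE => x AxB BxE; rewrite /setY/=; tauto.
split; last exact: mod0_limit.
move=> d' G bnd sG isb; have [mbnd _ bnd_tail] := isb.
have [L mL Lbnd] := limit_word_factor isb; exists L; split => //.
  apply/walk_law_init_eq0 => g.
  apply: (@ae_measure_eq0 _ _ _ (distribution M (walk_path g))); last first.
    by have := Lbnd g; apply: filterS => x Lx /=.
  rewrite (_ : mkset _ = \bigcup_k \bigcup_a ([set x | L (bnd x) k = a] `\`
      [set x | limit_word x k = a])).
    apply: bigcupT_measurable => k; apply: countable_bigcupT_measurable => [|a].
      exact: countableP.
    apply: measurableD; last by case: (tail_measurable_letter k a).
    rewrite -[X in measurable X]setTI.
    exact: (measurableT_comp mL mbnd measurableT (@measurable_coordinate W k [set a])).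
  apply/seteqP; split => x /=; last by move=> [k _ [a _ [/= <- nL]]] LE; apply: nL; rewrite LE.
  move=> nL; apply: contrapT => nex; apply: nL; apply/funext => k; apply: contrapT => nLk.
  by apply: nex; exists k => //; exists (L (bnd x) k) => //; split => //= /esym.
apply: (@factor_isomorphism _ _ _ _ _ _ (path_law M)) => //.
- exact: Lbnd.
- by move=> C mC; apply: mod0_limit; exact: bnd_tail.
Qed.

End limit_factor.

Theorem theorem1p2 (R : realType) (W : alphabet)
    (mu : probability (word W) R) (mu_generating : generating mu)
    (mu_log_moment : exists w : word W,
       w <> [::] /\ (log_moment mu w < +oo)%E)
    (m : probability (word W) R) (m_gt0 : forall g, (0 < m [set g])%E)
    (d : measure_display) (T : measurableType d) (Pr : probability T R)
    (xi : nat -> {mfun T >-> word W}) (xi_iid : iid Pr mu xi) :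
  infinite_words_are_poisson_boundary
    (walk_law Pr xi [::]) (walk_law_init Pr m xi).
Proof.
have [w [w0 fin]] := mu_log_moment.
apply: poisson_boundary_of_tail_events m_gt0 _ => B tB.
exact: generating_tail_event mu_generating w0 fin (increments_law_self_similar xi_iid) tB.
Qed.
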